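(* $$\frac32=\min\Big\{\limsup_{q\to\infty}\frac{p_X(q)}{q} : X\text{ is an infinite Toeplitz subshift}\Big\}.$$ That is, every infinite Toeplitz subshift $X$ satisfies $\limsup_{q\to\infty} p_X(q)/q\ge 3/2$, and there is an infinite Toeplitz subshift for which equality holds.
   Context: A subshift is a closed subset $X\subset\mathcal{A}^{\mathbb{Z}}$ ($\mathcal{A}$ a finite alphabet, product topology) invariant under the left shift homeomorphism $\sigma$; $p_X(q)$ is the number of words of length $q$ appearing in points of $X$. A real $\gamma$ is an additive continuous eigenvalue of $(X,\sigma)$ if there is a nonzero $f\in C(X)$ with $f(\sigma x)=e^{2\pi i\gamma}f(x)$ for all $x\in X$; these form a group $E_X\le(\mathbb{R},+)$ containing $\mathbb{Z}$. The maximal equicontinuous factor (MEF) is the largest equicontinuous topological factor of $(X,\sigma)$. A subshift $X$ is Toeplitz if it is minimal, it is an almost one-to-one extension of its MEF (i.e. the factor map onto the MEF has at least one one-point fiber), and $E_X$ is a subgroup of $(\mathbb{Q},+)$. *)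

(* Defs.v *)
From HB Require Import structures.
From mathcomp Require Import all_boot all_order all_algebra.
From mathcomp Require Import complex.
From mathcomp Require Import all_classical all_reals all_analysis.

Set Implicit Arguments.
Unset Strict Implicit.
Unset Printing Implicit Defensive.

Import Order.TTheory GRing.Theory Num.Theory.
Import numFieldNormedType.Exports.

Local Open Scope classical_set_scope.
Local Open Scope ring_scope.

Notation fullshift A := {ptws int -> discrete_topology A}.

Definition shiftmap (A : finType) (x : fullshift A) : fullshift A :=
  fun i : int => x (i + 1).

Definition subshift (A : finType) (X : set (fullshift A)) : Prop :=
  closed X /\ @shiftmap A @` X = X.

Definition minimal (A : finType) (X : set (fullshift A)) : Prop :=
  X !=set0 /\
  forall Y : set (fullshift A), subshift Y -> Y `<=` X -> Y !=set0 -> Y = X.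

Definition language (A : finType) (X : set (fullshift A)) (q : nat) : set (q.-tuple A) :=
  [set w | exists x, X x /\
           exists i : int, forall k : 'I_q, tnth w k = x (i + (k : nat)%:Z)].

Arguments language [A] X q.

Definition complexity (A : finType) (X : set (fullshift A)) (q : nat) : nat :=
  #|[set w : q.-tuple A | w \in language X q]%SET|.

Definition complexity_limsup (R : realType) (A : finType) (X : set (fullshift A)) :
    \bar R :=
  limn_esup (fun q : nat => ((complexity X q)%:R / q%:R)%:E).

Definition expi (R : realType) (t : R) : R[i] := (cos t +i* sin t)%C.

(* [R[i]] carries no topology of its own; [R[i]^o] has that of the modulus.
   Values of [f] outside [X] are irrelevant. *)
Definition eigenvalues (R : realType) (A : finType) (X : set (fullshift A)) : set R :=
  [set gamma | exists f : fullshift A -> R[i]^o,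
     [/\ {within X, continuous f},
         exists2 x, X x & f x != 0
       & forall x, X x -> f (shiftmap x) = expi (2 * pi * gamma) * f x]].

Arguments eigenvalues R [A] X.

Record dynsys (R : realType) := Dynsys {
  phase :> metricType R ;
  phase_compact : compact [set: phase] ;
  dyn : phase -> phase ;
  dyninv : phase -> phase ;
  dynK : cancel dyn dyninv ;
  dyninvK : cancel dyninv dyn ;
  dyn_continuous : continuous dyn ;
  dyninv_continuous : continuous dyninv }.

Definition iterz (R : realType) (Y : dynsys R) (n : int) : Y -> Y :=
  match n with
  | Posz k => iter k (@dyn R Y)
  | Negz k => iter k.+1 (@dyninv R Y)
  end.

(* The library's [equicontinuous] asks for a pointed codomain; this is its
   metric form for the family of all integer iterates. *)
Definition equicontinuous_dynsys (R : realType) (Y : dynsys R) : Prop :=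
  forall (y : Y) (e : R), 0 < e ->
    \forall z \near y, forall n : int, mdist (iterz n y) (iterz n z) < e.

Definition factor_map (R : realType) (S : topologicalType) (X : set S)
    (s : S -> S) (Y : dynsys R) (p : S -> Y) : Prop :=
  [/\ {within X, continuous p},
      p @` X = [set: Y]
    & forall x, X x -> p (s x) = dyn (p x)].

Definition is_MEF (R : realType) (A : finType) (X : set (fullshift A))
    (Y : dynsys R) (p : fullshift A -> Y) : Prop :=
  [/\ factor_map X (@shiftmap A) p,
      equicontinuous_dynsys Y
    & forall (Z : dynsys R) (r : fullshift A -> Z),
        factor_map X (@shiftmap A) r -> equicontinuous_dynsys Z ->
        exists g : Y -> Z,
          factor_map [set: Y] (@dyn R Y) g /\ forall x, X x -> r x = g (p x)].

Definition almost_one_to_one_over_MEF (R : realType) (A : finType)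
    (X : set (fullshift A)) : Prop :=
  exists (Y : dynsys R) (p : fullshift A -> Y),
    is_MEF X p /\
    exists (y : Y) (x : fullshift A), X `&` p @^-1` [set y] = [set x].

Definition toeplitz (R : realType) (A : finType) (X : set (fullshift A)) : Prop :=
  [/\ minimal X,
      almost_one_to_one_over_MEF R X
    & eigenvalues R X `<=` range (@ratr R)].

(* Main.v *)
(* Lower bound.  If the limsup is below 3/2, some word [w] has exactly two return
   words [u] and [v], and counting right special words shows that, up to exchanging
   [u] and [v], two consecutive [v]'s are separated by either no [u] or exactly [n]
   copies of it; then [v] and [v u^n] are the return words of [v w].
   Iterating, the complexity bound makes the ratio between the phase spread and a
   potential comparable to [min |u| |v|] decay geometrically each time [n >= 2],
   so the slopes of the states pinch a single irrational number [alpha], and the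
   phase of the last cut before the origin converges to an eigenfunction for
   [alpha].  A subshift with only rational eigenvalues is thus excluded.

   Example.  Fill [Z] by periods [(j + 1)!]: the symbol at [i] is the parity of the
   largest [j] such that [(j + 1)!] divides [i - s_j].  A window shorter than
   [(J + 2)!] meets at most one position not determined by the levels up to [J],
   which gives complexity at most [(3/2 + o(1)) q]. *)
From HB Require Import structures.
Require Import Defs.
From mathcomp Require Import all_boot all_order all_algebra.
From mathcomp Require Import all_classical all_reals all_analysis.
From mathcomp Require Import zify ring lra complex.

Set Implicit Arguments.
Unset Strict Implicit.
Unset Printing Implicit Defensive.

Import Order.TTheory GRing.Theory Num.Theory.
Import numFieldNormedType.Exports.

Local Open Scope classical_set_scope.
Local Open Scope ring_scope.

(** * Return words and states *)

(** Where 3/2 enters: for an exponent n >= 2 the word u^(n-1) w and long words ending with v w are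
    right special together, so the complexity grows by two per letter up to length q = |w| +
    (n-1)|u|. With delta = |u| + |v| - |w|, the bound (3/2 - eps) q turns this into (n-2)|u| + 3
    delta <= |v|, up to a margin proportional to eps. The decay is drawn from this inequality. The
    obstacle is that such a step raises delta by (n-1)|u| and that its surplus of right special
    words can outlast it; both have to be carried into the next count. Nor is it enough that slopes
    converge: the phases may grow at a step, and their deviations have to be summable over all
    levels. In the example the parities alternate so that a hole can receive either symbol at one of
    two consecutive levels, which gives minimality; the quotient of consecutive periods tends to
    infinity so that the patterns of shorter period cost only o(q) words. *)

Definition win (A : Type) (x : int -> A) (i : int) (q : nat) : seq A :=
  mkseq (fun k => x (i + k%:Z)) q.

Definition occ (A : Type) (w : seq A) (x : int -> A) (i : int) : Prop :=
  win x i (size w) = w.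

Definition is_factor (A : Type) (X : set (int -> A)) (w : seq A) : Prop :=
  exists x i, X x /\ occ w x i.

Definition right_special (A : Type) (X : set (int -> A)) (w : seq A) : Prop :=
  exists c d, [/\ c <> d, is_factor X (rcons w c) & is_factor X (rcons w d)].

Section Windows.
Variable A : finType.
Implicit Types (x : int -> A) (s t w : seq A) (i j : int).

Lemma size_win x i q : size (win x i q) = q.
Proof. by rewrite size_mkseq. Qed.

Lemma nth_win x i q z k : (k < q)%N -> nth z (win x i q) k = x (i + k%:Z).
Proof. by move=> kq; rewrite nth_mkseq. Qed.

Lemma win_cat x i p q : win x i (p + q) = win x i p ++ win x (i + p%:Z) q.
Proof.
rewrite /win /mkseq iotaD map_cat add0n; congr (_ ++ _).
rewrite -{1}[p]addn0 iotaDl -map_comp; apply: eq_map => k /=.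
by rewrite PoszD addrA.
Qed.

Lemma win_rcons x i q : win x i q.+1 = rcons (win x i q) (x (i + q%:Z)).
Proof. by rewrite -addn1 win_cat /= cats1 addr0. Qed.

Lemma eq_win x y i j q :
  (forall k, (k < q)%N -> x (i + k%:Z) = y (j + k%:Z)) -> win x i q = win y j q.
Proof.
move=> xy; apply/eq_in_map => k; rewrite mem_iota add0n => /andP[_]; exact: xy.
Qed.

Lemma win_eqP x y i j q :
  win x i q = win y j q -> forall k, (k < q)%N -> x (i + k%:Z) = y (j + k%:Z).
Proof.
move=> xy k kq; by rewrite -(nth_win x i (x 0) kq) xy nth_win.
Qed.

Lemma occ_win x i q : occ (win x i q) x i.
Proof. by rewrite /occ size_win. Qed.

Lemma occ_cat s t x i : occ (s ++ t) x i <-> occ s x i /\ occ t x (i + (size s)%:Z).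
Proof.
rewrite /occ size_cat win_cat; split=> [/eqP|[-> ->]//].
by rewrite eqseq_cat ?size_win// => /andP[/eqP ? /eqP ?].
Qed.

Lemma occ_catl s t x i : occ (s ++ t) x i -> occ s x i.
Proof. by case/occ_cat. Qed.

Lemma occ_catr s t x i : occ (s ++ t) x i -> occ t x (i + (size s)%:Z).
Proof. by case/occ_cat. Qed.

Lemma occ_nth w x i z k : occ w x i -> (k < size w)%N -> nth z w k = x (i + k%:Z).
Proof. by move=> wx kw; rewrite -wx nth_win. Qed.

Lemma occ_prefix s t x i : prefix s t -> occ t x i -> occ s x i.
Proof. by move=> /prefixP[r ->] /occ_catl. Qed.

Lemma occ_eq w x y i j :
  (forall k, (k < size w)%N -> x (i + k%:Z) = y (j + k%:Z)) -> occ w y j -> occ w x i.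
Proof. by move=> xy wy; rewrite /occ (eq_win xy). Qed.

Lemma nth_cat_add z s t k : nth z (s ++ t) (size s + k) = nth z t k.
Proof. by rewrite nth_cat ltnNge leq_addr /= addKn. Qed.

Lemma occ_shift w x i n : occ w (fun k => x (k + n)) i <-> occ w x (i + n).
Proof.
have E : win (fun k => x (k + n)) i (size w) = win x (i + n) (size w).
  by apply: eq_win => k _; congr x; lia.
by rewrite /occ E.
Qed.

Definition power n s := flatten (nseq n s).

Arguments power : simpl never.

Lemma powerS n s : power n.+1 s = s ++ power n s. Proof. by []. Qed.

Lemma powerD m n s : power (m + n) s = power m s ++ power n s.
Proof. by elim: m => [//|m IH]; rewrite addSn !powerS IH catA. Qed.

Lemma power1 s : power 1 s = s. Proof. by rewrite powerS cats0. Qed.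

Lemma powerSr n s : power n.+1 s = power n s ++ s.
Proof. by rewrite -addn1 powerD power1. Qed.

Lemma size_power n s : size (power n s) = (n * size s)%N.
Proof. by elim: n => [//|n IH]; rewrite powerS size_cat IH mulSn. Qed.

Lemma prefix_power n s t w :
  prefix w (s ++ w) -> prefix w (t ++ w) -> prefix w (power n s ++ t ++ w).
Proof.
move=> ws wt; elim: n => [//|n IH]; rewrite powerS -catA.
by apply: (prefix_trans ws); rewrite prefix_catr// eqxx.
Qed.

End Windows.

(** The combinatorial content of minimality for an infinite subshift: every factor recurs with a
    uniform gap, and no point has a period. The counting below works from this alone, without
    topology; compactness is used once, in [aperiodic_minimal_subshift]. *)
Record aperiodic_minimal (A : finType) (X : set (int -> A)) : Prop := AperiodicMinimal {
  am_shift : forall x n, X x -> X (fun i => x (i + n));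
  am_recurrent : forall w, is_factor X w -> exists K : nat, forall x, X x ->
    forall j : int, exists2 k : nat, (k <= K)%N & occ w x (j + k%:Z);
  am_aperiodic : forall x (n : nat), X x -> (0 < n)%N -> ~ (forall i, x (i + n%:Z) = x i);
  am_nonempty : X !=set0
}.

(** * Right special words and growth of the complexity *)

Section Language.
Variables (A : finType) (X : set (int -> A)).
Hypothesis amX : aperiodic_minimal X.
Let X_recurrent := am_recurrent amX.
Let X_aperiodic := am_aperiodic amX.
Let X_nonempty := am_nonempty amX.

Lemma occ_factor w x i : X x -> occ w x i -> is_factor X w.
Proof. by move=> Xx wx; exists x, i. Qed.

Lemma factor_cat s t : is_factor X (s ++ t) -> is_factor X s /\ is_factor X t.
Proof.
by move=> [x [i [Xx /occ_cat[sx tx]]]]; split; [exists x, i|exists x, (i + (size s)%:Z)].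
Qed.

Lemma factor_prefix s t : prefix s t -> is_factor X t -> is_factor X s.
Proof. by move=> /prefixP[r ->] /factor_cat[]. Qed.

Lemma factor_win x i q : X x -> is_factor X (win x i q).
Proof. by move=> Xx; exists x, i; split=> //; exact: occ_win. Qed.

Lemma factor_extend w : is_factor X w -> exists c, is_factor X (rcons w c).
Proof.
move=> [x [i [Xx wx]]]; exists (x (i + (size w)%:Z)).
by rewrite -{1}wx -win_rcons; exact: factor_win.
Qed.

(** A window of one point that refutes the period [M.+1] reappears with bounded gaps in every point,
    so the refutation is uniform. *)
Lemma aperiodic_le M : exists K : nat, forall c, (0 < c <= M)%N ->
  forall x i, X x -> exists2 k : nat, (k <= K)%N & x (i + k%:Z + c%:Z) <> x (i + k%:Z).
Proof.
elim: M => [|M [K IH]]; first by exists 0%N => c; lia.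
have [x0 Xx0] := X_nonempty.
have /existsNP[t xt] := X_aperiodic Xx0 (ltn0Sn M).
have [K' rK] := X_recurrent (factor_win t M.+2 Xx0).
exists (maxn K K') => c /andP[c0]; rewrite leq_eqVlt => /orP[/eqP -> x i Xx|cM x i Xx].
  have [k kK /occ_nth ox] := rK _ Xx i; exists k; first by lia.
  have := ox (x 0) 0%N; have := ox (x 0) M.+1.
  by rewrite !size_win !nth_win// !addr0 => <-// <-//.
have [|k kK xk] := IH c _ x i Xx; first by rewrite c0.
by exists k => //; lia.
Qed.

Lemma no_periodic_tail x i c : X x -> (0 < c)%N ->
  ~ (forall t : nat, x (i + t%:Z + c%:Z) = x (i + t%:Z)).
Proof.
move=> Xx c0 per; have [K HK] := aperiodic_le c.
by have [|k _] := HK c _ x i Xx; [rewrite c0 leqnn|rewrite per].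
Qed.

Lemma no_periodic_head x i c : X x -> (0 < c)%N ->
  ~ (forall t : nat, x (i - t%:Z - c%:Z) = x (i - t%:Z)).
Proof.
move=> Xx c0 per; have [K HK] := aperiodic_le c.
have [|k kK] := HK c _ x (i - c%:Z - K%:Z) Xx; first by rewrite c0 leqnn.
have -> : i - c%:Z - K%:Z + k%:Z + c%:Z = i - (K - k)%N%:Z by lia.
have -> : i - c%:Z - K%:Z + k%:Z = i - (K - k)%N%:Z - c%:Z by lia.
by rewrite per.
Qed.

Lemma pigeonhole_win (x : int -> A) q : exists i j : nat, (i < j)%N /\ win x i%:Z q = win x j%:Z q.
Proof.
pose f (i : 'I_#|{:q.-tuple A}|.+1) : q.-tuple A := Tuple (introT eqP (size_win x i%:Z q)).
have /injectivePn[i [j ij fij]] : ~~ injectiveb f.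
  by apply/negP => /injectiveP/leq_card; rewrite card_ord ltnn.
have E : win x i%:Z q = win x j%:Z q := congr1 val fij.
have [lij|lij|/val_inj eij] := ltngtP i j; first by exists i, j.
- by exists j, i.
- by rewrite eij eqxx in ij.
Qed.

(** A word that is not right special has only one possible next letter, so equal windows stay equal
    until a right special word is met. *)
Lemma determined_window x y i j q n : X x -> X y ->
    win x i q = win y j q ->
    (forall t : nat, (t < n)%N -> ~ right_special X (win x (i + t%:Z) q)) ->
  win x i (n + q) = win y j (n + q).
Proof.
move=> Xx Xy; elim: n => [//|n IH] E nrs.
have {}IH : win x i (n + q) = win y j (n + q).
  by apply: IH => // t tn; apply: nrs; lia.
rewrite !addSn !win_rcons IH; congr rcons.
have Eq : win x (i + n%:Z) q = win y (j + n%:Z) q.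
  by apply: eq_win => k kq; have := win_eqP IH (k := (n + k)%N); rewrite !PoszD !addrA; apply; lia.
apply: contrapT => ne; apply: (nrs n (ltnSn n)).
exists (x (i + (n + q)%:Z)), (y (j + (n + q)%:Z)); rewrite {2}Eq; split=> //.
- have -> : i + (n + q)%:Z = i + n%:Z + q%:Z by lia.
  by rewrite -win_rcons; exact: factor_win.
- have -> : j + (n + q)%:Z = j + n%:Z + q%:Z by lia.
  by rewrite -win_rcons; exact: factor_win.
Qed.

(** Otherwise a window seen twice, which exists by the pigeonhole principle, would have the same
    future both times and a tail would be periodic. *)
Lemma exists_right_special q : exists2 r, size r = q & right_special X r.
Proof.
apply: contrapT => nrs; have [x Xx] := X_nonempty.
have [i [j [ij E]]] := pigeonhole_win x q.
apply: (@no_periodic_tail x i%:Z (j - i) Xx); first by lia.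
move=> t.
have E' : win x i%:Z (t.+1 + q) = win x j%:Z (t.+1 + q).
  apply: determined_window => // s _ rs; apply: nrs.
  by exists (win x (i%:Z + s%:Z) q) => //; rewrite size_win.
have -> : i%:Z + t%:Z + (j - i)%N%:Z = j%:Z + t%:Z by lia.
by rewrite -(win_eqP E' (k := t)) //; lia.
Qed.

Lemma right_special_factor r : right_special X r -> is_factor X r.
Proof. by move=> [c [_ [_ /factor_prefix rc _]]]; apply: rc; exact: prefix_rcons. Qed.

Lemma right_special_suffix s r : right_special X (s ++ r) -> right_special X r.
Proof.
by move=> [c [d [cd]]]; rewrite !rcons_cat => /factor_cat[_ rc] /factor_cat[_ rd]; exists c, d.
Qed.

Definition words q : seq (seq A) :=
  [seq tval w | w <- enum [set w : q.-tuple A | `[< is_factor X w >]]%SET].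

Definition cpx q := size (words q).

Lemma mem_words q w : reflect (size w = q /\ is_factor X w) (w \in words q).
Proof.
apply: (iffP mapP) => [[t]|[wq fw]].
  by rewrite mem_enum inE => /asboolP ft ->; rewrite size_tuple.
by exists (Tuple (introT eqP wq)) => //; rewrite mem_enum inE; apply/asboolP.
Qed.

Lemma uniq_words q : uniq (words q).
Proof. by rewrite map_inj_uniq ?enum_uniq//; exact: val_inj. Qed.

(* The words of length [q] outside [C] extend to words outside [B]. *)
Lemma cpx_extend q (B C : seq (seq A)) : uniq B ->
    (forall w, w \in B -> [/\ size w = q.+1, is_factor X w & take q w \in C]) ->
  (size B + cpx q <= cpx q.+1 + size C)%N.
Proof.
move=> uB BP.
have /choice[ext extP] : forall w, exists c, is_factor X w -> is_factor X (rcons w c).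
  move=> w; have [/factor_extend[c wc]|nw] := pselect (is_factor X w); first by exists c.
  by have [x _] := X_nonempty; exists (x 0).
pose D := [seq rcons w (ext w) | w <- words q & w \notin C].
have DP w : w \in D -> [/\ size w = q.+1, is_factor X w & take q w \notin C].
  move=> /mapP[t]; rewrite mem_filter => /andP[tC /mem_words[tq /extP ft]] ->.
  by rewrite size_rcons tq -cats1 take_cat tq ltnn subnn take0 cats0; split=> //; rewrite cats1.
have uBD : uniq (B ++ D).
  rewrite cat_uniq uB /=; apply/andP; split.
    by apply/hasPn => w /DP[_ _ wC]; apply/negP => /BP[_ _ wC']; rewrite wC' in wC.
  by rewrite map_inj_uniq ?filter_uniq ?uniq_words// => s t /rcons_inj[].
have sBD : {subset B ++ D <= words q.+1}.
  by move=> w; rewrite mem_cat => /orP[/BP[? ? _]|/DP[? ? _]]; apply/mem_words.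
have := uniq_leq_size uBD sBD; rewrite size_cat size_map size_filter.
have : (count (mem C) (words q) <= size C)%N.
  rewrite -size_filter; apply: uniq_leq_size; first by rewrite filter_uniq// uniq_words.
  by move=> w; rewrite mem_filter => /andP[].
have : (count (mem C) (words q) + count (fun w => w \notin C) (words q))%N = cpx q.
  exact: count_predC.
by move=> <- E2 E3; rewrite addnCA [leqLHS]addnC; exact: leq_add.
Qed.

Lemma cpx_right_special q (r : seq (seq A)) : uniq r ->
    (forall w, w \in r -> size w = q /\ right_special X w) ->
  (cpx q + size r <= cpx q.+1)%N.
Proof.
move=> ur rP.
have /choice[e eP] : forall w, exists cd : A * A, right_special X w ->
    [/\ cd.1 <> cd.2, is_factor X (rcons w cd.1) & is_factor X (rcons w cd.2)].
  move=> w; have [[c [d H]]|nw] := pselect (right_special X w); first by exists (c, d).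
  by have [x _] := X_nonempty; exists (x 0, x 0).
pose B := [seq rcons w (e w).1 | w <- r] ++ [seq rcons w (e w).2 | w <- r].
have := @cpx_extend q B r; rewrite size_cat !size_map; suff H : uniq B /\
    forall w, w \in B -> [/\ size w = q.+1, is_factor X w & take q w \in r].
  by move=> /(_ H.1 H.2); lia.
split=> [|w]; last first.
  rewrite mem_cat => /orP[] /mapP[t tr ->]; have [tq /eP[_ ? ?]] := rP _ tr;
  by rewrite size_rcons tq -cats1 take_cat tq ltnn subnn take0 cats0; split=> //; rewrite cats1.
rewrite cat_uniq !map_inj_uniq ?ur/= ?andbT; last 2 first.
- by move=> s t /rcons_inj[].
- by move=> s t /rcons_inj[].
apply/hasPn => w /mapP[t tr ->]; apply/negP => /mapP[s _ /rcons_inj[<-]].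
by have [_ /eP[ne _ _]] := rP _ tr; move/esym.
Qed.

Lemma cpx_lt q : (cpx q < cpx q.+1)%N.
Proof.
have [r rq rs] := exists_right_special q.
by have := @cpx_right_special q [:: r] isT; rewrite addn1; apply=> w /[!inE] /eqP ->.
Qed.

Lemma cpx_mono p q : (p <= q)%N -> (cpx p + (q - p) <= cpx q)%N.
Proof.
elim: q => [|q IH pq]; first by rewrite leqn0 => /eqP ->; rewrite addn0.
have := cpx_lt q; have [pq'|pq'] := leqP p q; first by have := IH pq'; lia.
have -> : p = q.+1 by lia.
by rewrite subnn addn0.
Qed.

(** Where the complexity grows by one, this leaves at most two letters after a right special word,
    hence two return words. *)
Lemma cpx_three_followers q w c d e : size w = q -> uniq [:: c; d; e] ->
  is_factor X (rcons w c) -> is_factor X (rcons w d) -> is_factor X (rcons w e) ->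
  (cpx q + 2 <= cpx q.+1)%N.
Proof.
move=> wq u fc fd fe.
have := @cpx_extend q [seq rcons w a | a <- [:: c; d; e]] [:: w].
rewrite size_map map_inj_uniq ?u; last by move=> ? ? /rcons_inj[].
rewrite [size _]/= [size [:: w]]/= => /(_ isT); suff H : forall v, v \in [seq rcons w a | a <- [:: c; d; e]] ->
    [/\ size v = q.+1, is_factor X v & take q v \in [:: w]] by move=> /(_ H); lia.
move=> v /mapP[a] /[!inE] ae ->.
rewrite size_rcons wq -cats1 take_cat wq ltnn subnn take0 cats0 eqxx cats1; split=> //.
by case/or3P: ae => /eqP ->.
Qed.

(** [state_next] lets the letter after [w] decide which block follows, which also makes [w] right
    special. [state_last] separates the letters before [w], so that right special words ending with
    [u ++ w] and with [v ++ w] are counted apart. *)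
Record state (u v w : seq A) : Prop := State {
  state_return : forall x i, X x -> occ w x i ->
    (occ (u ++ w) x i /\ forall k, (0 < k < size u)%N -> ~ occ w x (i + k%:Z)) \/
    (occ (v ++ w) x i /\ forall k, (0 < k < size v)%N -> ~ occ w x (i + k%:Z));
  state_sizel : (0 < size u)%N;
  state_sizer : (0 < size v)%N;
  state_factorl : is_factor X (u ++ w);
  state_factorr : is_factor X (v ++ w);
  state_prefixl : prefix w (u ++ w);
  state_prefixr : prefix w (v ++ w);
  state_last : forall z, last z u <> last z v;
  state_next : forall z, nth z (u ++ w) (size w) <> nth z (v ++ w) (size w)
}.

Lemma state_sym u v w : state u v w -> state v u w.
Proof.
case=> ret ? ? ? ? ? ? nl nn; split=> // [x i Xx wx|z|z].
- by case: (ret x i Xx wx) => ?; [right|left].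
- by move=> /esym; exact: nl.
- by move=> /esym; exact: nn.
Qed.

Lemma state_exclusive u v w x i : state u v w -> occ (u ++ w) x i -> occ (v ++ w) x i -> False.
Proof.
move=> st ou ov; apply: (@state_next _ _ _ st (x 0)).
rewrite (occ_nth _ ou) ?(occ_nth _ ov)// size_cat.
- by have := state_sizer st; lia.
- by have := state_sizel st; lia.
Qed.

Lemma state_right_special u v w t : state u v w ->
  is_factor X (t ++ u ++ w) -> is_factor X (t ++ v ++ w) -> right_special X (t ++ w).
Proof.
move=> st; have [x _] := X_nonempty; have := @state_next _ _ _ st (x 0).
have [/prefixP[[|c s] E] /prefixP[[|d r] F]] := (state_prefixl st, state_prefixr st).
- by have := congr1 size E; have := state_sizel st; rewrite !size_cat /=; lia.
- by have := congr1 size E; have := state_sizel st; rewrite !size_cat /=; lia.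
- by have := congr1 size F; have := state_sizer st; rewrite !size_cat /=; lia.
rewrite E F !nth_cat ltnn subnn /= => cd.
by rewrite -!cat_rcons !catA -!rcons_cat => /factor_cat[? _] /factor_cat[? _]; exists c, d.
Qed.

Lemma run_to_next u v w x : state u v w -> X x -> forall d i,
  occ w x i -> occ (v ++ w) x (i + d%:Z) -> exists k, occ (power k u ++ v ++ w) x i.
Proof.
move=> st Xx; elim/ltn_ind => d IH i wx vx.
have [[ux none]|[vx' _]] := state_return st Xx wx; last by exists 0%N.
have [d0|d0] := posnP d.
  by rewrite d0 addr0 in vx; case: (state_exclusive st ux vx).
have ud : (size u <= d)%N.
  rewrite leqNgt; apply/negP => du; apply: (none d); first by rewrite d0.
  exact: occ_prefix (state_prefixr st) vx.
have [||k kx] := IH (d - size u)%N _ (i + (size u)%:Z) (occ_catr ux).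
- by have := state_sizel st; lia.
- by have -> : i + (size u)%:Z + (d - size u)%N%:Z = i + d%:Z by lia.
by exists k.+1; rewrite powerS -catA; apply/occ_cat; split=> //; exact: occ_catl ux.
Qed.

(** Otherwise [s] would repeat forever and give a periodic tail. *)
Lemma not_forced_return s t : (0 < size s)%N -> is_factor X t ->
  ~ (forall x i, X x -> occ t x i -> occ (s ++ t) x i).
Proof.
move=> s0 [x [i [Xx tx]]] H.
have {}tx m : occ t x (i + (m * size s)%N%:Z).
  elim: m => [|m IH]; first by rewrite addr0.
  have /occ_catr := H _ _ Xx IH.
  by have -> : i + (m * size s)%N%:Z + (size s)%:Z = i + (m.+1 * size s)%N%:Z by lia.
have sx m := occ_catl (H _ _ Xx (tx m)).
apply: (@no_periodic_tail x i (size s) Xx s0) => n.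
have nE := divn_eq n (size s); have ns : (n %% size s < size s)%N by rewrite ltn_mod.
have := occ_nth (x 0) (sx (n %/ size s)%N) ns.
have := occ_nth (x 0) (sx (n %/ size s).+1%N) ns => ->.
by move=> E; rewrite {1 2}nE; move: E; congr (x _ = x _); rewrite ?mulSn; lia.
Qed.

(** Both spacings are required to occur, since they become the two return words of the next
    state. *)
Definition forced_power u v w n := [/\ is_factor X (v ++ v ++ w),
  is_factor X (v ++ power n u ++ v ++ w) &
  forall x i, X x -> occ (v ++ w) x i ->
    occ (v ++ v ++ w) x i \/ occ (v ++ power n u ++ v ++ w) x i].

(* The lengths of the maximal runs of [u] between two consecutive [v] include a
   positive one; a second positive length makes a run right special. *)
Lemma forced_power_or_right_special u v w : state u v w ->
  (exists2 n, (0 < n)%N & forced_power u v w n) \/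
  (exists2 j, (0 < j)%N & right_special X (v ++ power j u ++ w)).
Proof.
move=> st; pose run k := is_factor X (v ++ power k u ++ v ++ w).
have runP x i : X x -> occ (v ++ w) x i -> exists2 k, run k & occ (v ++ power k u ++ v ++ w) x i.
  move=> Xx vx; have [K rK] := X_recurrent (state_factorr st).
  have [d _ dx] := rK _ Xx (i + (size v)%:Z).
  have [k kx] := run_to_next st Xx (occ_catr vx) dx.
  have okx : occ (v ++ power k u ++ v ++ w) x i by apply/occ_cat; split=> //; exact: occ_catl vx.
  by exists k => //; exact: occ_factor okx.
have npow n : ~ (forall k, run k -> k = n).
  move=> uniq_run; apply: (@not_forced_return (v ++ power n u) (v ++ w)).
  - by rewrite size_cat; have := state_sizer st; lia.
  - exact: state_factorr st.
  - by move=> x i Xx /(runP _ _ Xx)[k /uniq_run ->]; rewrite -catA.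
have [[j [M [j0 jM rj rM]]]|nojM] := pselect (exists j M, [/\ (0 < j)%N, (j < M)%N, run j & run M]).
  right; exists j => //; rewrite catA; apply: (state_right_special st); last by rewrite -catA.
  move: rM; rewrite /run -(subnKC jM) powerD powerSr -!catA; apply: factor_prefix.
  do 3 (rewrite prefix_catr// eqxx /=); apply: prefix_power.
  - exact: state_prefixl st.
  - exact: state_prefixr st.
left; have /existsNP[n /not_implyP[rn /eqP n0]] := npow 0%N.
rewrite -lt0n in n0.
have onlyn k : run k -> (0 < k)%N -> k = n.
  move=> rk k0; apply: contrapT => /eqP; rewrite neq_ltn => /orP[kn|nk]; apply: nojM.
    by exists k, n.
  by exists n, k.
have r0 : run 0%N.
  have /existsNP[k /not_implyP[rk kn]] := npow n; have [k0|k0] := posnP k; first by rewrite -k0.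
  by have := onlyn _ rk k0.
exists n => //; split=> // x i Xx /(runP _ _ Xx)[k rk kx].
have [k0|k0] := posnP k; first by left; move: kx; rewrite k0.
by right; move: kx; rewrite (onlyn _ rk k0).
Qed.

(** Inside a run every cut starts a copy of [u], and [v ++ w] cannot start where [u ++ w] does. This
    is what makes [v ++ power n u] a first return to [v ++ w]. *)
Lemma power_occurrences u v w n x i : state u v w -> X x ->
  occ (power n u ++ v ++ w) x i ->
  forall k, (k < n * size u)%N -> ~ occ (v ++ w) x (i + k%:Z).
Proof.
move=> st Xx; elim: n i => [|n IH] i; first by [].
rewrite powerS -catA => ox k kn vx.
have wx : occ w x i.
  apply: occ_prefix ox; have := @prefix_power A n.+1 u v w; rewrite powerS -catA.
  by apply; [exact: state_prefixl st|exact: state_prefixr st].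
have owx : occ (u ++ w) x i.
  apply: occ_prefix ox; rewrite prefix_catr// eqxx /=; apply: prefix_power.
  - exact: state_prefixl st.
  - exact: state_prefixr st.
have [[_ none]|[vx' _]] := state_return st Xx wx; last exact: state_exclusive st owx vx'.
have [k0|k0] := posnP k.
  by rewrite k0 addr0 in vx; exact: state_exclusive st owx vx.
have [ku|uk] := ltnP k (size u).
  by apply: (none k); [rewrite k0|exact: occ_prefix (state_prefixr st) vx].
apply: (IH _ (occ_catr ox) (k - size u)%N); first by rewrite mulSn in kn; lia.
by have -> : i + (size u)%:Z + (k - size u)%N%:Z = i + k%:Z by lia.
Qed.

(** The letter conditions are inherited: [v ++ power n u] ends with [u], and past the common prefix
    [v] it continues as [u ++ w]. *)
Lemma state_step u v w n : state u v w -> (0 < n)%N -> forced_power u v w n ->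
  state v (v ++ power n u) (v ++ w).
Proof.
move=> st n0 [fvv fvuv vP].
have pu := state_prefixl st; have pv := state_prefixr st.
have [z0 _] := X_nonempty.
have runs x i : X x -> occ (v ++ w) x i -> forall k, (0 < k < size v)%N -> ~ occ (v ++ w) x (i + k%:Z).
  move=> Xx vx k kv /(occ_prefix pv) wk.
  have [[ux _]|[_ none]] := state_return st Xx (occ_prefix pv vx).
    exact: state_exclusive st ux vx.
  exact: none k kv wk.
split=> //.
- move=> x i Xx vx; have [vvx|vuvx] := vP _ _ Xx vx; [left|right]; split=> //.
  + exact: runs.
  + by rewrite -catA.
  + move=> k /andP[k0]; rewrite size_cat => kv.
    have [kv'|vk] := ltnP k (size v); first by apply: runs => //; rewrite k0.
    have := @power_occurrences u v w n x _ st Xx (occ_catr vuvx) (k - size v)%N.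
    have -> : i + (size v)%:Z + (k - size v)%N%:Z = i + k%:Z by lia.
    by apply; rewrite size_power in kv; lia.
- exact: state_sizer st.
- by rewrite size_cat; have := state_sizer st; lia.
- by rewrite -catA.
- by rewrite prefix_catr// eqxx.
- by rewrite -catA prefix_catr// eqxx /=; apply: prefix_power.
- move=> z; case: n n0 {vP fvuv} => // n _; rewrite powerSr catA last_cat => H.
  by apply: (@state_last _ _ _ st (last z (v ++ power n u))); rewrite -H; case: (v) (state_sizer st).
- move=> z; case: n n0 {vP fvuv} => // n _; rewrite size_cat powerS -!catA !nth_cat_add => H.
  apply: (@state_next _ _ _ st z); rewrite H.
  have : prefix (u ++ w) (u ++ power n u ++ v ++ w).
    by rewrite prefix_catr// eqxx /=; apply: prefix_power.
  move=> /prefixP[r]; rewrite -!catA => ->; rewrite catA [RHS]nth_cat ifT//.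
  by rewrite size_cat; have := state_sizel st; lia.
Qed.

Lemma suffix_split (s t : seq A) : suffix s t -> exists r : seq A, t = r ++ s.
Proof. by case/suffixP => r ->; exists r. Qed.

(** From a common occurrence one advances by whole blocks. A block is decided by the letter after
    [w], so points sharing that letter share the whole block; a block reaching over the first
    disagreement is therefore impossible, and some occurrence of [w] ends right before it. [m]
    bounds the distance still to go. *)
Lemma last_occurrence u v w x y i j n : state u v w -> X x -> X y ->
  (forall k, (k < n)%N -> x (i + k%:Z) = y (j + k%:Z)) -> x (i + n%:Z) <> y (j + n%:Z) ->
  forall m k, (n - k <= m)%N -> (k + size w <= n)%N -> occ w x (i + k%:Z) ->
  occ w x (i + (n - size w)%N%:Z).
Proof.
move=> st Xx Xy agree differ; elim=> [|m IH] k nk kn wx.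
  have -> : (n - size w)%N = k by lia.
  by [].
have [E|E] := eqVneq (k + size w)%N n.
  have -> : (n - size w)%N = k by lia.
  by [].
have {E}kn' : (k + size w < n)%N by rewrite ltn_neqAle E.
have wy : occ w y (j + k%:Z).
  apply: occ_eq wx => l lw.
  by have := agree (k + l)%N; rewrite !PoszD !addrA => ->//; lia.
have key u' v' : state u' v' w -> occ (u' ++ w) x (i + k%:Z) ->
    occ w x (i + (n - size w)%N%:Z).
  move=> st' ux; have s0 := state_sizel st'.
  have uy : occ (u' ++ w) y (j + k%:Z).
    have [[]//|[vy _]] := state_return st' Xy wy.
    case: (@state_next _ _ _ st' (x 0)).
    rewrite (occ_nth _ ux) ?size_cat; last by lia.
    rewrite (occ_nth _ vy) ?size_cat; last by have := state_sizer st'; lia.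
    by have := agree (k + size w)%N kn'; rewrite !PoszD !addrA.
  have [kun|nku] := leqP (k + size u' + size w) n.
    apply: (IH (k + size u')%N) => //; first by lia.
    by have := occ_catr ux; rewrite PoszD addrA.
  have nku' : (n - k < size (u' ++ w))%N by rewrite size_cat; lia.
  case: differ; have := occ_nth (x 0) ux nku'; rewrite (occ_nth _ uy nku').
  have -> : i + k%:Z + (n - k)%N%:Z = i + n%:Z by lia.
  by have -> : j + k%:Z + (n - k)%N%:Z = j + n%:Z by lia.
have [[ux _]|[vx _]] := state_return st Xx wx; first exact: key st ux.
exact: key (state_sym st) vx.
Qed.

(* After an occurrence of [w] the next letter fixes the block that follows, so
   branching can only happen right after [w]. *)
Lemma right_special_ends u v w r k x i : state u v w -> right_special X r ->
  X x -> occ r x i -> (k + size w <= size r)%N -> occ w x (i + k%:Z) -> suffix w r.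
Proof.
move=> st [c [d [cd [y [j [Xy cy]]] [z [l [Xz dz]]]]]] Xx rx kr wx.
move: cy dz; rewrite -!cats1 => /occ_cat[ry cy] /occ_cat[rz dz].
have wy : occ w y (j + k%:Z).
  apply: occ_eq wx => m mw.
  have mr : (k + m < size r)%N by lia.
  by rewrite -!addrA -PoszD -(occ_nth (x 0) ry mr) (occ_nth (x 0) rx mr).
have := @last_occurrence u v w y z j l (size r) st Xy Xz.
move=> /(_ _ _ (size r) k (leq_subr _ _) kr wy) H.
have {}H : occ w y (j + (size r - size w)%N%:Z).
  apply: H => [m mr|E]; first by rewrite -(occ_nth (x 0) ry mr) (occ_nth (x 0) rz mr).
  apply: cd; move: cy dz => /(occ_nth (x 0)) cy /(occ_nth (x 0)) dz.
  by have := cy 0%N isT; have := dz 0%N isT; rewrite /= !addr0 => -> ->.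
apply/suffixP; exists (win y j (size r - size w)).
by rewrite -[X in _ ++ X]H -win_cat subnK//; lia.
Qed.

(** A right special word exceeding the recurrence gap of [w] contains [w], hence ends with it, and
    its suffixes remain right special. *)
Lemma long_right_special u v w Q : state u v w -> (size w <= Q)%N ->
  exists r, [/\ size r = Q, right_special X r & suffix w r].
Proof.
move=> st wQ; have [K rK] := X_recurrent (factor_cat (state_factorl st)).2.
have [r rs rr] := exists_right_special (Q + K).
have [x [i [Xx rx]]] := right_special_factor rr.
have [k kK wx] := rK _ Xx i.
have /suffix_split[t rE] : suffix w r by apply: (right_special_ends st rr Xx rx _ wx); lia.
have st' : (size t + size w)%N = (Q + K)%N by rewrite -size_cat -rE.
exists (drop K t ++ w); split; last exact: suffix_suffix.
  by rewrite size_cat size_drop; lia.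
by apply: (@right_special_suffix (take K t)); rewrite catA cat_take_drop -rE.
Qed.

Lemma right_special_shorten (s r : seq A) Q : right_special X r -> suffix s r ->
  (size s <= Q <= size r)%N -> exists t, [/\ size t = Q, right_special X t & suffix s t].
Proof.
move=> rr /suffix_split[t rE] /andP[sQ Qr].
have E : (size t + size s)%N = size r by rewrite -size_cat -rE.
exists (drop (size r - Q) t ++ s); split; last exact: suffix_suffix.
  by rewrite size_cat size_drop; lia.
by apply: (@right_special_suffix (take (size r - Q) t)); rewrite catA cat_take_drop -rE.
Qed.

Lemma suffix_last (z : A) u w : (0 < size u)%N -> forall s, suffix (last z u :: w) (s ++ u ++ w).
Proof.
case/lastP: u => // u c _ s; rewrite last_rcons cat_rcons catA; exact: suffix_suffix.
Qed.

(* Lengths between [size w] and [e] have a right special word other than those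
   ending with [w], which accounts for the growth still missing in the bound. *)
Record budget (u v w : seq A) (delta e : nat) : Prop := Budget {
  budget_delta : (size w + delta = size u + size v)%N;
  budget_cpx : forall Q, (size w <= Q)%N -> (Q + delta <= cpx Q.+1 + (e - Q))%N;
  budget_extra : forall Q, (size w < Q <= e)%N ->
    exists r, [/\ size r = Q, right_special X r & ~~ suffix w r];
  budget_end : (e <= 2 * (delta + minn (size u) (size v)))%N
}.

Lemma budget_sym u v w delta e : budget u v w delta e -> budget v u w delta e.
Proof. by case=> dE ? ? ?; split=> //; [rewrite dE addnC|rewrite minnC]. Qed.

(** Right special words are counted length by length. Up to [size w + k] the suffixes of [r1] and
    [r2] differ in the letter before [w]; up to [e] the budget adds a word that does not even end
    with [w]. The three are distinct, so their contributions to the growth add up. *)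
Lemma two_branches u v w delta e r1 r2 c d k : state u v w -> budget u v w delta e ->
  right_special X r1 -> suffix (c :: w) r1 -> right_special X r2 -> suffix (d :: w) r2 ->
  c <> d -> (size w + k <= size r1)%N -> (size w + k <= size r2)%N ->
  forall Q, (size w <= Q)%N ->
  (Q + delta + (minn e Q - size w) + (minn (size w + k) Q - size w)
    <= cpx Q.+1 + (e - size w))%N.
Proof.
move=> st bg rr1 sr1 rr2 sr2 cd kr1 kr2; elim=> [|Q IH] wQ.
  by have := budget_cpx bg wQ; lia.
have [{}wQ|Qw] := leqP (size w) Q; last by have := budget_cpx bg wQ; lia.
have {IH} := IH wQ.
have H (r : seq (seq A)) : uniq r ->
    (forall w, w \in r -> size w = Q.+1 /\ right_special X w) ->
    (cpx Q.+1 + size r <= cpx Q.+2)%N by exact: cpx_right_special.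
have sufw a r : suffix (a :: w) r -> suffix w r.
  by move=> /suffixP[t ->]; rewrite -cat_rcons suffix_suffix.
have ne12 t1 t2 : suffix (c :: w) t1 -> suffix (d :: w) t2 -> t1 != t2.
  move=> /suffixP[t ->] /suffixP[s ->]; apply/eqP; rewrite -!cat_rcons => /eqP.
  rewrite -[rcons t c ++ w]revK -[rcons s d ++ w]revK (can_eq revK) !rev_cat.
  by rewrite eqseq_cat// !rev_rcons eqxx /= eqseq_cons => /andP[/eqP].
have [Qe|eQ] := ltnP Q e; have [Qk|kQ] := ltnP Q (size w + k).
- have [|t [tQ rt nt]] := budget_extra bg (Q := Q.+1); first by lia.
  have [|t1 [t1Q rt1 st1]] := right_special_shorten (Q := Q.+1) rr1 sr1; first by rewrite /=; lia.
  have [|t2 [t2Q rt2 st2]] := right_special_shorten (Q := Q.+1) rr2 sr2; first by rewrite /=; lia.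
  have nt1 : t != t1 by apply/eqP => E'; move: nt; rewrite E' (sufw _ _ st1).
  have nt2 : t != t2 by apply/eqP => E'; move: nt; rewrite E' (sufw _ _ st2).
  have H' := H [:: t; t1; t2] ltac:(by rewrite /= !inE negb_or nt1 nt2 ne12).
  have : (cpx Q.+1 + 3 <= cpx Q.+2)%N by apply: H' => w'; rewrite !inE => /or3P[] /eqP ->.
  by lia.
- have [|t [tQ rt nt]] := budget_extra bg (Q := Q.+1); first by lia.
  have [|t1 [t1Q rt1 st1]] := @long_right_special u v w Q.+1 st; first by lia.
  have nt1 : t != t1 by apply/eqP => E'; move: nt; rewrite E' st1.
  have H' := H [:: t; t1] ltac:(by rewrite /= !inE nt1).
  have : (cpx Q.+1 + 2 <= cpx Q.+2)%N by apply: H' => w'; rewrite !inE => /orP[] /eqP ->.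
  by lia.
- have [|t1 [t1Q rt1 st1]] := right_special_shorten (Q := Q.+1) rr1 sr1; first by rewrite /=; lia.
  have [|t2 [t2Q rt2 st2]] := right_special_shorten (Q := Q.+1) rr2 sr2; first by rewrite /=; lia.
  have H' := H [:: t1; t2] ltac:(by rewrite /= !inE ne12).
  have : (cpx Q.+1 + 2 <= cpx Q.+2)%N by apply: H' => w'; rewrite !inE => /orP[] /eqP ->.
  by lia.
- by have := cpx_lt Q.+1; lia.
Qed.

Lemma budget_step1 u v w delta e : state u v w -> budget u v w delta e ->
  budget v (v ++ power 1 u) (v ++ w) delta e.
Proof.
move=> st [dE bc be bd]; split.
- by rewrite power1 !size_cat; lia.
- by move=> Q; rewrite size_cat => wQ; apply: bc; lia.
- move=> Q; rewrite size_cat => wQ; have [|r [rQ rr nr]] := be Q; first by lia.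
  exists r; split=> //; apply: contra nr => /suffixP[t ->].
  by rewrite catA suffix_suffix.
- by rewrite power1 size_cat; lia.
Qed.

(** In a full run the last [n] copies of [u] are followed by [v], and the first [n] by one more
    [u]. *)
Lemma power_right_special u v w n : state u v w -> forced_power u v w n.+1 ->
  right_special X (power n u ++ w).
Proof.
move=> st [_ fvuv _].
have pu := state_prefixl st; have pv := state_prefixr st.
apply: (state_right_special st).
  have [_] := factor_cat fvuv; rewrite powerSr -catA; apply: factor_prefix.
  by do 2 (rewrite prefix_catr// eqxx /=).
by have [_] := factor_cat fvuv; rewrite powerS -catA => /factor_cat[].
Qed.

(** One branch is [power m.+1 u ++ w]. The other is borrowed from the next state, which has
    arbitrarily long right special words ending with [v ++ w]. *)
Lemma power_branches u v w delta e m : state u v w -> budget u v w delta e ->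
  forced_power u v w m.+2 -> forall Q, (size w <= Q)%N ->
  (Q + delta + (minn e Q - size w) + (minn (size w + m.+1 * size u) Q - size w)
    <= cpx Q.+1 + (e - size w))%N.
Proof.
move=> st bg fp; have [x0 _] := X_nonempty; pose z := x0 0.
have [r [rQ rr /suffix_split[t rE]]] :=
  @long_right_special _ _ _ (size w + m.+1 * size u + size v) (state_step st (ltn0Sn _) fp)
   ltac:(rewrite size_cat; lia).
have sufv : suffix (last z v :: w) r by rewrite rE; exact: suffix_last (state_sizer st) _.
have sufu : suffix (last z u :: w) (power m.+1 u ++ w).
  by rewrite powerSr -catA; exact: suffix_last (state_sizel st) _.
apply: (two_branches st bg (power_right_special st fp) sufu rr sufv).
- exact: (state_last st).
- by rewrite size_cat size_power addnC.
- by rewrite rQ; lia.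
Qed.

(** This covers the failure of both orientations: each crossed word ends with a different block
    before [w] and is at least as long as [u], [v] and [w] together. *)
Lemma crossed_branches u v w delta e j k : state u v w -> budget u v w delta e ->
  (0 < j)%N -> right_special X (v ++ power j u ++ w) ->
  (0 < k)%N -> right_special X (u ++ power k v ++ w) ->
  forall Q, (size w <= Q)%N ->
  (Q + delta + (minn e Q - size w) + (minn (size w + (size u + size v)) Q - size w)
    <= cpx Q.+1 + (e - size w))%N.
Proof.
move=> st bg; case: j => // j _ rj; case: k => // k _ rk.
have [x0 _] := X_nonempty; pose z := x0 0.
apply: (two_branches (c := last z u) (d := last z v) st bg rj _ rk).
- by rewrite powerSr -catA catA; exact: suffix_last (state_sizel st) _.
- by rewrite powerSr -catA catA; exact: suffix_last (state_sizer st) _.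
- exact: (state_last st).
- by rewrite !size_cat size_power; lia.
- by rewrite !size_cat size_power; lia.
Qed.

(** The surplus of right special words given by [power m.+1 u ++ w] lasts up to its length, which is
    the new end. With [budget_end], the inequality between [delta] and [size v] puts the old end
    below the length of [v ++ w], so a single surplus is alive in the new state. *)
Lemma budget_step2 u v w delta e m : state u v w -> budget u v w delta e ->
  forced_power u v w m.+2 ->
  (m * size u + 3 * delta <= size v)%N -> (e <= size w + m.+1 * size u)%N ->
  budget v (v ++ power m.+2 u) (v ++ w)
    (delta + m.+1 * size u) (size w + m.+1 * size u).
Proof.
move=> st bg fp legal eend; have [dE bc be bd] := bg.
have [x0 _] := X_nonempty; pose z := x0 0.
have u0 := state_sizel st; have v0 := state_sizer st.
split.
- by rewrite !size_cat size_power; lia.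
- move=> Q; rewrite size_cat => wQ.
  by have := @power_branches u v w delta e m st bg fp Q; lia.
- move=> Q; rewrite size_cat => /andP[wQ Qe].
  have sufu : suffix (last z u :: w) (power m.+1 u ++ w).
    by rewrite powerSr -catA; exact: suffix_last.
  have [|t [tQ rt ut]] := right_special_shorten (Q := Q) (power_right_special st fp) sufu.
    by rewrite size_cat size_power /=; lia.
  exists t; split=> //; apply/negP => /suffixP[s sE].
  have vt : suffix (last z v :: w) t by rewrite sE; exact: suffix_last.
  apply: (state_last st (z := z)).
  move: ut vt => /suffixP[a ->] /suffixP[b]; rewrite -!cat_rcons => /eqP.
  rewrite -[rcons a _ ++ w]revK -[rcons b _ ++ w]revK (can_eq revK) !rev_cat.
  by rewrite eqseq_cat// !rev_rcons eqxx /= eqseq_cons => /andP[/eqP].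
- by rewrite size_cat size_power; lia.
Qed.

End Language.

(** * Construction of a first state *)

Section InitialState.
Variables (A : finType) (X : set (int -> A)).
Hypothesis amX : aperiodic_minimal X.
Let X_nonempty := am_nonempty amX.
Implicit Types (u v w s t r : seq A) (x y : int -> A).

Lemma exists_previous w x i : is_factor X w -> X x ->
  exists2 k : nat, occ w x (i - k%:Z) & forall l, (l < k)%N -> ~ occ w x (i - l%:Z).
Proof.
move=> fw Xx; have [K rK] := am_recurrent amX fw.
have ex : exists k : nat, `[< occ w x (i - k%:Z) >].
  have [k kK wx] := rK _ Xx (i - K%:Z); exists (K - k)%N; apply/asboolP.
  by have -> : i - (K - k)%N%:Z = i - K%:Z + k%:Z by lia.
exists (ex_minn ex); first by case: ex_minnP => k /asboolP.
move=> l; case: ex_minnP => k _ kmin lk /asboolP/kmin; lia.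
Qed.

Lemma exists_next w x i : is_factor X w -> X x ->
  exists2 k : nat, occ w x (i + k%:Z) & forall l, (l < k)%N -> ~ occ w x (i + l%:Z).
Proof.
move=> fw Xx; have [K rK] := am_recurrent amX fw.
have ex : exists k : nat, `[< occ w x (i + k%:Z) >].
  by have [k kK wx] := rK _ Xx i; exists k; apply/asboolP.
exists (ex_minn ex); first by case: ex_minnP => k /asboolP.
move=> l; case: ex_minnP => k _ kmin lk /asboolP/kmin; lia.
Qed.

Lemma occ1 x i : occ [:: x i] x i.
Proof. by congr [:: x _]; rewrite addr0. Qed.

Lemma take_drop_occ s x i k q : occ s x i -> (k + q <= size s)%N ->
  take q (drop k s) = win x (i + k%:Z) q.
Proof.
move=> <-; rewrite size_win => kq.
have -> : size s = (k + (q + (size s - k - q)))%N by lia.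
rewrite win_cat drop_size_cat ?size_win// win_cat take_size_cat ?size_win//.
Qed.

(** As [w] is a prefix of [u ++ w], the length of [u] is a period of [w], and long factors have no
    short period. *)
Lemma state_size_large M : exists K, forall u v w, state X u v w -> (K <= size w)%N ->
  (M < size u)%N.
Proof.
have [K HK] := aperiodic_le amX M; exists K.+1 => u v w st Kw.
rewrite ltnNge; apply/negP => uM.
have [x [i [Xx ux]]] := state_factorl st.
have wx := occ_prefix (state_prefixl st) ux.
have [|k kK] := HK (size u) _ x i Xx; first by rewrite uM (state_sizel st).
apply; have kw : (k < size w)%N by lia.
rewrite -(occ_nth (x 0) wx kw) (occ_nth (x 0) (occ_catr ux) kw); congr x; lia.
Qed.

Section FirstReturn.
Variables (w : seq A) (c d : A).
Hypothesis unique_rs : forall r, size r = size w -> right_special X r -> r = w.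

Definition first_return u x i :=
  [/\ X x, occ (u ++ w) x i & forall k, (0 < k < size u)%N -> ~ occ w x (i + k%:Z)].

(** Strictly between two cuts no word of this length is right special, so a window there determines
    the sequence up to the next cut: the distance to that cut and the letter before it can be read
    off. *)
Lemma first_return_window u u' x x' i i' k k' z :
  first_return u x i -> first_return u' x' i' ->
  (0 < k < size u)%N -> (0 < k' < size u')%N ->
  win x (i + k%:Z) (size w) = win x' (i' + k'%:Z) (size w) ->
  (size u - k <= size u' - k')%N ->
  (size u - k)%N = (size u' - k')%N /\ last z u = last z u'.
Proof.
move=> [Xx ux nx] [Xx' ux' nx'] /andP[k0 ku] /andP[k0' ku'] E le.
have E' : win x (i + k%:Z) (size u - k + size w) = win x' (i' + k'%:Z) (size u - k + size w).
  apply: (determined_window Xx Xx' E) => t tu rs.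
  apply: (nx (k + t)%N); first by lia.
  have -> : i + (k + t)%N%:Z = i + k%:Z + t%:Z by lia.
  by rewrite /occ; apply: unique_rs rs; rewrite size_win.
have reach : (size u - k = size u' - k')%N.
  apply/eqP; rewrite eqn_leq le leqNgt; apply/negP => lt.
  apply: (nx' (k' + (size u - k))%N); first by lia.
  apply: occ_eq (occ_catr ux) => l lw.
  have := win_eqP E' (k := (size u - k + l)%N) ltac:(lia).
  have -> : i + k%:Z + (size u - k + l)%N%:Z = i + (size u)%:Z + l%:Z by lia.
  by move=> ->; congr x'; lia.
split=> //.
have := win_eqP E' (k := (size u - k).-1) ltac:(lia).
rewrite -!nth_last (occ_nth z (occ_catl ux)); last by lia.
rewrite (occ_nth z (occ_catl ux')); last by lia.
have -> : i + k%:Z + (size u - k).-1%:Z = i + (size u).-1%:Z by lia.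
by have -> : i' + k'%:Z + (size u - k).-1%:Z = i' + (size u').-1%:Z by lia.
Qed.

Lemma exists_first_return e : is_factor X (rcons w e) ->
  exists u, [/\ (0 < size u)%N, is_factor X (u ++ w), prefix w (u ++ w),
    (forall z, nth z (u ++ w) (size w) = e) &
    forall x i, X x -> occ (rcons w e) x i -> first_return u x i].
Proof.
move=> [x [i [Xx ex]]].
have wx : occ w x i by move: ex; rewrite -cats1; exact: occ_catl.
have [a ax na] := exists_next (i + 1) (occ_factor Xx wx) Xx.
have ux : occ (win x i a.+1 ++ w) x i.
  apply/occ_cat; split; first exact: occ_win.
  by rewrite size_win; have -> : i + a.+1%:Z = i + 1 + a%:Z by lia.
have uE : win x i a.+1 ++ w = win x i (size w + a.+1).
  by rewrite -ux size_cat size_win addnC.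
have none k : (0 < k < a.+1)%N -> ~ occ w x (i + k%:Z).
  move=> ka; have := na k.-1 ltac:(lia).
  by have -> : i + 1 + k.-1%:Z = i + k%:Z by lia.
exists (win x i a.+1); split=> //.
- exact: occ_factor ux.
- by rewrite uE win_cat wx prefix_prefix.
- move=> z; rewrite uE nth_win; last by lia.
  by rewrite -(occ_nth z ex) ?size_rcons// nth_rcons ltnn eqxx.
move=> x' i' Xx' ex'.
have E1 : win x (i + 1) (size w) = win x' (i' + 1) (size w).
  apply: eq_win => k kw.
  have := occ_nth (x 0) ex (k := k.+1); have := occ_nth (x 0) ex' (k := k.+1).
  rewrite size_rcons => /(_ ltac:(lia)) -> /(_ ltac:(lia)) E.
  have -> : i + 1 + k%:Z = i + k.+1%:Z by lia.
  have -> : i' + 1 + k%:Z = i' + k.+1%:Z by lia.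
  by rewrite E.
have E2 : win x (i + 1) (a + size w) = win x' (i' + 1) (a + size w).
  apply: (determined_window Xx Xx' E1) => t tu rs.
  apply: (none t.+1); first by lia.
  have -> : i + t.+1%:Z = i + 1 + t%:Z by lia.
  by rewrite /occ; apply: unique_rs rs; rewrite size_win.
have agree k : (k < a.+1 + size w)%N -> x' (i' + k%:Z) = x (i + k%:Z).
  case: k => [|k] kaw.
    have := occ_nth (x 0) ex (k := 0%N); have := occ_nth (x 0) ex' (k := 0%N).
    by rewrite size_rcons => /(_ isT) -> /(_ isT).
  have := win_eqP E2 (k := k) ltac:(lia).
  have -> : i + 1 + k%:Z = i + k.+1%:Z by lia.
  by have -> : i' + 1 + k%:Z = i' + k.+1%:Z by lia.
split=> //.
  by apply: occ_eq ux => k; rewrite size_cat size_win; exact: agree.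
rewrite size_win => k ka wk; apply: (none k ka); apply: occ_eq wk => l lw.
by rewrite -!addrA -!PoszD agree//; lia.
Qed.
End FirstReturn.

(** Forced letters are added on the left. If this never stopped, two occurrences of [r] in one point
    would have the same infinite past, and the point would have a periodic head. *)
Lemma left_special_extension r : is_factor X r ->
  exists s c d, [/\ c <> d, is_factor X (c :: s ++ r), is_factor X (d :: s ++ r) &
    forall x i, X x -> occ r x i -> occ (s ++ r) x (i - (size s)%:Z)].
Proof.
move=> fr; pose P s := forall x i, X x -> occ r x i -> occ (s ++ r) x (i - (size s)%:Z).
apply: contrapT => none.
have extend s : P s -> exists c, P (c :: s).
  move=> Ps; have [x [i [Xx rx]]] := fr.
  exists (x (i - (size s)%:Z - 1)) => y j Xy ry.
  have occ_ext z k : X z -> occ r z k -> occ (z (k - (size s)%:Z - 1) :: s ++ r) z (k - (size s)%:Z - 1).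
    move=> Xz rz; rewrite -cat1s; apply/occ_cat; split; first exact: occ1.
    by have := Ps _ _ Xz rz; rewrite /= subrK.
  have [E|ne] := pselect (y (j - (size s)%:Z - 1) = x (i - (size s)%:Z - 1)).
    rewrite -E; have := occ_ext _ _ Xy ry.
    by have -> : j - (size s)%:Z - 1 = j - (size (y (j - (size s)%:Z - 1) :: s))%:Z by move=> /=; lia.
  case: none; exists s, (y (j - (size s)%:Z - 1)), (x (i - (size s)%:Z - 1)); split=> //.
  - by exists y, (j - (size s)%:Z - 1); split=> //; exact: occ_ext.
  - by exists x, (i - (size s)%:Z - 1); split=> //; exact: occ_ext.
have all n : exists2 s, size s = n & P s.
  elim: n => [|n [s <- Ps]]; first by exists [::] => // x i _; rewrite /= subr0.
  by have [c Pc] := extend _ Ps; exists (c :: s).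
have [x [i [Xx rx]]] := fr.
have [k kx _] := exists_next (i + 1) fr Xx.
apply: (@no_periodic_head A X amX x (i + k%:Z) k.+1 Xx (ltn0Sn _)) => t.
have [s sE Ps] := all t.+1.
have := Ps _ _ Xx rx; have := Ps _ _ Xx kx.
move=> /occ_catl/(occ_nth (x 0)) E1 /occ_catl/(occ_nth (x 0)) E2.
have := E1 0%N; have := E2 0%N; rewrite sE => /(_ isT) -> /(_ isT).
have -> : i - t.+1%:Z + 0%:Z = i + k%:Z - t%:Z - k.+1%:Z by lia.
by have -> : i + 1 + k%:Z - t.+1%:Z + 0%:Z = i + k%:Z - t%:Z by lia.
Qed.

(** Growth by one leaves a single right special word [r0], with two followers. Extending it on the
    left by [s] until the preceding letter is free is what separates the last letters of the two
    return words. *)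
Lemma initial_state M Q1 :
  (forall Q, exists2 Q', (Q <= Q')%N & cpx X Q'.+1 = (cpx X Q').+1) ->
  exists u v w delta, [/\ state X u v w, budget X u v w delta 0,
    (Q1 <= size w)%N, (M < size u)%N & (M < size v)%N].
Proof.
move=> often; have [K large] := state_size_large M.
have [Q0 Q0ge Q0E] := often (maxn K Q1).
have unique0 r r' : size r = Q0 -> right_special X r -> size r' = Q0 -> right_special X r' -> r = r'.
  move=> sr rr sr' rr'; apply/eqP; apply: contraT => ne.
  have := @cpx_right_special A X amX Q0 [:: r; r'] ltac:(by rewrite /= inE ne).
  rewrite Q0E /= => H; have : (cpx X Q0 + 2 <= (cpx X Q0).+1)%N; last by lia.
  by apply: H => t; rewrite !inE => /orP[] /eqP ->.
have [r0 r0Q rs0] := exists_right_special amX Q0.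
have [s [l1 [l2 [l12 fl1 fl2 sP]]]] := left_special_extension (right_special_factor rs0).
set w := s ++ r0; have [c [d [cd fc0 fd0]]] := rs0.
have sizew : size w = (size s + Q0)%N by rewrite size_cat r0Q.
have ext t : is_factor X (r0 ++ t) -> is_factor X (w ++ t).
  move=> [x [i [Xx /occ_cat[rx tx]]]]; exists x, (i - (size s)%:Z); split=> //.
  apply/occ_cat; split; first exact: sP.
  by rewrite sizew -r0Q; have -> : i - (size s)%:Z + (size s + size r0)%N%:Z = i + (size r0)%:Z by lia.
have fc : is_factor X (rcons w c) by rewrite -cats1; apply: ext; rewrite cats1.
have fd : is_factor X (rcons w d) by rewrite -cats1; apply: ext; rewrite cats1.
have unique_rs r : size r = size w -> right_special X r -> r = w.
  move=> sr rr; have E : drop (size s) r = r0.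
    apply: unique0 => //; first by rewrite size_drop sr sizew; lia.
    by apply: (@right_special_suffix _ _ (take (size s) r)); rewrite cat_take_drop.
  have [x [i [Xx rx]]] := right_special_factor rr.
  have wx : occ w x i.
    have := rx; rewrite -{1}(cat_take_drop (size s) r) E => /occ_catr.
    by rewrite size_takel; [move=> /(sP _ _ Xx); rewrite addrK|lia].
  by rewrite -rx sr.
have only x i : X x -> occ w x i -> occ (rcons w c) x i \/ occ (rcons w d) x i.
  move=> Xx wx; set a := x (i + (size w)%:Z).
  have ax : occ (rcons w a) x i.
    by rewrite -cats1; apply/occ_cat; split=> //; exact: occ1.
  have [<-|ac] := eqVneq a c; first by left.
  have [<-|ad] := eqVneq a d; first by right.
  have fa : is_factor X (rcons r0 a).
    by have := occ_factor Xx ax; rewrite -cats1 -catA cats1 => /factor_cat[].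
  have := @cpx_three_followers A X amX Q0 r0 a c d r0Q.
  rewrite /= !inE negb_or ac ad /= andbT => /(_ _ fa fc0 fd0).
  by have -> : c != d by [apply/eqP]; rewrite Q0E => /(_ isT); lia.
have [u [u0 fu pu nu uP]] := exists_first_return unique_rs fc.
have [v [v0 fv pv nv vP]] := exists_first_return unique_rs fd.
have ret x i : X x -> occ w x i -> first_return w u x i \/ first_return w v x i.
  by move=> Xx wx; case: (only x i Xx wx) => ex; [left; exact: uP|right; exact: vP].
have last_block x i k : X x -> occ w x (i - k%:Z) ->
    (forall m, (m < k)%N -> ~ occ w x (i - m%:Z)) ->
    (first_return w u x (i - k%:Z) /\ (k < size u)%N) \/
    (first_return w v x (i - k%:Z) /\ (k < size v)%N).
  move=> Xx wx nk; have key t : (0 < size t)%N -> first_return w t x (i - k%:Z) -> (k < size t)%N.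
    move=> t0 [_ /occ_catr tx _]; rewrite ltnNge; apply/negP => tk.
    apply: (nk (k - size t)%N); first by lia.
    by have -> : i - (k - size t)%N%:Z = i - k%:Z + (size t)%:Z by lia.
  by case: (ret x _ Xx wx) => H; [left|right]; split=> //; exact: key H.
have st : state X u v w.
  split=> //.
  - by move=> x i Xx /(ret _ _ Xx)[][_ ? ?]; [left|right].
  - move=> z E; apply: l12.
    suff H l : is_factor X (l :: w) -> l = last z u by rewrite (H _ fl1) (H _ fl2).
    move=> [x [i [Xx]]]; rewrite -cat1s => /occ_cat[lx wx].
    have -> : l = x i by have := occ_nth z lx (k := 0%N) isT; rewrite /= addr0.
    have [k kx nk] := exists_previous i (factor_cat fu).2 Xx.
    have key t : (0 < size t)%N -> first_return w t x (i - k%:Z) -> (k < size t)%N -> x i = last z t.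
      move=> t0 [_ tx nt] kt.
      have E' : (size t).-1 = k.
        apply/eqP; rewrite eqn_leq andbC -ltnS prednK// kt /= leqNgt; apply/negP => ltk.
        apply: (nt k.+1); first by lia.
        by have -> : i - k%:Z + k.+1%:Z = i + (size [:: l])%:Z by rewrite /=; lia.
      by rewrite -nth_last E' (occ_nth z (occ_catl tx))// subrK.
    by case: (last_block x i k Xx kx nk) => -[H1 H2]; [|rewrite E]; exact: key H1 H2.
  - by move=> z; rewrite nu nv.
have [x0 _] := X_nonempty; pose z := x0 0.
(* The windows of length [size w] inside the two blocks are all the words of that length; the only
   coincidence among them is at offset 0, where both blocks give [w]. *)
pose W t k := take (size w) (drop k (t ++ w)).
have WE t x i k : occ (t ++ w) x i -> (k <= size t)%N -> W t k = win x (i + k%:Z) (size w).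
  by move=> tx kt; apply: take_drop_occ => //; rewrite size_cat; lia.
have upper : (cpx X (size w) <= size u + size v)%N.
  have sub : {subset words X (size w) <=
      [seq W u k | k <- iota 0 (size u)] ++ [seq W v k | k <- iota 0 (size v)]}.
    move=> t /mem_words[tw [x [i [Xx tx]]]].
    have [k kx nk] := exists_previous i (factor_cat fu).2 Xx.
    have E s' : first_return w s' x (i - k%:Z) -> (k < size s')%N -> W s' k = t.
      by move=> [_ sx _] ks; rewrite (WE _ _ _ _ sx) ?subrK 1?ltnW// -tw.
    rewrite mem_cat; apply/orP.
    case: (last_block x i k Xx kx nk) => -[H1 H2]; [left|right]; apply/mapP; exists k => //.
    - by rewrite mem_iota.
    - by rewrite (E _ H1 H2).
    - by rewrite mem_iota.
    - by rewrite (E _ H1 H2).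
  apply: leq_trans (uniq_leq_size (uniq_words X _) sub) _.
  by rewrite size_cat !size_map !size_iota.
have [xu [iu [Xu cu]]] := fc; have frU := uP _ _ Xu cu.
have [xv [iv [Xv dv]]] := fd; have frV := vP _ _ Xv dv.
have lower : (size u + size v <= (cpx X (size w)).+1)%N.
  (* [W v 0] equals [W u 0], hence the second range starts at 1. *)
  pose B := [seq W u k | k <- iota 0 (size u)] ++ [seq W v k | k <- iota 1 (size v).-1].
  have wW t x i : first_return w t x i -> prefix w (t ++ w) -> W t 0%N = w.
    by move=> [_ tx _] pt; rewrite (WE _ _ _ _ tx)// addr0; exact: occ_prefix pt tx.
  have Ww t x i k : first_return w t x i -> (0 < k < size t)%N -> W t k <> w.
    move=> [_ tx nt] kt E; apply: (nt k kt).
    by rewrite /occ -(WE _ _ _ _ tx)//; lia.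
  have cross t t' x x' i i' k k' : first_return w t x i -> first_return w t' x' i' ->
      prefix w (t ++ w) -> prefix w (t' ++ w) -> (k < size t)%N -> (0 < k' < size t')%N ->
      W t k = W t' k' -> (size t - k = size t' - k')%N /\ last z t = last z t'.
    move=> fr fr' pt pt' kt kt' E; have [k0|k0] := posnP k.
      by case: (Ww _ _ _ _ fr' kt'); rewrite -E k0; exact: wW fr pt.
    have [_ tx _] := fr; have [_ tx' _] := fr'.
    rewrite (WE _ _ _ _ tx) ?(WE _ _ _ _ tx') in E; [|lia..].
    have [le|le] := leqP (size t - k) (size t' - k').
      by apply: (first_return_window unique_rs z fr fr') => //; rewrite k0.
    have k1 : (0 < k < size t)%N by rewrite k0.
    by have [-> ->] := first_return_window unique_rs z fr' fr kt' k1 (esym E) (ltnW le).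
  have inj t x i : first_return w t x i -> prefix w (t ++ w) ->
      {in iota 0 (size t) &, injective (W t)}.
    move=> fr pt k l; rewrite !mem_iota !add0n => /= kt lt E.
    have [l0|l0] := posnP l.
      have [k0|k0] := posnP k; first by rewrite k0 l0.
      have k1 : (0 < k < size t)%N by rewrite k0.
      by case: (Ww _ _ _ _ fr k1); rewrite E l0; exact: wW fr pt.
    have lt' : (0 < l < size t)%N by rewrite l0.
    have [] := cross _ _ _ _ _ _ _ _ fr fr pt pt kt lt' E; lia.
  have uB : uniq B.
    rewrite cat_uniq map_inj_in_uniq ?iota_uniq; last exact: inj frU pu.
    rewrite map_inj_in_uniq ?iota_uniq ?andbT; last first.
      by move=> k l; rewrite !mem_iota => kv lv; apply: (inj _ _ _ frV pv); rewrite ?mem_iota; lia.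
    apply/hasPn => _ /mapP[l + ->]; rewrite mem_iota => lv; apply/negP => /mapP[k].
    rewrite mem_iota => ku /esym E.
    have ku' : (k < size u)%N by lia.
    have lv' : (0 < l < size v)%N by lia.
    have [_ E'] := cross _ _ _ _ _ _ _ _ frU frV pu pv ku' lv' E.
    exact: (state_last st) E'.
  have sB : {subset B <= words X (size w)}.
    have key t x i k : first_return w t x i -> (k < size t)%N -> W t k \in words X (size w).
      move=> [Xx tx _] kt; apply/mem_words; rewrite (WE _ _ _ _ tx); last exact: ltnW.
      by rewrite size_win; split=> //; exact: factor_win.
    move=> t; rewrite mem_cat => /orP[] /mapP[k + ->]; rewrite mem_iota => kt.
      by apply: (key _ _ _ _ frU); lia.
    by apply: (key _ _ _ _ frV); lia.
  have sizeB : size B = (size u + (size v).-1)%N by rewrite size_cat !size_map !size_iota.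
  have : (size B <= cpx X (size w))%N by exact: uniq_leq_size uB sB.
  by rewrite sizeB; lia.
exists u, v, w, (size u + size v - size w)%N.
(* This makes the truncated subtraction defining the initial [delta] exact. *)
have le : (size w <= size u + size v)%N.
  by have := @cpx_mono A X amX 0%N (size w) isT; lia.
split=> //.
- split=> //.
  - by lia.
  - by move=> Q wQ; have := @cpx_mono A X amX (size w) Q.+1 ltac:(lia); lia.
  - by move=> Q; lia.
- by lia.
- by apply: (large u v w st); lia.
- by apply: (large v u w (state_sym st)); lia.
Qed.

End InitialState.

(** * The potential of a state *)

Section Potential.
Variable R : realType.
Implicit Types (x y d eps : R).

(** A step multiplies the determinant by its exponent n, so the potential has to gain more than n.
    The smaller length alone may not: legality, (n-2) x + 3 d <= y, gives n x <= y only when 3 d / 2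
    reaches x. Below that threshold the length is discounted, by at most 3, and the step repays the
    discount by raising [d]. *)
Definition potential x y d : R :=
  let m := Num.min x y in Num.min m (Num.max (m / 3) (3 * d / 2)).

Lemma potential_sym x y d : potential x y d = potential y x d.
Proof. by rewrite /potential (minC x y). Qed.

Lemma potential_le x y d : potential x y d <= Num.min x y.
Proof. by rewrite /potential ge_min lexx. Qed.

Lemma potential_ge x y d : 0 < x -> 0 < y -> Num.min x y / 3 <= potential x y d.
Proof.
move=> x0 y0; rewrite /potential le_min le_max lexx /= andbT.
have : 0 < Num.min x y by rewrite lt_min x0.
by lra.
Qed.

Lemma potential_gt0 x y d : 0 < x -> 0 < y -> 0 < potential x y d.
Proof.
move=> x0 y0; apply: lt_le_trans (potential_ge d x0 y0).
by rewrite divr_gt0// lt_min x0.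
Qed.

Lemma potential_step1 x y d : 0 < x -> potential x y d <= potential y (y + x) d.
Proof.
move=> x0; rewrite /potential.
have -> : Num.min y (y + x) = y by apply/min_idPl; lra.
have H : Num.min x y <= y by rewrite ge_min lexx orbT.
rewrite le_min; apply/andP; split; first by apply: le_trans H; rewrite ge_min lexx.
rewrite ge_min; apply/orP; right; rewrite ge_max !le_max lexx !orbT andbT.
by apply/orP; left; lra.
Qed.

Lemma potential_step2 x y d eps (m : nat) : 0 < x -> 0 < y -> 0 <= d ->
  0 < eps -> eps <= 1 / 4 ->
  m%:R * x + 3 * d + eps * (m.+2%:R * x + y) <= y ->
  (1 + eps) * m.+2%:R * potential x y d <= potential y (m.+2%:R * x + y) (d + m.+1%:R * x).
Proof.
move=> x0 y0 d0 e0 e4.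
have -> : m.+2%:R = m%:R + 2 :> R by rewrite -addn2 natrD.
have -> : m.+1%:R = m%:R + 1 :> R by rewrite -addn1 natrD.
(* Integrality of [m] enters the real inequalities only through this dichotomy. *)
have : m%:R = 0 :> R \/ 1 <= m%:R :> R.
  by case: m => [|m]; [left|right; rewrite ler1n].
have := ler0n R m; move: m%:R => {}m m0 m01 legal.
set F := potential x y d.
have M0 : 0 <= m * x by apply: mulr_ge0 => //; exact: ltW.
have eM0 : 0 <= eps * (m * x) by apply: mulr_ge0 => //; exact: ltW.
have ex0 : 0 < eps * x by exact: mulr_gt0.
have ey0 : 0 < eps * y by exact: mulr_gt0.
have eM4 : eps * (m * x) <= 1/4 * (m * x) by rewrite ler_wpM2r.
have ex4 : eps * x <= 1/4 * x by rewrite ler_wpM2r// ltW.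
have legal' : m * x + 3 * d + (eps * (m * x) + 2 * (eps * x) + eps * y) <= y by lra.
suff [F1 F2] : (1 + eps) * (m + 2) * F <= y /\ (1 + eps) * (m + 2) * F <= 3 * (d + (m + 1) * x) / 2.
  rewrite {1}/potential.
  have -> : Num.min y ((m + 2) * x + y) = y by apply/min_idPl; lra.
  by rewrite le_min F1 le_max F2 orbT.
have c0 : 0 <= (1 + eps) * (m + 2) by apply: mulr_ge0; lra.
(* In each case [G] is the active branch of the potential, which leaves linear inequalities once the
   products with [eps] and [m] are bounded. *)
suff [G [FG G1 G2]] : exists G, [/\ F <= G, (1 + eps) * (m + 2) * G <= y &
    (1 + eps) * (m + 2) * G <= 3 * (d + (m + 1) * x) / 2].
  by split; apply: le_trans (ler_wpM2l c0 FG) _.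
have [xy|yx] := leP x y.
  have FE : F = Num.min x (Num.max (x / 3) (3 * d / 2)).
    by rewrite /F /potential; move/min_idPl: xy => ->.
  have Fx : F <= x by rewrite FE ge_min lexx.
  have [dx|xd] := leP x (3 * d / 2); first by exists x; split=> //; lra.
  have Fmax : F <= Num.max (x / 3) (3 * d / 2) by rewrite FE ge_min lexx orbT.
  have [dx|dx] := leP (3 * d / 2) (x / 3).
    exists (x / 3); split.
    - by move: Fmax; move/max_idPl: dx => ->.
    - case: m01 => [mE|m1]; first by rewrite mE in legal' *; lra.
      have : x <= m * x by rewrite ler_peMl// ltW.
      by lra.
    - by lra.
  exists (3 * d / 2); split.
  - by move: Fmax; move/ltW/max_idPr: dx => ->.
  - have Nd : m * (3 * d / 2) <= m * x by rewrite ler_wpM2l// ltW.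
    have eNd : eps * (m * (3 * d / 2)) <= eps * (m * x) by rewrite ler_wpM2l// ltW.
    have ed : eps * (3 * d / 2) <= eps * x by rewrite ler_wpM2l// ltW.
    by lra.
  - have Nd : m * (3 * d / 2) <= m * x by rewrite ler_wpM2l// ltW.
    have Nd0 : 0 <= m * (3 * d / 2) by apply: mulr_ge0 => //; lra.
    have eNd : eps * (m * (3 * d / 2)) <= 1/4 * (m * (3 * d / 2)) by rewrite ler_wpM2r.
    have ed : eps * (3 * d / 2) <= 1/4 * (3 * d / 2) by rewrite ler_wpM2r//; lra.
    by lra.
have FE : F = Num.min y (Num.max (y / 3) (3 * d / 2)).
  by rewrite /F /potential; move/ltW/min_idPr: yx => ->.
have Fmax : F <= Num.max (y / 3) (3 * d / 2) by rewrite FE ge_min lexx orbT.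
(* Here [y < x], and legality with [m >= 1] would give [x <= y]; so the exponent is 2. *)
have mE : m = 0.
  case: m01 => // m1; have : x <= m * x by rewrite ler_peMl// ltW.
  by lra.
rewrite mE in legal' *.
have ed : eps * d <= eps * (y / 3) by rewrite ler_wpM2l ?ltW//; lra.
have ed4 : eps * d <= 1/4 * d by rewrite ler_wpM2r.
have ey4 : eps * y <= 1/4 * y by rewrite ler_wpM2r// ltW.
have [dx|dx] := leP (3 * d / 2) (y / 3).
  exists (y / 3); split; [by move: Fmax; move/max_idPl: dx => ->|lra|lra].
by exists (3 * d / 2); split; [by move: Fmax; move/ltW/max_idPr: dx => ->|lra|lra].
Qed.

End Potential.

(** * Constraints on a state from complexity below 3/2 *)

Section Arithmetic.
Variable R : realType.
Implicit Types (e d m U V W C eps : R).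

(** If the older surplus outlasts the new one, the complexity near [e] is at least [e + d + U],
    which is [3 e / 2] or more by [budget_end]. The factor 2 in [budget_end] is tuned for this
    contradiction. *)
Lemma arith_power_overlap e d m U W C eps :
  e + d + (m + 1) * U <= C -> C <= (3 / 2 - eps) * (e + 1) -> e <= 2 * (d + U) ->
  eps * W <= eps * e -> 3 <= eps * W -> 0 < eps -> 0 <= m * U -> False.
Proof. lra. Qed.

(** Substituting W = U + V - d turns the slope bound at length W + (m+1) U into legality. The
    conditions [3 <= eps * _] absorb the additive constants. *)
Lemma arith_power d m U V W C eps :
  W + (m + 1) * U + d + (m + 1) * U <= C -> C <= (3 / 2 - eps) * (W + (m + 1) * U + 1) ->
  W + d = U + V -> 3 <= eps * U -> 3 <= eps * V -> 3 <= eps * W -> 0 < eps ->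
  0 <= m * U ->
  m * U + 3 * d + eps * ((m + 2) * U + V) <= V.
Proof.
move=> H1 H2 WE eU eV eW e0 M0.
have {}WE : W = U + V - d by lra.
subst W; have eM0 : 0 <= eps * (m * U) by apply: mulr_ge0 => //; exact: ltW.
have d3 : 3 * d <= V + 3 by lra.
have ed3 : eps * (3 * d) <= eps * (V + 3) by rewrite ler_pM2l.
by lra.
Qed.

(** With W = U + V - d the count equals 3 (U + V), while 3/2 of the length W + U + V is at most
    that; the margin in [eps] makes the bound fail. *)
Lemma arith_crossed d U V W C eps :
  W + (U + V) + d + (U + V) <= C -> C <= (3 / 2 - eps) * (W + (U + V) + 1) ->
  W + d = U + V -> 3 <= eps * U -> 3 <= eps * V -> 3 <= eps * W -> 0 < eps -> 0 <= d ->
  False.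
Proof. move=> H1 H2 WE *; have {}WE : U + V = W + d by []. by lra. Qed.

End Arithmetic.

Section Legality.
Variables (R : realType) (A : finType) (X : set (int -> A)).
Hypothesis amX : aperiodic_minimal X.
Variables (eps : R) (Qmin : nat).
Hypothesis eps_gt0 : 0 < eps.
Hypothesis cpx_bound : forall Q, (Qmin <= Q)%N -> (cpx X Q)%:R <= (3 / 2 - eps) * Q%:R :> R.
Implicit Types (u v w : seq A).

Record good u v w (delta e : nat) : Prop := Good {
  good_state : state X u v w;
  good_budget : budget X u v w delta e;
  good_min : (Qmin <= size w)%N;
  good_largew : 3 <= eps * (size w)%:R;
  good_largeu : 3 <= eps * (size u)%:R;
  good_largev : 3 <= eps * (size v)%:R
}.

Lemma good_sym u v w delta e : good u v w delta e -> good v u w delta e.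
Proof. by case=> st bg *; split=> //; [exact: state_sym|exact: budget_sym]. Qed.

Lemma good_delta u v w delta e : good u v w delta e ->
  (size w)%:R + delta%:R = (size u)%:R + (size v)%:R :> R.
Proof. by move=> gd; rewrite -!natrD (budget_delta (good_budget gd)). Qed.

(** The count is evaluated at the length where the new pair of branches ends, or at [e] if the older
    surplus lasts longer; the latter case is contradictory. *)
Lemma good_legal u v w delta e m : good u v w delta e -> forced_power X u v w m.+2 ->
  m%:R * (size u)%:R + 3 * delta%:R + eps * (m.+2%:R * (size u)%:R + (size v)%:R)
    <= (size v)%:R :> R /\
  (e <= size w + m.+1 * size u)%N.
Proof.
move=> gd fp; have [st bg wmin lw lu lv] := gd; have dE := good_delta gd.
have br := power_branches amX st bg fp; have eb := budget_end bg.
have M0 : 0 <= m%:R * (size u)%:R :> R by rewrite -natrM.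
set q := (size w + m.+1 * size u)%N in br *.
have [eq|qe] := leqP e q; last first.
  exfalso; have := br e ltac:(lia); have wq : (size w <= q)%N by lia.
  have -> : minn e e = e by lia.
  have -> : minn q e = q by lia.
  rewrite addnAC leq_add2r => H.
  apply: (@arith_power_overlap R e%:R delta%:R m%:R (size u)%:R (size w)%:R (cpx X e.+1)%:R eps) => //.
  - by rewrite natr1 -natrM -!natrD ler_nat; lia.
  - by rewrite natr1; apply: cpx_bound; lia.
  - by rewrite -natrD -natrM ler_nat; lia.
  - by rewrite ler_pM2l// ler_nat; lia.
split=> //.
have := br q ltac:(lia).
have -> : minn e q = e by lia.
rewrite minnn => H.
have -> : m.+2%:R = m%:R + 2 :> R by rewrite -addn2 natrD.
apply: (@arith_power R delta%:R m%:R (size u)%:R (size v)%:R (size w)%:R (cpx X q.+1)%:R eps) => //.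
- by rewrite natr1 -natrM -!natrD ler_nat; lia.
- by rewrite !natr1 -natrM -natrD natr1; apply: cpx_bound; lia.
Qed.

Lemma good_forced_power u v w delta e : good u v w delta e ->
  (exists2 n, (0 < n)%N & forced_power X u v w n) \/
  (exists2 n, (0 < n)%N & forced_power X v u w n).
Proof.
move=> gd; have [st bg wmin lw lu lv] := gd; have dE := good_delta gd.
have [|[j j0 rj]] := forced_power_or_right_special amX st; first by left.
have [|[k k0 rk]] := forced_power_or_right_special amX (state_sym st); first by right.
exfalso; have br := crossed_branches amX st bg j0 rj k0 rk; have eb := budget_end bg.
set q := (size w + (size u + size v))%N in br.
have [eq|qe] := leqP e q.
  have := br q ltac:(lia).
  have -> : minn e q = e by lia.
  rewrite minnn => H.
  apply: (@arith_crossed R delta%:R (size u)%:R (size v)%:R (size w)%:R (cpx X q.+1)%:R eps) => //.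
  - by rewrite -!natrD ler_nat; lia.
  - by rewrite -!natrD natr1; apply: cpx_bound; lia.
have := br e ltac:(lia).
have -> : minn e e = e by lia.
have -> : minn q e = q by lia.
rewrite addnAC leq_add2r => H.
apply: (@arith_power_overlap R e%:R delta%:R 0 (size v)%:R (size w)%:R (cpx X e.+1)%:R eps) => //.
- by rewrite add0r mul1r -!natrD ler_nat; lia.
- by rewrite natr1; apply: cpx_bound; lia.
- by rewrite -natrD -natrM ler_nat; lia.
- by rewrite ler_pM2l// ler_nat; lia.
Qed.

Lemma good_step u v w delta e n : good u v w delta e -> (0 < n)%N -> forced_power X u v w n ->
  exists e', good v (v ++ power n u) (v ++ w) (delta + n.-1 * size u) e'.
Proof.
move=> gd n0 fp; have [st bg wmin lw lu lv] := gd.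
have mono (a b : nat) : (a <= b)%N -> 3 <= eps * a%:R -> 3 <= eps * b%:R.
  by move=> ab H; apply: (le_trans H); rewrite ler_pM2l// ler_nat.
have large e' : budget X v (v ++ power n u) (v ++ w) (delta + n.-1 * size u) e' ->
    good v (v ++ power n u) (v ++ w) (delta + n.-1 * size u) e'.
  move=> bg'; split=> //.
  - exact: (state_step amX st).
  - by rewrite size_cat; lia.
  - by apply: mono lw; rewrite size_cat; lia.
  - by apply: mono lv; rewrite size_cat; lia.
case: n n0 fp large => // -[|m] _ fp large.
  by exists e; apply: large; rewrite mul0n addn0; exact: budget_step1.
have [legal le] := good_legal gd fp.
exists (size w + m.+1 * size u)%N; apply: large.
apply: (budget_step2 amX st bg fp _ le); rewrite -(ler_nat R) natrD !natrM; apply: le_trans legal.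
by rewrite lerDl; apply: mulr_ge0; [exact: ltW|rewrite -natrM -natrD].
Qed.

End Legality.

(** * Sequences of states *)

Lemma nested_point (R : realType) (lo hi : nat -> R) :
  (forall k, lo k <= lo k.+1) -> (forall k, hi k.+1 <= hi k) -> (forall k, lo k <= hi k) ->
  exists a, forall k, lo k <= a <= hi k.
Proof.
move=> loS hiS lohi.
have lo_mono k l : (k <= l)%N -> lo k <= lo l.
  elim: l => [|l IH]; first by rewrite leqn0 => /eqP ->.
  by rewrite leq_eqVlt => /orP[/eqP ->//|/IH/le_trans]; apply.
have hi_mono k l : (k <= l)%N -> hi l <= hi k.
  elim: l => [|l IH]; first by rewrite leqn0 => /eqP ->.
  by rewrite leq_eqVlt => /orP[/eqP ->//|/IH]; apply: le_trans.
have lh k l : lo k <= hi l.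
  by apply: le_trans (lo_mono _ _ (leq_maxl k l)) (le_trans (lohi _) (hi_mono _ _ (leq_maxr k l))).
exists (sup (range lo)) => k; apply/andP; split.
  apply: ub_le_sup; last by exists k.
  by exists (hi 0%N) => _ [l _ <-].
by apply: ge_sup; [exists (lo 0%N); exists 0%N|move=> _ [l _ <-]].
Qed.

Lemma opposite_signs (R : realType) (a b x y alpha : R) : 0 < x -> 0 < y ->
  Num.min (a / x) (b / y) <= alpha <= Num.max (a / x) (b / y) ->
  (alpha * x - a) * (alpha * y - b) <= 0.
Proof.
move=> x0 y0; rewrite ge_min le_max !ler_pdivrMr// !ler_pdivlMr// => /andP[].
move=> /orP[] H1 /orP[] H2.
- have -> : alpha * x - a = 0 by lra.
  by rewrite mul0r.
- by rewrite mulr_ge0_le0//; lra.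
- by rewrite mulr_le0_ge0//; lra.
- have -> : alpha * y - b = 0 by lra.
  by rewrite mulr0.
Qed.

Lemma mediant (R : realType) (a b x y : R) (n : nat) : 0 < x -> 0 < y ->
  Num.min (a / x) (b / y) <= (b + n%:R * a) / (y + n%:R * x) <= Num.max (a / x) (b / y).
Proof.
move=> x0 y0; have n0 : 0 <= n%:R :> R by [].
have z0 : 0 < y + n%:R * x by rewrite ltr_wpDr// mulr_ge0// ltW.
have key (p q : R) : a / x <= q -> b / y <= q -> (b + n%:R * a) / (y + n%:R * x) <= q.
  rewrite !ler_pdivrMr// => H1 H2; have := ler_wpM2l n0 H1; lra.
have key' (q : R) : q <= a / x -> q <= b / y -> q <= (b + n%:R * a) / (y + n%:R * x).
  rewrite !ler_pdivlMr// => H1 H2; have := ler_wpM2l n0 H1; lra.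
apply/andP; split.
  by apply: key'; rewrite ge_min lexx ?orbT.
by apply: key; rewrite ?le_max ?lexx ?orbT.
Qed.

Section Levels.
Variables (R : realType) (A : finType) (X : set (int -> A)).
Hypothesis amX : aperiodic_minimal X.
Variables (eps : R) (Qmin : nat).
Hypothesis eps_gt0 : 0 < eps.
Hypothesis eps_le : eps <= 1 / 4.
Hypothesis cpx_bound : forall Q, (Qmin <= Q)%N -> (cpx X Q)%:R <= (3 / 2 - eps) * Q%:R :> R.

(** [lnu] and [lnv] count the copies of one fixed block of the first state inside [lu] and [lv].
    Divided by the lengths, they are the slopes that pinch [alpha]; [lpow] is the exponent forced at
    this level. *)
Record level := Level {
  lu : seq A; lv : seq A; lw : seq A; ldelta : nat; lend : nat; lpow : nat;
  lnu : nat; lnv : nat }.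

Definition valid l := [/\ good X eps Qmin (lu l) (lv l) (lw l) (ldelta l) (lend l),
  (0 < lpow l)%N, forced_power X (lu l) (lv l) (lw l) (lpow l) &
  (lnv l * size (lu l) != lnu l * size (lv l))%N].

(** The two cases are the two orientations: the block that occurs in runs of forced length is always
    named [lu]. *)
Definition next_level l l' := [/\ lw l' = lv l ++ lw l,
  ldelta l' = (ldelta l + (lpow l).-1 * size (lu l))%N &
  [/\ lu l' = lv l, lnu l' = lnv l, lv l' = lv l ++ power (lpow l) (lu l) &
    lnv l' = (lnv l + lpow l * lnu l)%N] \/
  [/\ lv l' = lv l, lnv l' = lnv l, lu l' = lv l ++ power (lpow l) (lu l) &
    lnu l' = (lnv l + lpow l * lnu l)%N]].

Lemma exists_oriented u v w delta e nu nv : good X eps Qmin u v w delta e ->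
  (nv * size u != nu * size v)%N ->
  exists l, [/\ valid l, lw l = w, ldelta l = delta &
    [/\ lu l = u, lnu l = nu, lv l = v & lnv l = nv] \/
    [/\ lv l = u, lnv l = nu, lu l = v & lnu l = nv]].
Proof.
move=> gd det; have [[n n0 fp]|[n n0 fp]] := good_forced_power amX eps_gt0 cpx_bound gd.
  by exists (Level u v w delta e n nu nv); split=> //=; left.
exists (Level v u w delta e n nv nu); split=> //=; last by right.
by split=> //=; [exact: good_sym|rewrite eq_sym].
Qed.

Lemma exists_next_level l : valid l -> exists l', valid l' /\ next_level l l'.
Proof.
move=> [gd n0 fp det].
have [e gd'] := good_step amX eps_gt0 cpx_bound gd n0 fp.
have det' : ((lnv l + lpow l * lnu l) * size (lv l) !=
    lnv l * size (lv l ++ power (lpow l) (lu l)))%N.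
  rewrite size_cat size_power mulnDl mulnDr eqn_add2l.
  by rewrite -mulnA [X in _ != X]mulnCA eqn_pmul2l// eq_sym.
have [l' [vl' lw' ld' H]] := exists_oriented gd' det'.
by exists l'.
Qed.

Lemma exists_levels : (forall Q, exists2 Q', (Q <= Q')%N & cpx X Q'.+1 = (cpx X Q').+1) ->
  exists L, forall k, valid (L k) /\ next_level (L k) (L k.+1).
Proof.
move=> often; pose M := Num.bound (3 / eps).
have M3 a : (M <= a)%N -> 3 <= eps * a%:R.
  move=> Ma; rewrite mulrC -ler_pdivrMr//; apply: (@le_trans _ _ M%:R); last by rewrite ler_nat.
  by apply/ltW/archi_boundP; rewrite divr_ge0// ltW.
have [u [v [w [delta [st bg wQ uM vM]]]]] := initial_state amX M (maxn M Qmin) often.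
have gd : good X eps Qmin u v w delta 0.
  by split=> //; [lia|apply: M3; lia|apply: M3; lia|apply: M3; lia].
(* The first [u] counts for one and the first [v] for zero, so the initial determinant is
   nonzero. *)
have det : (0 * size u != 1 * size v)%N by rewrite mul0n mul1n neq_ltn (state_sizer st).
have [l0 [v0 _]] := exists_oriented gd det.
pose T := {l | valid l}.
have /choice[f fP] : forall l : T, exists l' : T, next_level (sval l) (sval l').
  by move=> [l vl]; have [l' [vl' nl]] := exists_next_level vl; exists (exist _ l' vl').
exists (fun k => sval (iter k f (exist _ l0 v0))) => k; split; first exact: svalP.
exact: fP.
Qed.

Definition U l : R := (size (lu l))%:R.
Definition V l : R := (size (lv l))%:R.
Definition det l : R := `|(lnv l)%:R * U l - (lnu l)%:R * V l|.
Definition pot l : R := potential (U l) (V l) (ldelta l)%:R.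
Definition ratio l : R := det l / pot l.
Definition slope_min l := Num.min ((lnu l)%:R / U l) ((lnv l)%:R / V l).
Definition slope_max l := Num.max ((lnu l)%:R / U l) ((lnv l)%:R / V l).

Section OneLevel.
Variable l : level.
Hypothesis vl : valid l.

Lemma U_gt0 : 0 < U l.
Proof. by have [[st _ _ _ _ _] _ _ _] := vl; rewrite ltr0n (state_sizel st). Qed.

Lemma V_gt0 : 0 < V l.
Proof. by have [[st _ _ _ _ _] _ _ _] := vl; rewrite ltr0n (state_sizer st). Qed.

Lemma det_gt0 : 0 < det l.
Proof.
have [_ _ _ d] := vl; rewrite normr_gt0 subr_eq0 /U /V -!natrM.
by rewrite eqr_nat.
Qed.

Lemma pot_gt0 : 0 < pot l. Proof. exact: potential_gt0 U_gt0 V_gt0. Qed.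

Lemma ratio_gt0 : 0 < ratio l. Proof. by rewrite divr_gt0 ?det_gt0 ?pot_gt0. Qed.

Variable l' : level.
Hypothesis nl : next_level l l'.

Lemma size_next n : (size (lv l ++ power n (lu l)))%:R = V l + n%:R * U l.
Proof. by rewrite size_cat size_power natrD natrM. Qed.

Lemma det_next : det l' = (lpow l)%:R * det l.
Proof.
rewrite /det /U /V; have [_ _ [[-> -> -> ->]|[-> -> -> ->]]] := nl;
  rewrite size_next natrD natrM -[X in X * `|_|]normr_nat -normrM -/(V l).
  by rewrite -normrN; congr `|_|; rewrite -/(U l) -/(V l); ring.
by congr `|_|; rewrite -/(U l) -/(V l); ring.
Qed.

Lemma pot_nextE : pot l' = potential (V l) (V l + (lpow l)%:R * U l)
  ((ldelta l)%:R + (lpow l).-1%:R * U l).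
Proof.
rewrite /pot /U /V; have [_ -> [[-> _ -> _]|[-> _ -> _]]] := nl;
  by rewrite size_next natrD natrM // potential_sym.
Qed.

Lemma pot_next_gt0 : 0 < pot l'.
Proof.
rewrite pot_nextE; apply: potential_gt0; first exact: V_gt0.
by rewrite ltr_wpDr ?V_gt0// mulr_ge0// ltW// U_gt0.
Qed.

Lemma ratio_next2 : (1 < lpow l)%N -> (1 + eps) * ratio l' <= ratio l.
Proof.
move=> n1; have [gd _ fp _] := vl.
have H : (1 + eps) * (lpow l)%:R * pot l <= pot l'.
  rewrite pot_nextE; case: (lpow l) n1 fp => [|[|m]]// _ fp.
  have [legal _] := good_legal amX eps_gt0 cpx_bound gd fp.
  rewrite [V l + _]addrC.
  by apply: potential_step2 => //; [exact: U_gt0|exact: V_gt0].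
have p' := pot_next_gt0.
rewrite {2}/ratio ler_pdivlMr ?pot_gt0// /ratio det_next.
have -> : (1 + eps) * ((lpow l)%:R * det l / pot l') * pot l =
  (1 + eps) * (lpow l)%:R * pot l * (det l / pot l') by ring.
apply: le_trans (ler_wpM2r _ H) _; first by rewrite divr_ge0 ?ltW ?det_gt0.
by rewrite mulrC divfK ?gt_eqF.
Qed.

Lemma ratio_next1 : lpow l = 1%N -> ratio l' <= ratio l.
Proof.
move=> n1; rewrite /ratio det_next n1 mul1r.
rewrite ler_pM2l ?det_gt0// lef_pV2 ?posrE ?pot_gt0 ?pot_next_gt0//.
by rewrite pot_nextE n1 mul1r mul0r addr0; apply: potential_step1; exact: U_gt0.
Qed.

Lemma ratio_next : ratio l' <= ratio l.
Proof.
have [_ n0 _ _] := vl; have [n1|n1|/esym n1] := ltngtP 1%N (lpow l).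
- apply: le_trans (ratio_next2 n1); rewrite ler_peMl ?lerDl ?ltW//.
  by rewrite divr_gt0 ?pot_next_gt0// det_next mulr_gt0 ?ltr0n ?det_gt0.
- by lia.
- exact: ratio_next1.
Qed.

Lemma slope_next : slope_min l <= slope_min l' /\ slope_max l' <= slope_max l.
Proof.
have /andP[m1 m2] := mediant (lnu l)%:R (lnv l)%:R (lpow l) U_gt0 V_gt0.
rewrite /slope_min /slope_max /U /V; have [_ _ [[-> -> -> ->]|[-> -> -> ->]]] := nl;
  rewrite size_next natrD natrM -/(V l) -/(U l); split.
- by rewrite le_min m1 ge_min lexx orbT.
- by rewrite ge_max m2 le_max lexx orbT.
- by rewrite le_min m1 ge_min lexx orbT.
- by rewrite ge_max m2 le_max lexx orbT.
Qed.

End OneLevel.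

Lemma ratio_tends0 (L : nat -> level) : (forall k, valid (L k) /\ next_level (L k) (L k.+1)) ->
  forall e, 0 < e -> exists K, forall k, (K <= k)%N -> ratio (L k) < e.
Proof.
move=> LP.
have mono k l : (k <= l)%N -> ratio (L l) <= ratio (L k).
  elim: l => [|l IH]; first by rewrite leqn0 => /eqP ->.
  rewrite leq_eqVlt => /orP[/eqP ->//|/IH]; apply: le_trans.
  by have [? ?] := LP l; exact: ratio_next.
have rpos k : 0 < ratio (L k) by have [? _] := LP k; exact: ratio_gt0.
have e1 : 0 < 1 + eps by rewrite addr_gt0.
have shrink k : exists2 k', (k <= k')%N & (1 + eps) * ratio (L k') <= ratio (L k).
  have [[l [kl l1]]|none] := pselect (exists l, (k <= l)%N /\ (1 < lpow (L l))%N).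
    exists l.+1; first by lia.
    by have [? ?] := LP l; apply: le_trans (mono _ _ kl); exact: ratio_next2.
  (* When all later exponents are 1 there is no geometric gain, but the determinant is constant
     while the block lengths, hence the potential, tend to infinity. *)
  have pow1 l : (k <= l)%N -> lpow (L l) = 1%N.
    move=> kl; have [[_ n0 _ _] _] := LP l; apply/eqP; rewrite eqn_leq n0 andbT leqNgt.
    by apply/negP => l1; apply: none; exists l.
  have detk l : (k <= l)%N -> det (L l) = det (L k).
    elim: l => [|l IH]; first by rewrite leqn0 => /eqP ->.
    rewrite leq_eqVlt => /orP[/eqP ->//|kl].
    by have [_ nl] := LP l; rewrite (det_next nl) pow1// mul1r IH.
  have sizew l : (l <= size (lw (L l)))%N.
    elim: l => [//|l IH]; have [[[st _ _ _ _ _] _ _ _] [-> _ _]] := LP l.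
    by rewrite size_cat; have := state_sizer st; lia.
  have d0 : 0 < det (L k) by have [? _] := LP k; exact: det_gt0.
  (* The factor 3 is the loss in [potential_ge]. *)
  pose M := Num.bound ((1 + eps) * (det (L k) * 3) / ratio (L k)).
  have [K large] := state_size_large amX M.
  exists (maxn k K); first exact: leq_maxl.
  set l := maxn k K; have [vl _] := LP l; have [[st _ _ _ _ _] _ _ _] := vl.
  have Kw : (K <= size (lw (L l)))%N by apply: leq_trans (sizew l); exact: leq_maxr.
  have Mu := large _ _ _ st Kw; have Mv := large _ _ _ (state_sym st) Kw.
  have MR : (1 + eps) * (det (L k) * 3) / ratio (L k) <= M%:R.
    apply/ltW/archi_boundP; apply: divr_ge0; last exact: ltW.
    by apply: mulr_ge0; [exact: ltW|apply: mulr_ge0 => //; exact: ltW].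
  have Mp : M%:R / 3 <= pot (L l).
    apply: le_trans (potential_ge _ (U_gt0 vl) (V_gt0 vl)).
    by rewrite ler_pM2r ?invr_gt0// le_min !ler_nat ltnW ?(ltnW Mv).
  rewrite /ratio detk ?leq_maxl// mulrA ler_pdivrMr ?pot_gt0// -ler_pdivrMl ?rpos//.
  apply: le_trans Mp; rewrite ler_pdivlMr//; apply: le_trans MR; rewrite le_eqVlt; apply/orP; left.
  by apply/eqP; rewrite -/(ratio (L k)) mulrC; ring.
have iter m : exists k, (1 + eps) ^+ m * ratio (L k) <= ratio (L 0%N).
  elim: m => [|m [k IH]]; first by exists 0%N; rewrite mul1r.
  have [k' _ H] := shrink k; exists k'; apply: le_trans IH.
  by rewrite exprSr -mulrA ler_pM2l// exprn_gt0.
move=> e e0; pose m := Num.bound (ratio (L 0%N) / (e * eps)).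
have [K HK] := iter m.+1; exists K => k Kk; apply: le_lt_trans (mono _ _ Kk) _.
have mR : ratio (L 0%N) / (e * eps) <= m%:R.
  by apply/ltW/archi_boundP; apply: divr_ge0; [|apply: mulr_ge0]; exact: ltW.
have bern n : 1 + n%:R * eps <= (1 + eps) ^+ n.
  elim: n => [|n IH]; first by rewrite mul0r addr0.
  rewrite exprS -natr1; have := ler_wpM2l (ltW e1) IH; apply: le_trans.
  have : 0 <= n%:R * (eps * eps) by rewrite !mulr_ge0// ltW.
  by lra.
rewrite ltNge; apply/negP => eK.
have : (1 + m.+1%:R * eps) * e <= ratio (L 0%N).
  apply: le_trans HK; apply: ler_pM => //; last exact: ltW.
  by rewrite addr_ge0// mulr_ge0// ltW.
move: mR; rewrite ler_pdivrMr ?mulr_gt0// -natr1 => mR.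
have : 0 < eps * e by rewrite mulr_gt0.
by lra.
Qed.

Section Phases.
Variable alpha : R.

(** How far the rotation by [alpha] is from closing up along the block: the integer [lnu] is the
    expected number of turns. *)
Definition phase_u l := alpha * U l - (lnu l)%:R.
Definition phase_v l := alpha * V l - (lnv l)%:R.
Definition spread l := `|phase_u l| + `|phase_v l|.

Lemma opposite_norm (a b x y : R) : 0 <= x -> 0 <= y -> a * b <= 0 ->
  `|a * y - b * x| = `|a| * y + `|b| * x.
Proof.
move=> x0 y0 ab.
have [a0|a0] := leP 0 a; have [b0|b0] := leP 0 b.
- have : a * b = 0 by apply/le_anti; rewrite ab mulr_ge0.
  move=> /eqP; rewrite mulf_eq0 => /orP[] /eqP ->.
    by rewrite normr0 !mul0r sub0r add0r normrN ger0_norm ?mulr_ge0// ger0_norm.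
  by rewrite normr0 !mul0r subr0 addr0 ger0_norm ?mulr_ge0// ger0_norm.
- rewrite (ger0_norm a0) (ltr0_norm b0) ger0_norm ?mulNr//.
  by rewrite subr_ge0 (@le_trans _ _ 0) ?mulr_ge0 ?mulr_le0_ge0// ltW.
- rewrite (ltr0_norm a0) (ger0_norm b0) ler0_norm; first by ring.
  by rewrite subr_le0 (@le_trans _ _ 0) ?mulr_ge0 ?mulr_le0_ge0// ltW.
- have : 0 < a * b by rewrite nmulr_rgt0.
  by lra.
Qed.

Lemma combination_norm (a b n m : R) : 0 <= m -> a * b <= 0 -> `|b| <= n * `|a| ->
  m * `|a| <= n * `|a| -> `|b + m * a| <= n * `|a|.
Proof.
move=> m0 ab; have [a0|a0] := leP 0 a; have [b0|b0] := leP 0 b.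
- have : a * b == 0 by rewrite eq_le ab mulr_ge0.
  rewrite mulf_eq0 => /orP[] /eqP -> bn mn; first by rewrite mulr0 addr0.
  by rewrite add0r normrM (ger0_norm m0).
- rewrite (ger0_norm a0) (ltr0_norm b0) ler_norml => bn mn.
  by have ma := mulr_ge0 m0 a0; apply/andP; split; lra.
- rewrite (ltr0_norm a0) (ger0_norm b0) ler_norml => bn mn.
  by have ma := mulr_ge0_le0 m0 (ltW a0); apply/andP; split; lra.
- have : 0 < a * b by rewrite nmulr_rgt0.
  by lra.
Qed.

Lemma arith_lyapunov (x s s' cr cr' r' : R) : 0 <= s -> x <= s' -> s' <= 2 * r' ->
  4 * r' <= cr - cr' -> x <= s + cr - (s' + cr').
Proof. lra. Qed.

Lemma spread_le_ratio l : valid l -> slope_min l <= alpha <= slope_max l ->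
  spread l <= 2 * ratio l.
Proof.
move=> vl al; have u0 := U_gt0 vl; have v0 := V_gt0 vl.
have opp := opposite_signs u0 v0 al.
have dE : det l = `|phase_u l| * V l + `|phase_v l| * U l.
  rewrite -(opposite_norm (ltW u0) (ltW v0) opp) /det; congr `|_|.
  by rewrite /phase_u /phase_v; ring.
have p0 := pot_gt0 vl; have := potential_le (U l) (V l) (ldelta l)%:R.
rewrite -/(pot l) le_min => /andP[pu pv].
have Hu : `|phase_u l| <= ratio l.
  rewrite ler_pdivlMr// dE; apply: (@le_trans _ _ (`|phase_u l| * V l)).
    by rewrite ler_wpM2l.
  by rewrite lerDl mulr_ge0// ltW.
have Hv : `|phase_v l| <= ratio l.
  rewrite ler_pdivlMr// dE; apply: (@le_trans _ _ (`|phase_v l| * U l)).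
    by rewrite ler_wpM2l.
  by rewrite lerDr mulr_ge0// ltW.
by rewrite /spread; lra.
Qed.

(** Since [alpha] separates the slopes at both levels, [phase_v] has sign opposite both to [phase_u]
    and to [phase_v + n * phase_u]. Adding [n * phase_u] thus overshoots zero, and the absolute
    values before and after sum to that of [n * phase_u]. *)
Lemma phases_next l l' : valid l -> valid l' -> next_level l l' ->
  slope_min l <= alpha <= slope_max l -> slope_min l' <= alpha <= slope_max l' ->
  spread l' = (lpow l)%:R * `|phase_u l| /\ `|phase_v l| <= (lpow l)%:R * `|phase_u l| /\
  phase_u l * phase_v l <= 0.
Proof.
move=> vl vl' nl al al'; set n := (lpow l)%:R.
have n0 : 0 <= n by [].
have opp : phase_u l * phase_v l <= 0 := opposite_signs (U_gt0 vl) (V_gt0 vl) al.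
have opp' : phase_u l' * phase_v l' <= 0 := opposite_signs (U_gt0 vl') (V_gt0 vl') al'.
have [E O] : spread l' = `|phase_v l| + `|phase_v l + n * phase_u l| /\
    phase_v l * (phase_v l + n * phase_u l) <= 0.
  move: opp'; rewrite /spread /phase_u /phase_v /U /V.
  have [_ _ [[-> -> -> ->]|[-> -> -> ->]]] := nl; rewrite size_next natrD natrM -/(V l) -/(U l) -/n.
  - have -> : alpha * (V l + n * U l) - ((lnv l)%:R + n * (lnu l)%:R) =
      alpha * V l - (lnv l)%:R + n * (alpha * U l - (lnu l)%:R) by ring.
    by [].
  - have -> : alpha * (V l + n * U l) - ((lnv l)%:R + n * (lnu l)%:R) =
      alpha * V l - (lnv l)%:R + n * (alpha * U l - (lnu l)%:R) by ring.
    by move=> H; split; [exact: addrC|rewrite mulrC].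
move: opp E O {opp'}; move: (phase_u l) (phase_v l) => a b ab -> O.
have [b0|b0|b0] := ltgtP b 0.
- have s : 0 <= b + n * a by rewrite -(nmulr_rle0 _ b0).
  have a0 : 0 <= a by rewrite -(nmulr_lle0 _ b0).
  by rewrite (ltr0_norm b0) (ger0_norm s) (ger0_norm a0); split; [lra|split=> //; lra].
- have s : b + n * a <= 0 by rewrite -(pmulr_rle0 _ b0).
  have a0 : a <= 0 by rewrite -(pmulr_lle0 _ b0).
  by rewrite (gtr0_norm b0) (ler0_norm s) (ler0_norm a0); split; [lra|split=> //; lra].
- by rewrite b0 normr0 !add0r mulr0 normrM (ger0_norm n0); split=> //; split=> //; rewrite mulr_ge0.
Qed.

(** For an exponent at least 2, the deviation and the new spread are each at most twice the new
    ratio, which makes 4, while the ratio drops by at least [eps] times its new value; hence the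
    coefficient [4 / eps]. *)
Definition lyapunov l := spread l + 4 / eps * ratio l.

(* A step with [lpow = 1] only consumes the spread; the other steps, which may
   enlarge it, are paid by the geometric decay of [ratio]. *)
Lemma phase_deviation l l' j : valid l -> valid l' -> next_level l l' ->
  slope_min l <= alpha <= slope_max l -> slope_min l' <= alpha <= slope_max l' ->
  (j < lpow l)%N -> `|phase_v l + j%:R * phase_u l| <= lyapunov l - lyapunov l'.
Proof.
move=> vl vl' nl al al' jn; have [E [le opp]] := phases_next vl vl' nl al al'.
have c0 : 0 < 4 / eps by rewrite divr_gt0.
have s0 : 0 <= spread l by rewrite addr_ge0.
have jn' : j%:R * `|phase_u l| <= (lpow l)%:R * `|phase_u l|.
  by rewrite ler_wpM2r// ler_nat ltnW.
have [n1|n1|/esym n1] := ltngtP 1%N (lpow l).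
- have r2 := ratio_next2 vl nl n1; have sr := spread_le_ratio vl' al'.
  have dev : `|phase_v l + j%:R * phase_u l| <= spread l'.
    by rewrite E; apply: combination_norm.
  apply: (arith_lyapunov s0 dev sr); rewrite -mulrBr.
  have -> : 4 * ratio l' = 4 / eps * (eps * ratio l') by rewrite [RHS]mulrA divfK ?gt_eqF.
  by rewrite ler_pM2l// lerBrDr -{2}[ratio l']mul1r -mulrDl addrC.
- by have [_ n0 _ _] := vl; move: n1; rewrite ltnNge n0.
- have j0 : j = 0%N by apply/eqP; rewrite -leqn0 -ltnS -n1.
  have r1 := ratio_next1 vl nl n1.
  have H : 4 / eps * ratio l' <= 4 / eps * ratio l by rewrite ler_pM2l.
  rewrite j0 mul0r addr0 /lyapunov E n1 mul1r /spread.
  rewrite opprD addrACA -addrA addrA [X in X + _]addrAC subrr add0r lerDl.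
  by rewrite subr_ge0.
Qed.

End Phases.
End Levels.

(** * Cylinders *)

Section Cylinders.
Variable A : finType.
Implicit Types (x y : fullshift A) (X Y : set (fullshift A)).

Definition cylinder x (N : nat) : set (fullshift A) :=
  [set y | forall i : int, (`|i| <= N)%N -> y i = x i].

Lemma cylinder_le x N M : (N <= M)%N -> cylinder x M `<=` cylinder x N.
Proof. by move=> NM y yM i iN; apply: yM; exact: leq_trans NM. Qed.

Lemma nbhs_coordinate x (i : int) : nbhs x [set y | y i = x i].
Proof.
apply: (@proj_continuous int (fun=> discrete_topology A) i x [set x i]).
by rewrite /nbhs /=.
Qed.

Lemma nbhs_cylinder x N : nbhs x (cylinder x N).
Proof.
have H (s : seq int) : nbhs x [set y : fullshift A | {in s, forall i, y i = x i}].
  elim: s => [|i s IH]; first by apply: filterS (@filterT _ _ (@nbhs_filter _ x)) => y _ i.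
  apply: (@filterS _ _ (@nbhs_filter (fullshift A) x)) (@filterI _ _ (@nbhs_filter (fullshift A) x) _ _ (nbhs_coordinate x i) IH) => y [/= yi ys] j.
  by rewrite inE => /orP[/eqP -> //|]; exact: ys.
apply: (@filterS _ _ (@nbhs_filter (fullshift A) x)) (H ([seq k%:Z | k <- iota 0 N.+1] ++ [seq - k%:Z | k <- iota 0 N.+1])) => y ys i iN.
apply: ys; rewrite mem_cat; apply/orP.
by case: i iN => k kN; [left|right]; apply/mapP; [exists k|exists k.+1];
  rewrite ?mem_iota ?NegzE//; lia.
Qed.

Lemma nbhsP_cylinder x (W : set (fullshift A)) : nbhs x W -> exists N, cylinder x N `<=` W.
Proof.
pose F := filter_from [set: nat] (cylinder x).
have FF : Filter F.
  apply: filter_from_filter; first by exists 0%N.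
  move=> n m _ _; exists (maxn n m) => // y yc; split; apply: cylinder_le yc.
    exact: leq_maxl.
  exact: leq_maxr.
have H : F --> x.
  apply/cvg_sup => i U; rewrite nbhsE => -[B [ [V oV VB] Bx] BU].
  exists `|i|%N => // y yc; apply: BU; move: Bx; rewrite -VB /= => Vx.
  by rewrite /preimage /= (yc i).
by move=> /H[N _ NW]; exists N.
Qed.

Lemma closed_cylinderP Y :
  closed Y <-> forall x, (forall N, exists2 y, Y y & cylinder x N y) -> Y x.
Proof.
split=> [cY x xY|H x clx].
  apply: cY => W /nbhsP_cylinder[N NW]; have [y Yy yN] := xY N.
  by exists y; split=> //; exact: NW.
by apply: H => N; have [y [Yy yN]] := clx _ (nbhs_cylinder x N); exists y.
Qed.

Lemma within_cylinderP (S : topologicalType) X (f : fullshift A -> S) :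
  {within X, continuous f} <-> forall x, X x -> forall W, nbhs (f x) W ->
    exists N, forall y, X y -> cylinder x N y -> W (f y).
Proof.
rewrite subspace_continuousP; split=> H x Xx W fW.
  have /nbhsP_cylinder[N NW] := H x Xx W fW.
  by exists N => y Xy yN; exact: NW.
have [N HN] := H x Xx W fW.
apply: filterS (nbhs_cylinder x N) => y yN Xy; exact: HN.
Qed.

Lemma compact_fullshift : compact [set: fullshift A].
Proof.
have := @tychonoff int (fun=> discrete_topology A) (fun=> setT).
have -> : [set f : int -> discrete_topology A | forall i, [set: discrete_topology A] (f i)] = setT.
  by apply/seteqP; split.
by apply=> i; apply: finite_compact; exact: finite_finset.
Qed.

Lemma shift_by X x (n : int) : subshift X -> X x -> X (fun i => x (i + n)).
Proof.
move=> [_ sX] Xx.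
have s1 y : X y -> X (fun i => y (i + 1)) by rewrite -{2}sX; exists y.
have s2 y : X y -> X (fun i => y (i - 1)).
  rewrite -{1}sX => -[z Xz <-]; congr X: Xz; apply/funext => i.
  by rewrite /shiftmap subrK.
case: n => [n|n]; [elim: n => [|n IH]|rewrite NegzE; elim: n => [|n IH]].
- by congr X: Xx; apply/funext => i; rewrite addr0.
- by congr X: (s1 _ IH); apply/funext => i; congr x; lia.
- exact: s2.
- by congr X: (s2 _ IH); apply/funext => i; congr x; lia.
Qed.

Lemma shiftmap_image Y : (forall y, Y y -> Y (fun i => y (i + 1))) ->
  (forall y, Y y -> Y (fun i => y (i - 1))) -> @shiftmap A @` Y = Y.
Proof.
move=> s1 s2; apply/seteqP; split=> [_ [y Yy <-]|y Yy]; first exact: s1.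
by exists (fun i => y (i - 1)); [exact: s2|apply/funext => i; rewrite /shiftmap addrK].
Qed.

Lemma aperiodic_minimal_subshift X : subshift X -> minimal X -> infinite_set X ->
  aperiodic_minimal X.
Proof.
move=> sX [X0 minX] infX; have cX : closed X by case: sX.
have shX x n : X x -> X (fun i => x (i + n)) by exact: shift_by.
split=> //.
- move=> w [x0 [i0 [Xx0 wx0]]].
  (* The points of [X] avoiding [w] form a subshift other than [X], so there are none. *)
  have hit x : X x -> exists i, occ w x i.
    move=> Xx; apply: contrapT => nw.
    pose Y := [set y | X y /\ forall i, ~ occ w y i].
    have YX : Y = X.
      apply: minX; last 2 first.
      - by move=> y [].
      - by exists x; split=> // i wi; apply: nw; exists i.
      split.
        apply/closed_cylinderP => y yY; split.
          by move/closed_cylinderP: cX; apply=> N; have [z [Xz _] zN] := yY N; exists z.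
        move=> i wi; have [z [_ nz] zN] := yY (`|i| + size w)%N.
        by apply: (nz i); apply: occ_eq wi => k kw; apply: zN; lia.
      apply: shiftmap_image => y [Xy ny]; (split; first exact: shX);
        by move=> i /occ_shift; exact: ny.
    have [_ nx0] : Y x0 by rewrite YX.
    exact: nx0 wx0.
  apply: contrapT => none.
  (* Unbounded gaps can be centred at the origin; by compactness a limit point would then avoid [w]
     entirely. *)
  pose F K := [set x | X x /\ forall i : int, (`|i| <= K)%N -> ~ occ w x i].
  have Fne K : F K !=set0.
    apply: contrapT => FK; apply: none; exists (2 * K)%N => x Xx j.
    apply: contrapT => nk; apply: FK; exists (fun i => x (i + (j + K%:Z))); split.
      exact: shX.
    move=> i iK /occ_shift wi; apply: nk; exists (absz (i + K%:Z)); first by lia.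
    by have -> : j + (absz (i + K%:Z))%:Z = i + (j + K%:Z) by lia.
  pose FF := filter_from [set: nat] F.
  have PF : ProperFilter FF.
    apply: filter_from_proper => //; apply: filter_from_filter; first by exists 0%N.
    move=> n m _ _; exists (maxn n m) => // y [Xy ny]; split; split=> // i iN; apply: ny;
      by rewrite (leq_trans iN)// ?leq_maxl ?leq_maxr.
  have cptX : compact X by apply: (subclosed_compact cX compact_fullshift).
  have [|x [Xx clx]] := cptX FF PF; first by exists 0%N => // y [].
  have [i wi] := hit x Xx.
  have FFi : FF (F `|i|%N) by exists `|i|%N.
  have [y [[Xy ny] yN]] := clx _ _ FFi (nbhs_cylinder x (`|i| + size w)).
  by apply: (ny i) => //; apply: occ_eq wi => k kw; apply: yN; lia.
- move=> x n Xx n0 per; apply: infX.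
  (* By minimality the period of one point is shared by all, and [n] coordinates then determine a
     point, so [X] is finite. *)
  pose Y := [set y | X y /\ forall i, y (i + n%:Z) = y i].
  have YX : Y = X.
    apply: minX; last 2 first.
    - by move=> y [].
    - by exists x.
    split.
      apply/closed_cylinderP => y yY; split.
        by move/closed_cylinderP: cX; apply=> N; have [z [Xz _] zN] := yY N; exists z.
      move=> i; have [z [_ nz] zN] := yY (`|i| + n)%N.
      by rewrite -(zN i) -?(zN (i + n%:Z)) ?nz//; lia.
    apply: shiftmap_image => y [Xy ny]; (split; first exact: shX);
      by move=> i; rewrite addrAC ny.
  pose g (y : fullshift A) : n.-tuple A := [tuple (y i%:Z : A) | i < n].
  have perZ y : Y y -> forall (k : nat) i, y (i + (k * n)%N%:Z) = y i.
    move=> [_ py]; elim=> [|k IH] i; first by rewrite addr0.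
    have -> : i + (k.+1 * n)%N%:Z = i + (k * n)%N%:Z + n%:Z by lia.
    by rewrite py IH.
  have ginj : {in X &, injective g}.
    move=> y z; rewrite -YX !inE => Yy Yz E; apply/funext => i.
    have low j : (j < n)%N -> y j%:Z = z j%:Z.
      by move=> jn; have := congr1 (fun t => tnth t (Ordinal jn)) E; rewrite !tnth_mktuple.
    pose r := absz (i + (`|i| * n)%N%:Z).
    have rE : i + (`|i| * n)%N%:Z = r%:Z by have := leq_pmulr `|i|%N n0; rewrite /r; lia.
    have iE : i + (`|i| * n)%N%:Z = (r %% n)%N%:Z + (r %/ n * n)%N%:Z.
      by rewrite rE {1}(divn_eq r n) PoszD addrC.
    rewrite -(perZ y Yy `|i|%N i) -(perZ z Yz `|i|%N i) iE (perZ y Yy) (perZ z Yz).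
    by apply: low; rewrite ltn_mod.
  apply: (@card_le_finite _ _ _ (g @` X)); last exact: finite_finset.
  by rewrite (card_le_eqr (inj_card_eq ginj)).
Qed.

End Cylinders.

(** * The eigenfunction *)

Section Circle.
Variable R : realType.
Implicit Types (s t : R).

Lemma expi0 : expi 0 = 1 :> R[i].
Proof. by rewrite /expi cos0 sin0. Qed.

Lemma expiD s t : expi (s + t) = expi s * expi t.
Proof. by rewrite /expi cosD sinD; simpc; rewrite [sin s * cos t + _]addrC. Qed.

Lemma norm_expi t : `|expi t| = 1 :> R[i].
Proof. by rewrite normc_def /= cos2Dsin2 sqrtr1. Qed.

Lemma expi_neq0 t : expi t != 0.
Proof. by rewrite -normr_gt0 norm_expi ltr01. Qed.

Lemma expi_nat (n : nat) : expi (2 * pi * n%:R) = 1 :> R[i].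
Proof.
elim: n => [|n IH]; first by rewrite mulr0 expi0.
rewrite -[n.+1%:R]natr1 mulrDr mulr1 expiD IH mul1r /expi.
by rewrite mulrC mulr_natr cos2pi sin2pi.
Qed.

Lemma expi_int (n : int) : expi (2 * pi * n%:~R) = 1 :> R[i].
Proof.
case: n => n; first exact: expi_nat.
rewrite NegzE mulrNz; apply: (mulfI (expi_neq0 (2 * pi * n.+1%:R))).
by rewrite -expiD mulr1 expi_nat -mulrDr subrr mulr0 expi0.
Qed.

Lemma expi_near (e : R) : 0 < e -> exists2 d, 0 < d & forall t (n : int),
  `|t - n%:~R| < d -> `|expi (2 * pi * t) - 1| < e%:C%C.
Proof.
move=> e0; have p2 : 0 < 2 * pi :> R by rewrite mulr_gt0 ?pi_gt0.
have e2 : 0 < e / 2 by rewrite divr_gt0.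
have := @continuous_cos R 0; move=> /cvgrPdist_lt/(_ _ e2)/nbhs_ballP[d1 /= d10 H1].
have := @continuous_sin R 0; move=> /cvgrPdist_lt/(_ _ e2)/nbhs_ballP[d2 /= d20 H2].
exists (Num.min d1 d2 / (2 * pi)); first by rewrite divr_gt0// lt_min d10.
move=> t n; rewrite ltr_pdivlMr// lt_min => /andP[tn1 tn2].
set s := 2 * pi * (t - n%:~R).
have -> : expi (2 * pi * t) = expi s.
  by rewrite -[RHS]mulr1 -(expi_int n) -expiD -mulrDr subrK.
have sE : `|s| = `|t - n%:~R| * (2 * pi) by rewrite normrM (gtr0_norm p2) mulrC.
have c1 : `|cos s - 1| < e / 2.
  by have := H1 s; rewrite cos0 distrC; apply; rewrite /ball /= sub0r normrN sE.
have c2 : `|sin s| < e / 2.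
  by have := H2 s; rewrite sin0 sub0r normrN; apply; rewrite /ball /= sub0r normrN sE.
have -> : expi s - 1 = (cos s - 1)%:C%C + 'i%C * (sin s)%:C%C.
  by rewrite /expi; apply/eqP; rewrite eq_complex /=; simpc.
apply: le_lt_trans (ler_normD _ _) _; rewrite normrM normCi mul1r.
by rewrite !normc_def /= !expr0n /= !addr0 !sqrtr_sqr -rmorphD /= ltcR; lra.
Qed.

Lemma expi_eq1 t : (forall d, 0 < d -> exists n : int, `|t - n%:~R| < d) ->
  expi (2 * pi * t) = 1.
Proof.
move=> H; apply/eqP; rewrite -subr_eq0 -normr_eq0; apply/negP => /negP.
set z := expi _ - 1 => z0.
have zE : `|z| = (complex.Re `|z|)%:C%C by rewrite normc_def.
have e0 : 0 < complex.Re `|z|.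
  by rewrite -ltcR -zE lt_neqAle eq_sym z0 normr_ge0.
have [d d0 dP] := expi_near e0; have [n nd] := H d d0.
by have := dP t n nd; rewrite -zE ltxx.
Qed.

End Circle.

(** * Last cut before the origin: change of level and shift *)

Section Cuts.
Variables (A : finType) (X : set (int -> A)).
Hypothesis amX : aperiodic_minimal X.
Implicit Types (u v w : seq A) (x y : int -> A).

Definition last_cut w x (g : nat) :=
  occ w x (- g%:Z) /\ forall l, (l < g)%N -> ~ occ w x (- l%:Z).

Lemma last_cut_unique w x g h : last_cut w x g -> last_cut w x h -> g = h.
Proof.
move=> [wg ng] [wh nh]; have [gh|hg|//] := ltngtP g h.
  by case: (nh g).
by case: (ng h).
Qed.

Lemma exists_last_cut w x : is_factor X w -> X x -> exists g, last_cut w x g.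
Proof.
move=> fw Xx; have [k wk nk] := exists_previous amX 0 fw Xx; exists k; split.
  by rewrite -[- _]sub0r.
by move=> l lk; rewrite -[- _]sub0r; exact: nk.
Qed.

Lemma power_cuts u v w n x i k : state X u v w -> X x ->
  occ (power n u ++ v ++ w) x i -> (k < n * size u)%N -> occ w x (i + k%:Z) ->
  exists2 j, (j < n)%N & k = (j * size u)%N.
Proof.
move=> st Xx; elim: n i k => [|n IH] i k //; rewrite powerS -catA => ox kn wk.
have pu := state_prefixl st; have pv := state_prefixr st.
have owx : occ (u ++ w) x i.
  by apply: occ_prefix ox; rewrite prefix_catr// eqxx /=; apply: prefix_power.
have [k0|k0] := posnP k; first by exists 0%N => //; rewrite k0.
have [[_ none]|[vx _]] := state_return st Xx (occ_prefix pu owx); last first.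
  by case: (state_exclusive st owx vx).
have uk : (size u <= k)%N.
  by rewrite leqNgt; apply/negP => ku; apply: (none k) => //; rewrite k0.
have [||j jn E] := IH _ (k - size u)%N (occ_catr ox).
- by rewrite mulSn in kn; lia.
- by have -> : i + (size u)%:Z + (k - size u)%N%:Z = i + k%:Z by lia.
by exists j.+1 => //; rewrite mulSn; lia.
Qed.

(** A cut of the new level is also one of the old level. If they differ, the old one lies in the run
    of [u] after [v], strictly before the end of the run because the next [v ++ w] starts after the
    origin; so [j < n], the range that [phase_deviation] controls. *)
Lemma last_cut_step u v w n x g g' : state X u v w -> forced_power X u v w n ->
  X x -> last_cut w x g -> last_cut (v ++ w) x g' ->
  g' = g \/ exists2 j, (j < n)%N & g' = (g + size v + j * size u)%N.
Proof.
move=> st [_ _ fp] Xx [wg ng] [wg' ng'].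
have pv := state_prefixr st; have ww' := occ_prefix pv wg'.
have gg' : (g <= g')%N by rewrite leqNgt; apply/negP => lt; exact: (ng _ lt ww').
have [->|ne] := eqVneq g' g; first by left.
have {ne}gg' : (g < g')%N by rewrite ltn_neqAle eq_sym ne.
have vg : (size v <= g' - g)%N.
  have [[ux _]|[_ none]] := state_return st Xx ww'.
    by case: (state_exclusive st ux wg').
  rewrite leqNgt; apply/negP => lt; apply: (none (g' - g)%N); first by lia.
  by have -> : - g'%:Z + (g' - g)%N%:Z = - g%:Z by lia.
have later k : occ (v ++ w) x (- g'%:Z + k%:Z) -> (0 < k)%N -> (g' < k)%N.
  move=> vk k0; rewrite ltnNge; apply/negP => kg; apply: (ng' (g' - k)%N); first by lia.
  by have -> : - (g' - k)%N%:Z = - g'%:Z + k%:Z by lia.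
right; have v0 := state_sizer st.
have [/occ_catr vv|/occ_catr vuv] := fp _ _ Xx wg'.
  exfalso; have [[ux _]|[_ none]] := state_return st Xx (occ_prefix pv wg').
    by case: (state_exclusive st ux wg').
  have := later _ vv v0; lia.
have wend := occ_catr vuv; rewrite size_power -addrA -PoszD in wend.
have lt := later _ wend ltac:(lia).
have [||j jn E] := @power_cuts u v w n x _ (g' - g - size v)%N st Xx vuv.
- by lia.
- by have -> : - g'%:Z + (size v)%:Z + (g' - g - size v)%N%:Z = - g%:Z by lia.
by exists j => //; lia.
Qed.

Lemma last_cut_shift u v w x g h : state X u v w -> X x ->
  last_cut w x g -> last_cut w (fun i => x (i + 1)) h ->
  h = g.+1 \/ h = 0%N /\ (g.+1 = size u \/ g.+1 = size v).
Proof.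
move=> st Xx [wg ng] [/occ_shift wh nh]; have [h0|h0] := posnP h.
  right; split=> //; rewrite h0 oppr0 add0r in wh.
  have key t : (0 < size t)%N -> occ (t ++ w) x (- g%:Z) ->
      (forall k, (0 < k < size t)%N -> ~ occ w x (- g%:Z + k%:Z)) -> g.+1 = size t.
    move=> t0 /occ_catr wt nt; apply/eqP; rewrite eqn_leq; apply/andP; split.
      rewrite ltnNge; apply/negP => tg; apply: (ng (g - size t)%N); first by lia.
      by have -> : - (g - size t)%N%:Z = - g%:Z + (size t)%:Z by lia.
    rewrite leqNgt; apply/negP => gt; apply: (nt g.+1) => //.
    by have -> : - g%:Z + g.+1%:Z = 1 by lia.
  have [[ux nu]|[vx nv]] := state_return st Xx wg; [left|right]; apply: key => //.
    exact: state_sizel st.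
  exact: state_sizer st.
left; have [gh|hg|//] := ltngtP g.+1 h.
  case: (nh g.+1) => //; apply/occ_shift.
  by have -> : - g.+1%:Z + 1 = - g%:Z by lia.
case: (ng h.-1); first by lia.
by have -> : - h.-1%:Z = - h%:Z + 1 by lia.
Qed.

Lemma last_cut_local w x y g N : (g + size w <= N)%N ->
  (forall i : int, (`|i| <= N)%N -> y i = x i) -> last_cut w x g -> last_cut w y g.
Proof.
move=> gN yx [wg ng]; split.
  by apply: occ_eq wg => k kw; apply: yx; lia.
move=> l lg wl; apply: (ng l lg); apply: occ_eq wl => k kw.
by rewrite yx//; lia.
Qed.

Lemma last_cut_bound w : is_factor X w -> exists K, forall x g, X x -> last_cut w x g -> (g <= K)%N.
Proof.
move=> fw; have [K rK] := am_recurrent amX fw; exists K => x g Xx [_ ng].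
have [k kK wk] := rK x Xx (- K%:Z); rewrite leqNgt; apply/negP => gK.
apply: (ng (K - k)%N); first by lia.
by have -> : - (K - k)%N%:Z = - K%:Z + k%:Z by lia.
Qed.

End Cuts.

Section Eigenfunction.
Variables (R : realType) (A : finType) (X : set (int -> A)).
Hypothesis amX : aperiodic_minimal X.
Variables (eps : R) (Qmin : nat).
Hypothesis eps_gt0 : 0 < eps.
Hypothesis eps_le : eps <= 1 / 4.
Hypothesis cpx_bound : forall Q, (Qmin <= Q)%N -> (cpx X Q)%:R <= (3 / 2 - eps) * Q%:R :> R.
Variable L : nat -> level A.
Hypothesis L_valid : forall k, valid X eps Qmin (L k) /\ next_level (L k) (L k.+1).
Variable alpha : R.
Hypothesis alpha_slope : forall k, slope_min R (L k) <= alpha <= slope_max R (L k).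

Let lyap k := lyapunov eps alpha (L k).

Lemma lyapunov_ge_spread k : spread alpha (L k) <= lyap k.
Proof.
have [vk _] := L_valid k.
by rewrite lerDl; apply: mulr_ge0; apply: ltW; [exact: divr_gt0|exact: ratio_gt0 vk].
Qed.

Lemma lyapunov_tends0 e : 0 < e -> exists K, forall k, (K <= k)%N -> lyap k < e.
Proof.
move=> e0; have c0 : 0 < 2 + 4 / eps by rewrite addr_gt0// divr_gt0.
have [K KP] := ratio_tends0 amX eps_gt0 eps_le cpx_bound L_valid (divr_gt0 e0 c0).
exists K => k /KP; rewrite ltr_pdivlMr// => H; apply: le_lt_trans H.
have [vk _] := L_valid k; have := spread_le_ratio vk (alpha_slope k).
by rewrite /lyap /lyapunov mulrDr [_ * 2]mulrC [_ * (4 / eps)]mulrC lerD2r.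
Qed.

Lemma deviation k j : (j < lpow (L k))%N ->
  `|phase_v alpha (L k) + j%:R * phase_u alpha (L k)| <= lyap k - lyap k.+1.
Proof.
have [vk nk] := L_valid k; have [vk' _] := L_valid k.+1.
exact: (phase_deviation amX eps_gt0 eps_le cpx_bound vk vk' nk).
Qed.

Lemma lyapunov_decr k : lyap k.+1 <= lyap k.
Proof.
have [[_ n0 _ _] _] := L_valid k; rewrite -subr_ge0.
exact: le_trans (deviation n0).
Qed.

Lemma level_state k : state X (lu (L k)) (lv (L k)) (lw (L k)).
Proof. by have [[[]]] := L_valid k. Qed.

Lemma level_factor k : is_factor X (lw (L k)).
Proof. exact: (factor_cat (state_factorl (level_state k))).2. Qed.

Lemma cut_deviation k x g g' : X x -> last_cut (lw (L k)) x g ->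
  last_cut (lw (L k.+1)) x g' ->
  exists N : nat, `|alpha * g'%:R - alpha * g%:R - N%:R| <= lyap k - lyap k.+1.
Proof.
move=> Xx cg; have [[_ _ fp _] [-> _ _]] := L_valid k => cg'.
have [->|[j jn ->]] := last_cut_step (level_state k) fp Xx cg cg'.
  by exists 0%N; rewrite !subrr normr0 subr_ge0 lyapunov_decr.
exists (lnv (L k) + j * lnu (L k))%N; apply: le_trans (deviation jn).
rewrite /phase_u /phase_v /U /V !natrD !natrM le_eqVlt; apply/orP; left; apply/eqP.
by congr `|_|; ring.
Qed.

(** Passing to the next level changes [alpha * g], up to an integer, by at most the drop of the
    Lyapunov function. The drops telescope, so intervals of radius [lyap k] around the corrected
    phases are nested. *)
Lemma exists_phase x : X x -> exists theta : R, forall k, exists N : int,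
  forall g, last_cut (lw (L k)) x g -> `|theta - (alpha * g%:R - N%:~R)| <= lyap k.
Proof.
move=> Xx.
have /choice[g gP] k : exists g, last_cut (lw (L k)) x g.
  exact: (exists_last_cut amX (level_factor k) Xx).
have /choice[N NP] k := cut_deviation Xx (gP k) (gP k.+1).
(* The integer parts are accumulated and removed so that the phases converge in the reals and not
   only modulo 1. *)
pose M := fix M k := if k is k'.+1 then (M k' + N k')%N else 0%N.
pose t k : R := alpha * (g k)%:R - (M k)%:R.
have tS k : `|t k.+1 - t k| <= lyap k - lyap k.+1.
  rewrite /t /= natrD; apply: le_trans (NP k); rewrite le_eqVlt; apply/orP; left; apply/eqP.
  by congr `|_|; ring.
have [theta thetaP] : exists theta, forall k, t k - lyap k <= theta <= t k + lyap k.
  apply: nested_point => k; first by have := tS k; rewrite ler_norml => /andP[]; lra.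
    by have := tS k; rewrite ler_norml => /andP[]; lra.
  have s0 : 0 <= spread alpha (L k) by rewrite addr_ge0.
  by have := lyapunov_ge_spread k; lra.
exists theta => k; exists (M k)%:Z => h /(last_cut_unique (gP k)) <-.
by rewrite ler_norml; have := thetaP k; rewrite /t -[((M k)%:Z)%:~R]/((M k)%:R) => /andP[]; lra.
Qed.

(** For [alpha] of denominator q the phases are multiples of 1/q. Once the spread is below 1/q both
    vanish, and with them the determinant, which is nonzero. *)
Lemma alpha_irrational : ~ range (@ratr R) alpha.
Proof.
move=> [r _ rE].
have q0 : 0 < (denq r)%:~R :> R by rewrite ltr0z denq_gt0.
have [K KP] := lyapunov_tends0 (divr_gt0 ltr01 q0).
have [vK _] := L_valid K; have := KP K (leqnn _); rewrite ltr_pdivlMr// => lq.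
have aE : alpha * (denq r)%:~R = (numq r)%:~R.
  by rewrite -rE /ratr divfK// gt_eqF.
have zero (a : R) (m : int) : a * (denq r)%:~R = m%:~R -> `|a| <= lyap K -> a = 0.
  move=> aE' al; have : `|m%:~R| < 1 :> R.
    rewrite -aE' normrM (gtr0_norm q0); apply: le_lt_trans lq.
    by rewrite ler_pM2r.
  rewrite -intr_norm -[1]/(1%:~R) ltr_int => m1.
  have m0 : m = 0 by lia.
  by apply/eqP; move/eqP: aE'; rewrite m0 mulf_eq0 (gt_eqF q0) orbF.
have spr := lyapunov_ge_spread K.
have pu : phase_u alpha (L K) = 0.
  apply: (zero _ (numq r * (size (lu (L K)))%:Z - (lnu (L K))%:Z * denq r)).
    by rewrite rmorphB /= !rmorphM /= -aE /phase_u /U; ring.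
  by apply: le_trans spr; rewrite lerDl.
have pv : phase_v alpha (L K) = 0.
  apply: (zero _ (numq r * (size (lv (L K)))%:Z - (lnv (L K))%:Z * denq r)).
    by rewrite rmorphB /= !rmorphM /= -aE /phase_v /V; ring.
  by apply: le_trans spr; rewrite lerDr.
have := det_gt0 vK; rewrite /det.
have -> : (lnv (L K))%:R * U R (L K) - (lnu (L K))%:R * V R (L K) =
    phase_u alpha (L K) * V R (L K) - phase_v alpha (L K) * U R (L K).
  by rewrite /phase_u /phase_v; ring.
by rewrite pu pv !mul0r subrr normr0 ltxx.
Qed.

Lemma alpha_eigenvalue : eigenvalues R X alpha.
Proof.
have /choice[theta thetaP] x : exists t : R, X x -> forall k, exists N : int,
    forall g, last_cut (lw (L k)) x g -> `|t - (alpha * g%:R - N%:~R)| <= lyap k.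
  have [/exists_phase[t tP]|nX] := pselect (X x); first by exists t.
  by exists 0.
exists (fun x => expi (2 * pi * theta x)); split.
- apply/within_cylinderP => x Xx W /nbhs_ballP[e /= e0 eW].
  have eE : e = (complex.Re e)%:C%C.
    by move: e0; rewrite ltcE => /andP[/eqP /= + _]; case: (e) => a b /= ->.
  have e0' : 0 < complex.Re e by rewrite -ltcR -eE.
  have [d d0 dP] := expi_near e0'.
  have [K KP] := lyapunov_tends0 (divr_gt0 d0 (ltr0n R 2)).
  have [M MP] := last_cut_bound amX (level_factor K).
  (* This window covers the last cut of [x] and the word read there, so [y] has the same last cut
     and hence nearly the same phase modulo 1. *)
  exists (M + size (lw (L K)))%N => y Xy yx; apply: eW.
  have [g cg] := exists_last_cut amX (level_factor K) Xx.
  have gM := MP _ _ Xx cg.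
  have cg' : last_cut (lw (L K)) y g.
    by apply: (last_cut_local _ yx cg); rewrite leq_add2r.
  have [N1 /(_ _ cg) H1] := thetaP x Xx K; have [N2 /(_ _ cg') H2] := thetaP y Xy K.
  rewrite -ball_normE /ball_ /=.
  have -> : expi (2 * pi * theta x) - expi (2 * pi * theta y) =
      - (expi (2 * pi * theta x) * (expi (2 * pi * (theta y - theta x)) - 1)).
    by rewrite mulrBr mulr1 -expiD mulrBr [2 * pi * theta x + _]addrC subrK opprB.
  rewrite normrN normrM norm_expi mul1r eE; apply: (dP _ (N1 - N2)).
  have lK := KP K (leqnn _); rewrite rmorphB /=.
  by move: H1 H2; rewrite !ler_norml ltr_norml => /andP[? ?] /andP[? ?]; apply/andP; split; lra.
- have [x Xx] := am_nonempty amX; exists x => //; exact: expi_neq0.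
- move=> x Xx; rewrite /shiftmap -/(int -> A).
  have Xs := am_shift amX 1 Xx.
  rewrite -expiD -mulrDr; set s := theta _; set t := theta x.
  have -> : s = (s - alpha - t) + (alpha + t) by ring.
  rewrite [in LHS]mulrDr expiD expi_eq1 ?mul1r// => d d0.
  have [K KP] := lyapunov_tends0 (divr_gt0 d0 (ltr0n R 3)).
  have [g cg] := exists_last_cut amX (level_factor K) Xx.
  have [h ch] := exists_last_cut amX (level_factor K) Xs.
  have [N1 /(_ _ cg)] := thetaP x Xx K; have [N2 /(_ _ ch)] := thetaP _ Xs K.
  have lK := KP K (leqnn _); have spr := lyapunov_ge_spread K.
  rewrite -/s -/t => H2 H1.
  have [N3 H3] : exists N : int, `|alpha * h%:R - alpha * g%:R - alpha - N%:~R| <= lyap K.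
    have s0 : 0 <= spread alpha (L K) by rewrite addr_ge0.
    (* Either the cut recedes by one, which adds exactly [alpha], or the origin becomes a cut and a
       whole block is dropped, at the cost of its phase. *)
    have [->|[-> [E|E]]] := last_cut_shift (level_state K) Xx cg ch.
    - exists 0; rewrite -natr1; have -> : alpha * (g%:R + 1) - alpha * g%:R - alpha - 0%:~R = 0 by ring.
      by rewrite normr0 (le_trans s0).
    - exists (- (lnu (L K))%:Z); apply: le_trans spr.
      have -> : alpha * 0%:R - alpha * g%:R - alpha - (- (lnu (L K))%:Z)%:~R = - phase_u alpha (L K).
        by rewrite /phase_u /U -E -natr1 rmorphN /= -[(_%:Z)%:~R]/(_%:R); ring.
      by rewrite normrN lerDl.
    - exists (- (lnv (L K))%:Z); apply: le_trans spr.
      have -> : alpha * 0%:R - alpha * g%:R - alpha - (- (lnv (L K))%:Z)%:~R = - phase_v alpha (L K).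
        by rewrite /phase_v /V -E -natr1 rmorphN /= -[(_%:Z)%:~R]/(_%:R); ring.
      by rewrite normrN lerDr.
  exists (N3 - N2 + N1); rewrite rmorphD rmorphB /=.
  by move: H1 H2 H3; rewrite !ler_norml ltr_norml => /andP[? ?] /andP[? ?] /andP[? ?]; apply/andP; split; lra.
Qed.

End Eigenfunction.

(** * The lower bound *)

Section LowerBound.
Variables (R : realType) (A : finType).
Implicit Types X : set (fullshift A).

Lemma complexityE X q : complexity X q = cpx X q.
Proof.
rewrite /complexity /cpx size_map -cardE; apply: eq_card => w; rewrite !inE.
apply/idP/idP => [/set_mem[x [Xx [i wi]]]|/asboolP[x [i [Xx wi]]]].
  apply/asboolP; exists x, i; split=> //; rewrite /occ size_tuple.
  apply: (@eq_from_nth _ (x 0)); first by rewrite size_win size_tuple.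
  move=> k; rewrite size_win => kq; rewrite nth_win// -(tnth_nth _ _ (Ordinal kq)).
  by rewrite wi.
apply/mem_set; exists x; split=> //; exists i => k.
by rewrite (tnth_nth (x 0)) (occ_nth _ wi)// size_tuple.
Qed.

(** Otherwise the complexity would grow by at least two at every length from [Q] on, which is slope
    2. *)
Lemma often_increment_one X (eps : R) Qmin : aperiodic_minimal X -> 0 < eps ->
  (forall Q, (Qmin <= Q)%N -> (cpx X Q)%:R <= (3 / 2 - eps) * Q%:R :> R) ->
  forall Q, exists2 Q', (Q <= Q')%N & cpx X Q'.+1 = (cpx X Q').+1.
Proof.
move=> amX e0 bound Q; apply: contrapT => none.
have two n : (2 * n <= cpx X (Q + n))%N.
  elim: n => [//|n IH]; rewrite addnS.
  have [E|ne] := eqVneq (cpx X (Q + n).+1) (cpx X (Q + n)).+1.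
    by case: none; exists (Q + n)%N => //; exact: leq_addr.
  by have := cpx_lt amX (Q + n); lia.
have := bound (Q + (Qmin + 4 * Q).+1)%N ltac:(lia).
have : (2 * (Qmin + 4 * Q).+1)%:R <= (cpx X (Q + (Qmin + 4 * Q).+1))%:R :> R by rewrite ler_nat.
have : (4 * (Q + (Qmin + 4 * Q).+1) >= 3 * (Q + (Qmin + 4 * Q).+1))%N by lia.
have : 0 <= eps * (Q + (Qmin + 4 * Q).+1)%:R by rewrite mulr_ge0// ltW.
have : (3 * (Q + (Qmin + 4 * Q).+1) < 4 * (Qmin + 4 * Q).+1)%N by lia.
rewrite -(ltr_nat R) !natrM; move: (cpx _ _)%:R ((Q + (Qmin + 4 * Q).+1)%:R) ((Qmin + 4 * Q).+1%:R) => a b c.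
by lra.
Qed.

Lemma irrational_eigenvalue X (eps : R) Qmin : aperiodic_minimal X ->
  0 < eps -> eps <= 1 / 4 ->
  (forall Q, (Qmin <= Q)%N -> (cpx X Q)%:R <= (3 / 2 - eps) * Q%:R :> R) ->
  exists2 alpha : R, eigenvalues R X alpha & ~ range (@ratr R) alpha.
Proof.
move=> amX e0 e4 bound.
have [L LP] := exists_levels amX e0 e4 bound (often_increment_one amX e0 bound).
have [alpha aP] : exists alpha, forall k, slope_min R (L k) <= alpha <= slope_max R (L k).
  apply: nested_point => k; have [vk nk] := LP k.
  - by have [] := slope_next vk nk.
  - by have [] := slope_next vk nk.
  - by rewrite /slope_min /slope_max ge_min le_max lexx.
exists alpha; first exact: (alpha_eigenvalue amX e0 e4 bound LP aP).
exact: (alpha_irrational amX e0 e4 bound LP aP).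
Qed.

Lemma complexity_limsup_lt X (r : R) : (complexity_limsup R X < r%:E)%E ->
  exists2 s, s < r & exists N, forall q, (N <= q)%N -> (cpx X q)%:R <= s * q%:R.
Proof.
rewrite /complexity_limsup /limn_esup /limf_esup => /ereal_inf_lt[_ [V [N _ NV] <-] Vr].
have le q : (N <= q)%N -> (((complexity X q)%:R / q%:R)%:E <= ereal_sup [set ((complexity X q)%:R / q%:R : R)%:E | q in V])%E.
  by move=> Nq; apply: ereal_sup_ubound; exists q => //; exact: NV.
case: (ereal_sup _) Vr le => [s||] // Vr le.
- exists s => //; exists N.+1 => q Nq.
  have := le q (ltnW Nq); rewrite lee_fin complexityE ler_pdivrMr//.
  by rewrite ltr0n; lia.
- by have := le N (leqnn _).
Qed.

Theorem complexity_limsup_ge X : subshift X -> minimal X -> infinite_set X ->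
  eigenvalues R X `<=` range (@ratr R) -> ((3 / 2)%:E <= complexity_limsup R X)%E.
Proof.
move=> sX mX iX rat; rewrite leNgt; apply/negP => /complexity_limsup_lt[s s32 [N NP]].
have amX := aperiodic_minimal_subshift sX mX iX.
pose eps := Num.min (1 / 4) (3 / 2 - s).
have e0 : 0 < eps by rewrite lt_min; apply/andP; split; lra.
have e4 : eps <= 1 / 4 by rewrite ge_min lexx.
have es : s <= 3 / 2 - eps.
  have : eps <= 3 / 2 - s by rewrite ge_min lexx orbT.
  by lra.
have [//|alpha /rat aR aN] := @irrational_eigenvalue X eps N amX e0 e4.
  by move=> Q NQ; apply: le_trans (NP Q NQ) _; rewrite ler_wpM2r.
exact: aN.
Qed.

End LowerBound.

(** * A Toeplitz subshift with factorial periods *)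

(** Consecutive periods have quotient [j.+2], which tends to infinity: this is the source of the
    error term in [cpx_toeplitz_ratio]. *)
Definition period (j : nat) : int := ((j.+1)`!)%:Z.

Definition pdvd (j : nat) (d : int) : bool := (period j %| d)%Z.

Lemma period_gt0 j : 0 < period j.
Proof. by rewrite ltz_nat fact_gt0. Qed.

Lemma periodS j : period j.+1 = period j * j.+2%:Z.
Proof. by rewrite /period factS PoszM mulrC. Qed.

Lemma period_le j k : (j <= k)%N -> (period j %| period k)%Z.
Proof.
elim: k => [|k IH]; first by rewrite leqn0 => /eqP ->; exact: dvdzz.
rewrite leq_eqVlt => /orP[/eqP ->|/IH]; first exact: dvdzz.
by rewrite periodS; exact: dvdz_mulr.
Qed.

Lemma period_ge j : j%:Z < period j.
Proof.
elim: j => [//|j IH]; rewrite periodS; have := period_gt0 j; nia.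
Qed.

Lemma pdvd0 j : pdvd j 0. Proof. exact: dvdz0. Qed.

Lemma pdvdD j a b : pdvd j a -> pdvd j b -> pdvd j (a + b).
Proof. exact: rpredD. Qed.

Lemma pdvdB j a b : pdvd j a -> pdvd j b -> pdvd j (a - b).
Proof. exact: rpredB. Qed.

Lemma pdvd_congr j a b : pdvd j (a - b) -> pdvd j a = pdvd j b.
Proof.
move=> ab; apply/idP/idP => H; last by rewrite -(subrK b a); exact: pdvdD.
have -> : b = a - (a - b) by ring.
exact: pdvdB.
Qed.

Lemma pdvd_opp j a : pdvd j (- a) = pdvd j a.
Proof. exact: rpredN. Qed.

Lemma pdvd_le j k d : (j <= k)%N -> pdvd k d -> pdvd j d.
Proof. by move=> jk; apply: dvdz_trans; exact: period_le. Qed.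

Lemma pdvd_period j : pdvd j (period j). Proof. exact: dvdzz. Qed.

Lemma pdvd_modz j (s : int) : pdvd j (s - (s %% period j)%Z).
Proof. by rewrite {1}(divz_eq s (period j)) addrK; exact: dvdz_mull. Qed.

Lemma pdvd_small j d : pdvd j d -> `|d| < period j -> d = 0.
Proof.
move=> /dvdzP[m ->]; have p0 := period_gt0 j; rewrite normrM (gtr0_norm p0).
by rewrite -[ltRHS]mul1r ltr_pM2r// => m1; have -> : m = 0 by lia.
Qed.

Lemma pdvdS_period j : ~~ pdvd j.+1 (period j).
Proof.
apply/negP => /pdvd_small; have := period_gt0 j; rewrite periodS => p0.
by move=> /(_ ltac:(nia)); lia.
Qed.

Lemma pdvd_first_fail j d : ~~ pdvd j d -> exists2 k, (k < j)%N & pdvd k d && ~~ pdvd k.+1 d.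
Proof.
elim: j => [|j IH]; first by rewrite /pdvd dvd1z.
move=> nd; have [dj|/IH[k kj H]] := boolP (pdvd j d); first by exists j; rewrite ?dj.
by exists k => //; exact: ltnW.
Qed.

Lemma pdvd_eq0 d : (forall j, pdvd j d) -> d = 0.
Proof.
move=> H; apply: (pdvd_small (H `|d|%N)); rewrite -abszE; exact: period_ge.
Qed.

(* At level [J] the positions [i] with [(J+1)!] not dividing [i - s] are filled:
   [x i] is the parity of the largest [j] with [(j+1)!] dividing [i - s]. *)
Definition filled (J : nat) (s : int) (x : int -> bool) : Prop :=
  forall i j, (j < J)%N -> pdvd j (i - s) -> ~~ pdvd j.+1 (i - s) -> x i = odd j.

Definition toeplitz_factorial : set (fullshift bool) :=
  [set x | forall J, exists s, filled J s x].

Section ToeplitzFactorial.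
Local Notation X := toeplitz_factorial.

Lemma filled_le J K s x : (J <= K)%N -> filled K s x -> filled J s x.
Proof. by move=> JK f i j jJ; apply: f; exact: leq_trans JK. Qed.

Lemma filled_congr J s t x : pdvd J (s - t) -> filled J s x -> filled J t x.
Proof.
move=> st f i j jJ; have E : i - s - (i - t) = - (s - t) by ring.
rewrite -(@pdvd_congr j (i - s)); last by rewrite E pdvd_opp; apply: pdvd_le st; exact: ltnW.
rewrite -(@pdvd_congr j.+1 (i - s)); last by rewrite E pdvd_opp; apply: pdvd_le st.
exact: f.
Qed.

Lemma filled_shift J s x (n : int) : filled J s x -> filled J (s - n) (fun i => x (i + n)).
Proof. move=> f i j jJ; have -> : i - (s - n) = i + n - s by ring.
exact: (f (i + n) j).
Qed.

Lemma filled_agree J s x y i : filled J s x -> filled J s y ->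
  ~~ pdvd J (i - s) -> x i = y i.
Proof.
move=> fx fy nd; have [j jJ /andP[d1 d2]] := pdvd_first_fail nd.
by rewrite (fx i j)// (fy i j).
Qed.

(** If two hole classes modulo [period J.+1] were possible, each would fill the other, and a whole
    class modulo [period J] would carry the parity of [J]. The next level puts the opposite parity
    on part of that class. *)
Lemma filled_unique x J s t : X x -> filled J s x -> filled J t x -> pdvd J (s - t).
Proof.
move=> Xx; elim: J s t => [|J IH] s t fs ft; first exact: dvd1z.
have st : pdvd J (s - t) by apply: IH; [exact: filled_le fs|exact: filled_le ft].
apply: contraT => nst.
have all i : pdvd J (i - s) -> x i = odd J.
  move=> di; have [d1|d1] := boolP (pdvd J.+1 (i - s)); last exact: fs.
  apply: ft => //.
    by rewrite (@pdvd_congr J _ (i - s))//; have -> : i - t - (i - s) = s - t by ring.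
  apply: contra nst => d2; have -> : s - t = (i - t) - (i - s) by ring.
  exact: pdvdB.
have [u fu] := Xx J.+2.
have us : pdvd J (u - s) by apply: IH; [by apply: filled_le fu; exact: leqW|exact: filled_le fs].
have := fu (u + period J.+1) J.+1 (ltnSn _).
have -> : u + period J.+1 - u = period J.+1 by ring.
move=> /(_ (pdvd_period _) (pdvdS_period _)); rewrite all /=; first by case: odd.
have -> : u + period J.+1 - s = (u - s) + period J.+1 by ring.
by apply: pdvdD => //; exact: period_le.
Qed.

Section HoleFree.
(** The nested classes of [offset J] modulo [period J] have no common integer: [offset J] tends to
    infinity while [offset J.+1] stays below a fixed multiple of [period J]. Every position is thus
    filled at some level. *)
Definition offset J : int := \sum_(k < J) period k.

Lemma offsetS J : offset J.+1 = offset J + period J.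
Proof. by rewrite /offset big_ord_recr. Qed.

Lemma pdvd_offset j J : (j <= J)%N -> pdvd j (offset J - offset j).
Proof.
elim: J => [|J IH]; first by rewrite leqn0 => /eqP ->; rewrite subrr pdvd0.
rewrite leq_eqVlt => /orP[/eqP ->|jJ]; first by rewrite subrr pdvd0.
have -> : offset J.+1 - offset j = (offset J - offset j) + period J by rewrite offsetS; ring.
by apply: pdvdD; [exact: IH|exact: period_le].
Qed.

Lemma offset_bounds J : J%:Z <= offset J /\ offset J.+1 <= 2 * period J.
Proof.
elim: J => [|J [IH1 IH2]]; first by rewrite offsetS /offset big_ord0.
rewrite offsetS in IH2; rewrite !offsetS periodS; have := period_gt0 J; split; nia.
Qed.

Lemma hole_free i : exists J, ~~ pdvd J.+1 (i - offset J.+1).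
Proof.
exists (`|i| + 2)%N; apply/negP => /pdvd_small; set J := (`|i| + 2)%N.
have [_ b2] := offset_bounds J; have [b1 _] := offset_bounds J.+1.
rewrite periodS; have := period_gt0 J => p0.
move=> /(_ ltac:(nia)); lia.
Qed.

Definition hole_free_point : fullshift bool := fun i => odd (ex_minn (hole_free i)).

Lemma filled_hole_free J : filled J (offset J) hole_free_point.
Proof.
move=> i j jJ d1 d2; rewrite /hole_free_point; case: ex_minnP => m m1 m2.
have E k : (k <= J)%N -> pdvd k (i - offset J) = pdvd k (i - offset k).
  move=> kJ; apply: pdvd_congr; have -> : i - offset J - (i - offset k) = - (offset J - offset k) by ring.
  by rewrite pdvd_opp pdvd_offset.
have mj : (m <= j)%N by apply: m2; rewrite -E.
move: mj; rewrite leq_eqVlt => /orP[/eqP -> //|mj].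
by move: m1; rewrite -E ?(leq_trans mj)// 1?ltnW// (pdvd_le mj).
Qed.

Lemma hole_free_in : X hole_free_point.
Proof. by move=> J; exists (offset J); exact: filled_hole_free. Qed.
End HoleFree.

(** There are finitely many classes modulo [period J], so a single window refutes all the wrong
    ones. *)
Lemma filled_window J x : exists M : nat, forall y s,
  cylinder x M y -> filled J s y -> filled J s x.
Proof.
have /choice[bad badP] (s : int) : exists i : int, ~ filled J s x ->
    ~ forall j, (j < J)%N -> pdvd j (i - s) -> ~~ pdvd j.+1 (i - s) -> x i = odd j.
  have [fs|/existsNP[i ni]] := pselect (filled J s x); first by exists 0.
  by exists i.
pose P := `|period J|%N; have p0 := period_gt0 J; have pn : period J != 0 by rewrite gt_eqF.
exists (\max_(k < P) `|bad k%:Z|)%N => y s yx fs.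
have sP : (absz (s %% period J)%Z < P)%N.
  by have := ltz_mod s pn; have := modz_ge0 s pn; rewrite /P; lia.
have sE : (absz (s %% period J)%Z)%:Z = (s %% period J)%Z by rewrite gez0_abs// modz_ge0.
have ss := pdvd_modz J s.
apply: (@filled_congr J (s %% period J)%Z); first by rewrite -opprB pdvd_opp.
apply: contrapT => nf; apply: (badP _ nf) => j jJ d1 d2.
rewrite -yx; first exact: (filled_congr ss fs).
by rewrite -sE; apply: (@leq_bigmax _ (fun k : 'I_P => `|bad k%:Z|%N) (Ordinal sP)).
Qed.

Lemma toeplitz_closed : closed X.
Proof.
apply/closed_cylinderP => x xX J; have [M HM] := filled_window J x.
by have [y Xy yx] := xX M; have [s fs] := Xy J; exists s; exact: HM yx fs.
Qed.

Lemma toeplitz_shift x n : X x -> X (fun i => x (i + n)).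
Proof. by move=> Xx J; have [s fs] := Xx J; exists (s - n); exact: filled_shift. Qed.

Lemma toeplitz_subshift : subshift X.
Proof.
split; first exact: toeplitz_closed.
by apply: shiftmap_image => y Xy; exact: toeplitz_shift.
Qed.

(* The window of [x'] around [0] has at most one position left unfilled at level
   [K]; choosing the parity of [K], that position of [x] is filled with the value
   it has in [x']. *)
Lemma windows_recur x x' N : X x -> X x' -> exists K a, forall t, pdvd K (t - a) ->
  forall i : int, (`|i| <= N)%N -> x (i + t) = x' i.
Proof.
move=> Xx Xx'; pose K0 := (2 * N)%N.
have [s' fs'] := Xx' K0.+1.
have one i j : (`|i| <= N)%N -> (`|j| <= N)%N -> pdvd K0 (i - s') -> pdvd K0 (j - s') -> i = j.
  move=> iN jN di dj; apply/eqP; rewrite -subr_eq0; apply/eqP.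
  apply: (@pdvd_small K0).
    have -> : i - j = (i - s') - (j - s') by ring.
    exact: pdvdB.
  by have := period_ge K0; lia.
have [K [h [K1 hK hP]]] : exists K h, [/\ (K0 <= K <= K0.+1)%N, pdvd K (h - s') &
    forall i, (`|i| <= N)%N -> pdvd K (i - s') -> i = h /\ x' i = odd K].
  have [[h [hN dh]]|none] := pselect (exists h, (`|h| <= N)%N /\ pdvd K0.+1 (h - s')).
    have dh0 := pdvd_le (leqnSn K0) dh.
    have [E|E] := boolP (x' h == odd K0.+1).
      exists K0.+1, h; split=> //; first by rewrite leqnSn leqnn.
      move=> i iN /(pdvd_le (leqnSn K0)) di; have -> : i = h by exact: one.
      by split=> //; apply/eqP.
    exists K0, h; split=> //; first by rewrite leqnSn leqnn.
    move=> i iN di; have -> : i = h by exact: one.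
    by split=> //; move: E => /=; case: (x' h); case: odd.
  exists K0.+1, s'; split; [by rewrite leqnSn leqnn|by rewrite subrr pdvd0|].
  by move=> i iN di; case: none; exists i.
have [s fs] := Xx K.+1.
exists K.+1, (s + period K - h) => t dt i iN.
have E : i + t - s - (i - h + period K) = t - (s + period K - h) by ring.
have [di|ndi] := boolP (pdvd K (i - s')).
  have [ih ->] := hP i iN di.
  have E' k : (k <= K.+1)%N -> pdvd k (i + t - s) = pdvd k (period K).
    by move=> kK; apply: pdvd_congr; move: E; rewrite ih subrr add0r => ->; exact: pdvd_le dt.
  by apply: fs => //; rewrite E' ?pdvd_period ?pdvdS_period.
have [j jK /andP[d1 d2]] := pdvd_first_fail ndi.
have E' k : (k <= K)%N -> pdvd k (i + t - s) = pdvd k (i - s').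
  move=> kK; apply: pdvd_congr.
  have -> : i + t - s - (i - s') = (t - (s + period K - h)) + period K - (h - s') by ring.
  apply: pdvdB; last exact: pdvd_le hK.
  by apply: pdvdD; [apply: pdvd_le dt; exact: leqW|exact: period_le].
rewrite (fs _ j) ?E' ?d1//; [|exact: leqW|exact: ltnW].
by rewrite (fs' _ j)//; lia.
Qed.

Lemma toeplitz_minimal : minimal X.
Proof.
split; first by exists hole_free_point; exact: hole_free_in.
move=> Y sY YX [y Yy]; apply/seteqP; split=> // x Xx.
have [/closed_cylinderP cY _] := sY; apply: cY => N.
have [K [a H]] := windows_recur N (YX _ Yy) Xx.
exists (fun i => y (i + a)); first exact: (shift_by _ sY Yy).
by move=> i iN; apply: H => //; rewrite subrr pdvd0.
Qed.

Lemma toeplitz_no_period x (d : int) : X x -> (forall i : int, x (i + d) = x i) -> d = 0.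
Proof.
move=> Xx per; apply: pdvd_eq0 => J; have [s fs] := Xx J.
have fs' : filled J (s - d) x.
  by have := filled_shift (n := d) fs; rewrite (_ : (fun i : int => x (i + d)) = x)//; apply/funext.
by have := filled_unique Xx fs fs'; rewrite opprB addrCA subrr addr0.
Qed.

Lemma toeplitz_infinite : infinite_set X.
Proof.
pose g (n : nat) : fullshift bool := fun i => hole_free_point (i + n%:Z).
have gX n : X (g n) by apply: toeplitz_shift; exact: hole_free_in.
have ginj : injective g.
  move=> m n E; suff : m%:Z - n%:Z = 0 by lia.
  apply: (@toeplitz_no_period (g 0%N)) => // i.
  have := congr1 (fun x : fullshift bool => x (i - n%:Z)) E; rewrite /g !addr0 subrK => <-.
  by congr hole_free_point; ring.
move=> finX; apply: infinite_nat; apply: (@card_le_finite _ _ _ (g @` setT)).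
  by rewrite (card_le_eqr (inj_card_eq _))// => m n _ _; exact: ginj.
by apply: sub_finite_set finX => _ [n _ <-].
Qed.

(** * Complexity of the Toeplitz subshift *)

(** Off the multiples of [period J] this is the parity of the largest [j] with [period j] dividing
    [d]. On them it equals [odd J], as if all remaining holes were filled at level [J]. *)
Definition pattern (J : nat) (d : int) : bool :=
  odd (count (fun j => pdvd j.+1 d) (iota 0 J)).

(** The exceptional window: the hole, at position [P], holds the symbol opposite to that of
    [pattern J]. *)
Definition hole_word (J P q : nat) : seq bool :=
  win (fun d : int => if d == 0 then ~~ odd J else pattern J d) (- P%:Z) q.

Lemma pattern_dvd J d : pdvd J d -> pattern J d = odd J.
Proof.
move=> dJ; rewrite /pattern; congr odd; rewrite -[RHS](size_iota 0 J); apply/eqP.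
rewrite -all_count; apply/allP => j; rewrite mem_iota add0n => /andP[_ jJ].
exact: pdvd_le dJ.
Qed.

Lemma patternS J d : ~~ pdvd J.+1 d -> pattern J.+1 d = pattern J d.
Proof.
by move=> nd; rewrite /pattern -addn1 iotaD count_cat add0n /= (negbTE nd) !addn0.
Qed.

Lemma pattern_congr J a b : pdvd J (a - b) -> pattern J a = pattern J b.
Proof.
move=> ab; rewrite /pattern; congr odd; apply: eq_in_count => j.
rewrite mem_iota add0n => /andP[_ jJ]; apply: pdvd_congr; exact: pdvd_le ab.
Qed.

Lemma filled_pattern J s x i : filled J s x -> ~~ pdvd J (i - s) ->
  x i = pattern J (i - s).
Proof.
elim: J => [|J IH] fx; first by rewrite /pdvd dvd1z.
have [d nd|nd _] := boolP (pdvd J (i - s)).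
  by rewrite patternS// pattern_dvd// (fx i J).
rewrite patternS; first by apply: IH => //; apply: filled_le fx.
by apply: contra nd; exact: pdvd_le.
Qed.

Lemma win_pattern J s q :
  win (pattern J) (- s) q \in [seq win (pattern J) (- k%:Z) q | k <- iota 0 `|period J|%N].
Proof.
have pn : period J != 0 by rewrite gt_eqF ?period_gt0.
have r0 := modz_ge0 s pn; have rP := ltz_mod s pn.
apply/mapP; exists (absz (s %% period J)%Z); first by rewrite mem_iota; lia.
apply: eq_win => k _; apply: pattern_congr; rewrite gez0_abs//.
have -> : - s + k%:Z - (- (s %% period J)%Z + k%:Z) = - ((s %/ period J)%Z * period J).
  by rewrite {1}(divz_eq s (period J)); ring.
by rewrite pdvd_opp; exact: dvdz_mull.
Qed.

(** Such a window meets at most one hole of level [J.+1]. If its symbol is [odd J] the window is one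
    of the periodic pattern, otherwise it is exceptional. *)
Lemma words_hole J q w : q%:Z <= period J.+1 -> w \in words X q ->
  w \in [seq win (pattern J) (- k%:Z) q | k <- iota 0 `|period J|%N] \/
  exists2 P, (P < q)%N & w = hole_word J P q.
Proof.
move=> qJ /mem_words[wq [x [i [Xx wx]]]].
have [s fs] := Xx J.+1.
have E : w = win x i q by rewrite -wx wq.
have out k : ~~ pdvd J.+1 (i + k%:Z - s) -> x (i + k%:Z) = pattern J (i + k%:Z - s).
  by move=> nd; rewrite (filled_pattern fs nd) patternS.
have [[P [Pq dP]]|none] := pselect (exists P, (P < q)%N /\ pdvd J.+1 (i + P%:Z - s)); last first.
  left; have -> : w = win (pattern J) (- (s - i)) q; last exact: win_pattern.
  rewrite E; apply: eq_win => k kq; rewrite out; first by congr pattern; ring.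
  by apply/negP => dk; apply: none; exists k.
have uniqP k : (k < q)%N -> pdvd J.+1 (i + k%:Z - s) -> k = P.
  move=> kq dk; suff : k%:Z - P%:Z = 0 by lia.
  apply: (@pdvd_small J.+1); last by lia.
  have -> : k%:Z - P%:Z = (i + k%:Z - s) - (i + P%:Z - s) by ring.
  exact: pdvdB.
have [xP|xP] := boolP (x (i + P%:Z) == odd J).
  left; have -> : w = win (pattern J) (- (s - i)) q; last exact: win_pattern.
  rewrite E; apply: eq_win => k kq; have -> : - (s - i) + k%:Z = i + k%:Z - s by ring.
  have [dk|] := boolP (pdvd J.+1 (i + k%:Z - s)); last exact: out.
  by rewrite pattern_dvd ?(pdvd_le _ dk)// (uniqP k kq dk) (eqP xP).
right; exists P => //; rewrite E; apply: eq_win => k kq.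
have [->|kP] := eqVneq k P.
  by rewrite addNr eqxx; move: xP; case: (x _); case: odd.
have -> : (- P%:Z + k%:Z == 0) = false by lia.
rewrite out; last by apply: contra kP => dk; rewrite (uniqP k kq dk).
apply: pattern_congr; have -> : i + k%:Z - s - (- P%:Z + k%:Z) = i + P%:Z - s by ring.
exact: pdvd_le dP.
Qed.

(** When the window contains no other multiple of [period J.+1], the symbol in the hole is the one
    [pattern J] puts there, so the word is counted already among the shorter patterns. *)
Lemma hole_word_pattern J P q : (P%:Z < period J.+1) -> q%:Z <= P%:Z + period J.+1 ->
  hole_word J.+1 P q = win (pattern J) (- P%:Z) q.
Proof.
move=> PJ qJ; apply: eq_win => k kq.
have [E|ne] := eqVneq (- P%:Z + k%:Z) 0.
  by rewrite E pattern_dvd ?pdvd0//= negbK.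
rewrite patternS//; apply: contra ne => /pdvd_small ->//; lia.
Qed.

Lemma cpx_toeplitz_short J q : q%:Z <= period J.+1 -> (cpx X q <= `|period J| + q)%N.
Proof.
move=> qJ; pose B := [seq win (pattern J) (- k%:Z) q | k <- iota 0 `|period J|%N] ++
  [seq hole_word J P q | P <- iota 0 q].
have sub : {subset words X q <= B}.
  move=> w /(words_hole qJ)[wP|[P Pq ->]]; rewrite mem_cat ?wP//.
  by apply/orP; right; apply/mapP; exists P; rewrite ?mem_iota.
apply: leq_trans (uniq_leq_size (uniq_words X _) sub) _.
by rewrite size_cat !size_map !size_iota.
Qed.

(** Only holes among the first or the last [q - N] positions give new words, which is a growth of
    two per letter; the others fall under [hole_word_pattern]. *)
Lemma cpx_toeplitz_long J q : period J.+1 <= q%:Z <= 2 * period J.+1 ->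
  (cpx X q <= `|period J| + `|period J.+1| + (q - `|period J.+1|).*2)%N.
Proof.
set N := `|period J.+1|%N; have p0 := period_gt0 J.+1.
have NE : N%:Z = period J.+1 by rewrite /N; lia.
move=> /andP[Nq qN].
pose B := [seq win (pattern J) (- k%:Z) q | k <- iota 0 `|period J|%N] ++
  [seq win (pattern J.+1) (- k%:Z) q | k <- iota 0 N] ++
  [seq hole_word J.+1 P q | P <- iota 0 (q - N)] ++
  [seq hole_word J.+1 P q | P <- iota N (q - N)].
have sub : {subset words X q <= B}.
  have qJ : q%:Z <= period J.+2 by rewrite periodS; nia.
  move=> w /(words_hole qJ); rewrite !mem_cat => -[wP|[P Pq ->]]; first by rewrite wP orbT.
  have [P1|P1] := ltnP P (q - N).
    by rewrite (_ : _ \in [seq _ | _ <- iota 0 (q - N)]) ?orbT//;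
      apply/mapP; exists P; rewrite ?mem_iota.
  have [P2|P2] := ltnP P N.
    by rewrite hole_word_pattern ?win_pattern// -NE; lia.
  rewrite (_ : _ \in [seq _ | _ <- iota N (q - N)]) ?orbT//.
  by apply/mapP; exists P; rewrite ?mem_iota//; lia.
apply: leq_trans (uniq_leq_size (uniq_words X _) sub) _.
by rewrite !size_cat !size_map !size_iota; lia.
Qed.

(** The two bounds peak at q = 2 [period J.+1]: up to there the quotient of the long bound by q
    increases, and afterwards that of the short bound decreases from 3/2. The value at the peak is
    3/2 + 1/(2 (J+2)). *)
Lemma cpx_toeplitz_ratio J q : period J.+1 <= q%:Z <= period J.+2 ->
  (2 * J.+2 * cpx X q <= (3 * J.+2 + 1) * q)%N.
Proof.
move=> /andP[Nq qN]; have p0 := period_gt0 J.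
have [q2|q2] := leP q%:Z (2 * period J.+1).
  have := @cpx_toeplitz_long J q; rewrite Nq q2 => /(_ isT).
  move: Nq q2; rewrite periodS; set M := `|period J|%N; have ME : period J = M%:Z by rewrite /M; lia.
  rewrite ME; have -> : absz (M%:Z * J.+2%:Z) = (M * J.+2)%N by lia.
  move: (cpx X q) => c; move: M {ME} => M; rewrite -!PoszM !lez_nat => Nq q2 H; nia.
have := @cpx_toeplitz_short J.+1 q qN.
move: q2; rewrite periodS; set M := `|period J|%N; have ME : period J = M%:Z by rewrite /M; lia.
rewrite ME; have -> : absz (M%:Z * J.+2%:Z) = (M * J.+2)%N by lia.
by move: (cpx X q) => c; nia.
Qed.

Lemma cpx_toeplitz_eventually (c : nat) : exists N, forall q, (N <= q)%N ->
  (2 * c.+1 * cpx X q <= (3 * c.+1 + 1) * q)%N.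
Proof.
exists `|period c.+1|%N => q Nq.
have [J JP] : exists J, [/\ (c <= J)%N, period J.+1 <= q%:Z & q%:Z <= period J.+2].
  have ex : exists J, q%:Z < period J.+1 by exists q; apply: (lt_trans (period_ge q)); rewrite periodS; have := period_gt0 q; nia.
  case: (ex_minnP ex) => m m1 m2; have p0 := period_gt0 c.+1.
  have cm : (c < m)%N.
    rewrite ltnNge; apply/negP => mc; have : period m.+1 <= period c.+1.
      have mc1 : (m.+1 <= c.+1)%N by [].
      by have := period_le mc1; rewrite dvdzE lez_nat => /dvdn_leq ->//; exact: fact_gt0.
    by lia.
  case: m cm m1 m2 => // m cm m1 m2; exists m; split=> //; last exact: ltW.
  rewrite leNgt; apply/negP => /m2; by rewrite ltnn.
case: JP => cJ q1 q2; have := @cpx_toeplitz_ratio J q; rewrite q1 q2 => /(_ isT).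
move: (cpx X q) => z H.
nia.
Qed.

Section Limsup.
Variable R : realType.

Lemma complexity_limsup_le (A : finType) (Y : set (fullshift A)) (r : R) N :
  (forall q, (N <= q)%N -> (cpx Y q)%:R <= r * q%:R) -> (complexity_limsup R Y <= r%:E)%E.
Proof.
move=> H; rewrite /complexity_limsup /limn_esup /limf_esup.
apply: (@le_trans _ _ (ereal_sup [set ((complexity Y q)%:R / q%:R : R)%:E | q in [set q | (N < q)%N]])).
  apply: ereal_inf_lbound; exists [set q | (N < q)%N] => //.
  by exists N.+1.
apply: ge_ereal_sup => _ [q Nq <-]; rewrite lee_fin complexityE ler_pdivrMr ?H//.
  exact: ltnW.
by rewrite ltr0n; apply: leq_trans Nq.
Qed.

Lemma complexity_limsup_toeplitz : (complexity_limsup R X <= (3 / 2)%:E)%E.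
Proof.
apply/lee_addgt0Pr => e e0.
have [c ce] : exists c : nat, c.+1%:R^-1 <= e.
  exists (Num.trunc e^-1); rewrite -[leRHS]invrK lef_pV2 ?posrE ?invr_gt0 ?ltr0n//.
  by apply/ltW/truncnS_gt.
have [N NP] := cpx_toeplitz_eventually c.
rewrite -EFinD; apply: (@complexity_limsup_le _ _ _ N) => q /NP.
rewrite -(ler_nat R) !natrM natrD natrM => H.
have c0 : 0 < c.+1%:R :> R by rewrite ltr0n.
have ce1 : 1 <= e * c.+1%:R by rewrite -ler_pdivrMr// mul1r.
have : c.+1%:R * (2 * (cpx X q)%:R) <= c.+1%:R * ((3 + 2 * e) * q%:R).
  apply: (@le_trans _ _ ((3 * c.+1%:R + 1) * q%:R)).
    by move: H; congr (_ <= _); ring.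
  have -> : c.+1%:R * ((3 + 2 * e) * q%:R) = (3 * c.+1%:R + 2 * (e * c.+1%:R)) * q%:R by ring.
  by apply: ler_wpM2r => //; lra.
rewrite ler_pM2l// => H2; have -> : (3 / 2 + e) * q%:R = (3 + 2 * e) * q%:R / 2 by field.
by rewrite ler_pdivlMr// mulrC.
Qed.

End Limsup.

(** * Eigenvalues of the Toeplitz subshift *)

Section Eigenvalues.
Variable R : realType.
Implicit Types (s t : R).

(** As long as the cosine is nonnegative, doubling the angle at least doubles [1 - cos], which stays
    at most 1; so it vanishes. *)
Lemma cos_double_ge0 t : (forall m : nat, 0 <= cos (m%:R * t)) -> cos t = 1.
Proof.
move=> H; apply/eqP; rewrite eq_le cos_le1 /=; rewrite leNgt; apply/negP => c1.
have grow k : (2 ^ k)%:R * (1 - cos t) <= 1 - cos ((2 ^ k)%:R * t).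
  elim: k => [|k IH]; first by rewrite !mul1r.
  set s := (2 ^ k)%:R * t in IH.
  have -> : (2 ^ k.+1)%:R * t = s *+ 2 by rewrite /s expnS natrM mulr2n; ring.
  have := H (2 ^ k)%N; rewrite -/s cos_mulr2n => c0.
  have := cos_le1 s; rewrite expnS natrM.
  by move: (cos t) (cos s) ((2 ^ k)%:R) IH c0 => a b d; nra.
have [k kP] : exists k : nat, (1 - cos t)^-1 < k%:R.
  by exists (Num.trunc (1 - cos t)^-1).+1; exact: truncnS_gt.
have d0 : 0 < 1 - cos t by rewrite subr_gt0.
have : 1 < k%:R * (1 - cos t) by rewrite -ltr_pdivrMr// mul1r.
have k2 : k%:R <= (2 ^ k)%:R :> R by rewrite ler_nat ltnW// ltn_expl.
have := grow k; have := H (2 ^ k)%N; have := ler_wpM2r (ltW d0) k2; lra.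
Qed.

Lemma cos_eq1_int t : cos (2 * pi * t) = 1 -> exists n : int, t = n%:~R.
Proof.
set n := Num.floor t; move=> c1.
have p0 := pi_gt0 R.
have /andP[f0 f1] : 0 <= t - n%:~R < 1.
  by have := floor_itv t; rewrite -/n intrD subr_ge0 ltrBlDl addrC.
have cf : cos (2 * pi * (t - n%:~R)) = 1.
  have E : expi (2 * pi * t) = expi (2 * pi * (t - n%:~R)).
    by rewrite -{1}(subrK n%:~R t) mulrDr expiD expi_int mulr1.
  by have := congr1 (@complex.Re R) E; rewrite /= c1.
exists n; apply/eqP; rewrite -subr_eq0; move: (t - _) f0 f1 cf => f f0 f1 cf.
have [f2|f2] := leP f (1 / 2).
  have /eqP : 2 * pi * f = 0.
    apply: cos_inj; rewrite ?cos0 ?in_itv//=; apply/andP; split; nra.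
  by rewrite !mulf_eq0 (gt_eqF p0) pnatr_eq0.
have c2 : cos (2 * pi * (1 - f)) = 1.
  have -> : 2 * pi * (1 - f) = - (2 * pi * f) + pi *+ 2 by rewrite mulr2n; ring.
  by rewrite cosD cos2pi sin2pi cosN sinN cf; ring.
have : 2 * pi * (1 - f) = 0.
  by apply: cos_inj; rewrite ?c2 ?cos0// in_itv/=; apply/andP; split; nra.
by nra.
Qed.

Lemma expi_near1_cos t : `|expi t - 1| < 2^-1 :> R[i] -> 0 <= cos t.
Proof.
have -> : (2^-1 : R[i]) = (2^-1 : R)%:C%C by rewrite fmorphV rmorph_nat.
rewrite normc_def ltcR /= => H; rewrite leNgt; apply/negP => c0.
have : `|cos t - 1| <= Num.sqrt ((cos t - 1) ^+ 2 + (sin t - 0) ^+ 2).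
  by rewrite -sqrtr_sqr ler_wsqrtr// lerDl sqr_ge0.
by move: H; have := ler_norm (- (cos t - 1)); rewrite normrN; lra.
Qed.

Lemma eigenfunction_shift (f : fullshift bool -> R[i]^o) gamma x (n : nat) :
  (forall x, X x -> f (shiftmap x) = expi (2 * pi * gamma) * f x) -> X x ->
  f (fun i => x (i + n%:Z)) = expi (n%:R * (2 * pi * gamma)) * f x.
Proof.
move=> fs Xx; elim: n => [|n IH].
  by rewrite mul0r expi0 mul1r; congr f; apply/funext => i; rewrite addr0.
have -> : (fun i => x (i + n.+1%:Z)) = shiftmap (fun i => x (i + n%:Z)).
  by apply/funext => i; rewrite /shiftmap; congr x; lia.
rewrite fs ?IH; last exact: toeplitz_shift.
by rewrite mulrA -expiD -natr1; congr (expi _ * _); ring.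
Qed.

(** A point returns near itself along a whole arithmetic progression of difference [P]. The
    eigenfunction hardly moves there, so all multiples of [gamma * P] stay in the right half of the
    circle, which forces [gamma * P] to be an integer. *)
Lemma toeplitz_eigenvalues : eigenvalues R X `<=` range (@ratr R).
Proof.
move=> gamma [f [cf [x0 Xx0 f0] fs]].
(* A quarter, so that the difference of two such estimates is below one half. *)
have e0 : 0 < `|f x0| / 4 by rewrite divr_gt0 ?normr_gt0.
have [|N HN] := (within_cylinderP X f).1 cf x0 Xx0 (ball (f x0) (`|f x0| / 4)).
  exact: nbhsx_ballx.
have [K [a Ka]] := windows_recur N Xx0 Xx0.
set P := `|period K|%N; have PE : P%:Z = period K by rewrite /P; have := period_gt0 K; lia.
have pn : period K != 0 by rewrite gt_eqF ?period_gt0.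
pose b := absz (a %% period K)%Z.
have bE : b%:Z = (a %% period K)%Z by rewrite gez0_abs ?modz_ge0.
have close (m : nat) : `|expi ((b + m * P)%N%:R * (2 * pi * gamma)) - 1| < 4^-1 :> R[i].
  have Xy : X (fun i => x0 (i + (b + m * P)%N%:Z)) by exact: toeplitz_shift.
  have := HN _ Xy; rewrite (eigenfunction_shift _ fs Xx0) => /(_ _)/wrap[].
    move=> i iN; apply: Ka => //; rewrite PoszD PoszM bE PE.
    have -> : (a %% period K)%Z + m%:Z * period K - a = (m%:Z - (a %/ period K)%Z) * period K.
      by rewrite {2}(divz_eq a (period K)); ring.
    exact: dvdz_mull.
  rewrite -ball_normE /ball_ /= -{1}[f x0]mul1r -mulrBl normrM distrC.
  by rewrite [ltRHS]mulrC ltr_pM2r// normr_gt0.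
have near (m : nat) : 0 <= cos (m%:R * (2 * pi * (gamma * P%:R))).
  apply: expi_near1_cos; set mu := expi _; set l := expi (b%:R * (2 * pi * gamma)).
  have E : expi ((b + m * P)%N%:R * (2 * pi * gamma)) = l * mu.
    by rewrite -expiD natrD natrM; congr expi; ring.
  have := close 0%N; have := close m; rewrite E mul0n addn0 -/l => H1 H2.
  have -> : mu - 1 = l^-1 * ((l * mu - 1) - (l - 1)).
    by field; exact: expi_neq0.
  rewrite normrM normrV ?unitfE ?expi_neq0// norm_expi invr1 mul1r.
  apply: le_lt_trans (ler_normB _ _) _.
  have -> : (2^-1 : R[i]) = 4^-1 + 4^-1 by field.
  exact: ltrD.
have [n nE] := cos_eq1_int (cos_double_ge0 near).
exists (n%:~R / P%:R) => //; rewrite fmorph_div rmorph_int rmorph_nat -nE mulfK//.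
by rewrite pnatr_eq0; have := period_gt0 K; lia.
Qed.

End Eigenvalues.

(** * The odometer as maximal equicontinuous factor *)

(** The class of the holes at level [J]; over all [J] these are the coordinates of [x] in the
    odometer. The default 0 is never taken on the subshift, where some class always fits. *)
Definition residue (x : fullshift bool) (J : nat) : int :=
  (xget 0 [set s | filled J s x] %% period J)%Z.

Lemma filled_residue J x : X x -> filled J (residue x J) x.
Proof.
move=> Xx; have /(xgetPex 0) fs : exists s, [set s | filled J s x] s by exact: Xx.
exact: (filled_congr (pdvd_modz _ _) fs).
Qed.

Lemma residueE x J s : X x -> filled J s x -> residue x J = (s %% period J)%Z.
Proof.
move=> Xx fs; have fr := filled_residue (J := J) Xx.
have := filled_unique Xx fr fs; rewrite /pdvd -eqz_mod_dvd => /eqP <-.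
by rewrite /residue modz_mod.
Qed.

Lemma residue_shift x (n : int) : X x ->
  residue (fun i => x (i + n)) = (fun J => ((residue x J - n) %% period J)%Z).
Proof.
move=> Xx; apply/funext => J; apply: residueE; first exact: toeplitz_shift.
by apply: filled_shift; exact: filled_residue.
Qed.

Lemma residue_local x J : X x -> exists M, forall y, X y -> cylinder x M y ->
  residue y J = residue x J.
Proof.
move=> Xx; have [M HM] := filled_window J x; exists M => y Xy yx.
rewrite (residueE Xx (HM _ _ yx (filled_residue (J := J) Xy))).
by rewrite /residue modz_mod.
Qed.

Lemma residue_differ x y i : X x -> X y -> residue x = residue y -> x i <> y i ->
  forall J, pdvd J (i - residue x J).
Proof.
move=> Xx Xy E xy J; apply: contraT => nd; case: xy.
apply: filled_agree nd; first exact: filled_residue.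
by rewrite E; exact: filled_residue.
Qed.

Lemma residue_eventually x y : X x -> X y -> residue x = residue y ->
  exists M : nat, forall i : int, (M < `|i|)%N -> x i = y i.
Proof.
move=> Xx Xy E; have [[i xyi]|none] := pselect (exists i, x i <> y i); last first.
  by exists 0%N => i _; apply: contrapT => xyi; apply: none; exists i.
exists `|i|%N => j ij; apply: contrapT => xyj; have : j - i = 0; last by lia.
apply: pdvd_eq0 => J; have -> : j - i = (j - residue x J) - (i - residue x J) by ring.
by apply: pdvdB; apply: residue_differ Xx Xy E _ J.
Qed.

(** Points with the same residues can differ only at a position that is a hole at every level, and
    over these residues there is none. *)
Lemma residue_hole_free x : X x -> residue x = residue hole_free_point -> x = hole_free_point.
Proof.
move=> Xx E; apply/funext => i; apply: contrapT => xh.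
have [J /negP] := hole_free i; apply; have Xh := hole_free_in.
have := residue_differ Xx Xh E xh J.+1; rewrite E.
rewrite (residueE Xh (@filled_hole_free J.+1)) => d.
rewrite (@pdvd_congr J.+1 _ (i - (offset J.+1 %% period J.+1)%Z))//.
have -> : i - offset J.+1 - (i - (offset J.+1 %% period J.+1)%Z) =
  - (offset J.+1 - (offset J.+1 %% period J.+1)%Z) by ring.
by rewrite pdvd_opp pdvd_modz.
Qed.

(** * An ultrametric on residue sequences *)

Section Gap.
Variable R : realType.
Implicit Types y z : nat -> int.

Definition gap y z : R :=
  if pselect (exists J, y J != z J) is left e then (ex_minn e).+1%:R^-1 else 0.

Lemma gap_ge0 y z : 0 <= gap y z.
Proof. by rewrite /gap; case: pselect => // e; rewrite invr_ge0 ler0n. Qed.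

Lemma gap_lt y z N : gap y z < N.+1%:R^-1 <-> forall J, (J <= N)%N -> y J = z J.
Proof.
rewrite /gap; case: pselect => [e|ne]; last first.
  rewrite invr_gt0 ltr0n; split=> // _ J _; apply/eqP; apply: contrapT => /negP yz.
  by apply: ne; exists J.
case: ex_minnP => m m1 m2; rewrite ltf_pV2 ?posrE ?ltr0n// ltr_nat ltnS; split.
  move=> Nm J JN; apply/eqP; apply: contraTT Nm => /m2; rewrite -leqNgt => /leq_trans; exact.
by move=> H; rewrite ltnNge; apply/negP => /H/eqP; exact/negP.
Qed.

Lemma gap_le y z y' z' : (forall N, (forall J, (J <= N)%N -> y J = z J) ->
  forall J, (J <= N)%N -> y' J = z' J) -> gap y' z' <= gap y z.
Proof.
move=> H; rewrite leNgt; apply/negP; rewrite {2}/gap; case: pselect => [e|_].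
  by case: ex_minnP => m m1 m2 /gap_lt/H/(_ m (leqnn m))/eqP; exact/negP.
by rewrite ltNge gap_ge0.
Qed.

Lemma gapxx y : gap y y = 0.
Proof. by rewrite /gap; case: pselect => // e; exfalso; case: e => J; rewrite eqxx. Qed.

Lemma gap_eq0 y z : gap y z = 0 -> y = z.
Proof.
move=> g0; apply/funext => J.
have /gap_lt : gap y z < J.+1%:R^-1 by rewrite g0 invr_gt0 ltr0n.
exact.
Qed.

Lemma gap_sym y z : gap y z = gap z y.
Proof.
by apply/eqP; rewrite eq_le; apply/andP; split; apply: gap_le => N H J JN; rewrite H.
Qed.

Lemma gap_triangle y x z : gap x z <= gap x y + gap y z.
Proof.
wlog le : x z / gap x y <= gap y z => [wl|].
  have [|/ltW] := leP (gap x y) (gap y z); first exact: wl.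
  by rewrite gap_sym (gap_sym x) addrC (gap_sym x z) => H; apply: wl; rewrite // gap_sym.
apply: (@le_trans _ _ (gap y z)); last by rewrite lerDr gap_ge0.
apply: gap_le => N yz J JN; rewrite -(yz J JN).
suff /gap_lt -> : gap x y < N.+1%:R^-1 by [].
by apply: le_lt_trans le _; apply/gap_lt.
Qed.

End Gap.

(** Only residue sequences realized in the subshift are kept, so the map onto them is surjective by
    construction and compactness is inherited. *)
Definition odometer (R : realType) : Type :=
  {y : nat -> int | `[< exists2 x, X x & y = residue x >]}.

HB.instance Definition _ (R : realType) := Choice.on (odometer R).

Section Odometer.
Variable R : realType.
Local Notation Y := (odometer R).
Implicit Types y z : Y.

Definition odometer_dist y z : R := gap R (val y) (val z).

Lemma odometer_dist0 y z : odometer_dist y z = 0 -> y = z.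
Proof. by move=> /gap_eq0; exact: val_inj. Qed.

HB.instance Definition _ := isMetric.Build R Y (fun y => gapxx R (val y)) odometer_dist0
  (fun y z => gap_sym R (val y) (val z)) (fun y x z => gap_triangle R (val y) (val x) (val z)).

Lemma ball_odometer y e : ball y e = [set z | odometer_dist y z < e].
Proof. by []. Qed.

Lemma odometer_shift y (n : int) :
  `[< exists2 x, X x & (fun J => ((val y J - n) %% period J)%Z) = residue x >].
Proof.
apply/asboolP; have /asboolP[x Xx ->] := valP y.
by exists (fun i => x (i + n)); [exact: toeplitz_shift|rewrite residue_shift].
Qed.

(** The sign is negative because shifting a point by [n] moves its holes by [- n]. *)
Definition odometer_add (n : int) y : Y :=
  exist _ (fun J => ((val y J - n) %% period J)%Z) (odometer_shift y n).

Lemma odometer_hole_free : `[< exists2 x, X x & residue hole_free_point = residue x >].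
Proof. by apply/asboolP; exists hole_free_point => //; exact: hole_free_in. Qed.

Definition to_odometer (x : fullshift bool) : Y :=
  insubd (exist _ (residue hole_free_point) odometer_hole_free : Y) (residue x).

Lemma val_to_odometer x : X x -> val (to_odometer x) = residue x.
Proof. by move=> Xx; rewrite /to_odometer insubdK//; apply/asboolP; exists x. Qed.

Lemma to_odometer_shift x (n : int) : X x ->
  to_odometer (fun i => x (i + n)) = odometer_add n (to_odometer x).
Proof.
move=> Xx; apply: val_inj; rewrite val_to_odometer; last exact: toeplitz_shift.
by rewrite residue_shift//= val_to_odometer.
Qed.

Lemma to_odometer_surj y : exists2 x, X x & to_odometer x = y.
Proof.
have /asboolP[x Xx E] := valP y; exists x => //; apply: val_inj.
by rewrite val_to_odometer.
Qed.

Lemma odometer_addK n : cancel (odometer_add n) (odometer_add (- n)).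
Proof.
move=> y; have [x Xx <-] := to_odometer_surj y.
rewrite -!to_odometer_shift//; last exact: toeplitz_shift.
by congr to_odometer; apply/funext => i; rewrite addrNK.
Qed.

Lemma odometer_add_lip n y z :
  odometer_dist (odometer_add n y) (odometer_add n z) <= odometer_dist y z.
Proof. by apply: gap_le => N H J JN /=; rewrite H. Qed.

Lemma odometer_add_continuous n : continuous (odometer_add n : Y -> Y).
Proof.
move=> y W /nbhs_ballP[e /= e0 eW]; apply/nbhs_ballP; exists e => //= z yz.
by apply: eW; apply: le_lt_trans yz; exact: odometer_add_lip.
Qed.

Lemma to_odometer_continuous : {within X, continuous to_odometer}.
Proof.
apply/within_cylinderP => x Xx W /nbhs_ballP[e /= e0 eW].
have [N Ne] : exists N : nat, N.+1%:R^-1 <= e.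
  exists (Num.trunc e^-1); rewrite -[leRHS]invrK lef_pV2 ?posrE ?invr_gt0 ?ltr0n//.
  by apply/ltW/truncnS_gt.
have /choice[M MP] : forall J, exists M, forall y : fullshift bool,
    X y -> cylinder x M y -> residue y J = residue x J by move=> J; exact: residue_local.
exists (\max_(J < N.+1) M J)%N => y Xy yx; apply: eW.
rewrite ball_odometer /=; apply: lt_le_trans Ne; apply/gap_lt => J JN.
rewrite !val_to_odometer//; apply/esym/MP => //; apply: cylinder_le yx.
exact: (@leq_bigmax _ (fun J : 'I_N.+1 => M J) (Ordinal (JN : (J < N.+1)%N))).
Qed.

Lemma toeplitz_compact : compact X.
Proof. exact: (subclosed_compact toeplitz_closed (@compact_fullshift _)). Qed.

Lemma to_odometer_image : to_odometer @` X = setT.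
Proof.
by apply/seteqP; split=> // y _; have [x Xx <-] := to_odometer_surj y; exists x.
Qed.

Lemma odometer_compact : compact [set: Y].
Proof.
rewrite -to_odometer_image; apply: continuous_compact toeplitz_compact.
exact: to_odometer_continuous.
Qed.

Definition odometer_system : dynsys R := Dynsys odometer_compact
  (odometer_addK 1) (odometer_addK (- 1)) (@odometer_add_continuous 1)
  (@odometer_add_continuous (- 1)).

Lemma odometer_equicontinuous : equicontinuous_dynsys odometer_system.
Proof.
move=> y e e0; apply/nbhs_ballP; exists e => //= z yz n.
apply: le_lt_trans yz; have it k m : odometer_dist (iter k (odometer_add m) y) (iter k (odometer_add m) z) <= odometer_dist y z.
  by elim: k => //= k IH; apply: le_trans IH; exact: odometer_add_lip.
by case: n => n; exact: it.
Qed.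

Lemma to_odometer_factor : factor_map X (@shiftmap bool) (to_odometer : _ -> odometer_system).
Proof.
split; [exact: to_odometer_continuous|exact: to_odometer_image|].
by move=> x Xx; exact: to_odometer_shift.
Qed.

Section Factor.
Variables (Z : dynsys R) (r : fullshift bool -> Z).
Hypotheses (rX : factor_map X (@shiftmap bool) r) (eqZ : equicontinuous_dynsys Z).

Lemma factor_iter x (n : nat) : X x -> r (fun i => x (i + n%:Z)) = iter n (@dyn R Z) (r x).
Proof.
have [_ _ rs] := rX; move=> Xx; elim: n => [|n IH].
  by congr r; apply/funext => i; rewrite addr0.
have -> : (fun i => x (i + n.+1%:Z)) = shiftmap (fun i => x (i + n%:Z)).
  by apply/funext => i; rewrite /shiftmap; congr x; lia.
by rewrite rs ?IH//; exact: toeplitz_shift.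
Qed.

(* Points with the same residues differ in at most one coordinate, so they
   are asymptotic; an equicontinuous factor identifies asymptotic points. *)
Lemma factor_residue x x' : X x -> X x' -> residue x = residue x' -> r x = r x'.
Proof.
move=> Xx Xx' E; apply: mdist_positivity; apply/eqP; rewrite eq_le mdist_ge0 andbT.
rewrite leNgt; apply/negP => d0; have d2 : 0 < mdist (r x) (r x') / 2 by rewrite divr_gt0.
have [rc _ _] := rX; have := eqZ (r x) d2.
move=> /((within_cylinderP X r).1 rc x Xx)[N NP].
have [M MP] := residue_eventually Xx Xx' E.
have [K [a Ka]] := windows_recur N Xx Xx.
have p0 := period_gt0 K.
have [n nE nK] : exists2 n : nat, (N + M < n)%N & pdvd K (n%:Z - a).
  exists (absz (a + (`|a| + N + M).+1%:Z * period K)); first by nia.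
  have -> : (absz (a + (`|a| + N + M).+1%:Z * period K))%:Z = a + (`|a| + N + M).+1%:Z * period K by nia.
  by rewrite addrC addKr; exact: dvdz_mull.
have c1 : cylinder x N (fun i => x (i + n%:Z)) by move=> i iN; exact: Ka.
have c2 : cylinder x N (fun i => x' (i + n%:Z)).
  by move=> i iN; rewrite -c1//; apply/esym/MP; lia.
have Z1 := NP _ (toeplitz_shift n%:Z Xx) c1; have Z2 := NP _ (toeplitz_shift n%:Z Xx') c2.
have back (z : fullshift bool) : X z -> iterz (- n%:Z) (r (fun i => z (i + n%:Z))) = r z.
  move=> Xz; rewrite factor_iter//; case: n {nE nK c1 c2 Z1 Z2} => [//|n].
  rewrite -NegzE /iterz; move: (r z) => w; elim: n.+1 w => [//|m IH] w.
  by rewrite iterSr [in LHS]iterS dynK IH.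
have := Z1 (- n%:Z); have := Z2 (- n%:Z); rewrite !back// => H2 H1.
have := metric_triangle (r x) (iterz (- n%:Z) (r x)) (r x').
by rewrite (metric_sym (r x) (iterz _ _)); lra.
Qed.

Definition odometer_factor (y : Y) : Z := r (xget hole_free_point (X `&` to_odometer @^-1` [set y])).

Lemma odometer_factorE x : X x -> r x = odometer_factor (to_odometer x).
Proof.
move=> Xx; rewrite /odometer_factor; case: xgetP => [x' _ [Xx' E]|/(_ x)[]//].
by apply: factor_residue; rewrite -?(val_to_odometer Xx) -?(val_to_odometer Xx') ?E.
Qed.

(** By compactness, points whose residues approach those of [x] while their images avoid [W] would
    cluster at a point with the residues of [x], whose image is [r x]. *)
Lemma odometer_factor_continuous : continuous odometer_factor.
Proof.
move=> y W; have [x Xx <-] := to_odometer_surj y; rewrite -(odometer_factorE Xx) => rW.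
have [rc _ _] := rX; apply: contrapT => nW.
pose F N := [set x' | [/\ X x', (forall J, (J <= N)%N -> residue x' J = residue x J) & ~ W (r x')]].
have Fne N : F N !=set0.
  apply: contrapT => FN; apply: nW; apply/nbhs_ballP; exists N.+1%:R^-1 => /=.
    by rewrite invr_gt0 ltr0n.
  move=> z; have [x' Xx' <-] := to_odometer_surj z.
  rewrite ball_odometer /= => /gap_lt; rewrite !val_to_odometer// => H.
  rewrite /preimage /= -odometer_factorE//; apply: contrapT => nx'; apply: FN.
  by exists x'; split=> // J JN; rewrite H.
pose FF := filter_from [set: nat] F.
have PF : ProperFilter FF.
  apply: filter_from_proper => //; apply: filter_from_filter; first by exists 0%N.
  move=> n m _ _; exists (maxn n m) => // z [Xz zr nz].
  by split; split=> // J JN; apply: zr; rewrite (leq_trans JN)// ?leq_maxl ?leq_maxr.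
have [|z [Xz clz]] := toeplitz_compact PF; first by exists 0%N => // z [].
have FFF N : FF (F N) by exists N.
have E : residue x = residue z.
  apply/funext => J; have [M HM] := residue_local J Xz.
  have [z' [[Xz' rz' _] zz']] := clz _ _ (FFF J) (nbhs_cylinder z M).
  by rewrite -(HM z')// rz'.
have rzW : nbhs (r z) W by rewrite -(factor_residue Xx Xz E).
have [M HM] := (within_cylinderP X r).1 rc z Xz W rzW.
have [z' [[Xz' _ nz'] zz']] := clz _ _ (FFF 0%N) (nbhs_cylinder z M).
by apply: nz'; exact: HM.
Qed.

End Factor.

Lemma to_odometer_MEF : is_MEF X (to_odometer : _ -> odometer_system).
Proof.
split; [exact: to_odometer_factor|exact: odometer_equicontinuous|].
move=> Z r rX eqZ; exists (odometer_factor r : odometer_system -> Z).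
split; last by move=> x Xx; exact: odometer_factorE.
have [_ rs rd] := rX; split.
- by apply: continuous_subspaceT => y; exact: odometer_factor_continuous.
- apply/seteqP; split=> // z _; have [x Xx <-] : (r @` X) z by rewrite rs.
  by exists (to_odometer x) => //; rewrite -odometer_factorE.
- move=> y _; have [x Xx <-] := to_odometer_surj y.
  have Xs : X (shiftmap x) by exact: toeplitz_shift.
  rewrite -(odometer_factorE rX eqZ Xx) -rd// (odometer_factorE rX eqZ Xs).
  by congr (odometer_factor r _); rewrite to_odometer_shift.
Qed.

Lemma toeplitz_almost_one_to_one : almost_one_to_one_over_MEF R X.
Proof.
exists odometer_system, to_odometer; split; first exact: to_odometer_MEF.
have Xh := hole_free_in; exists (to_odometer hole_free_point), hole_free_point.
apply/seteqP; split=> [x [Xx /= E]|x -> //].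
by apply: residue_hole_free => //; rewrite -(val_to_odometer Xx) E val_to_odometer.
Qed.

Lemma toeplitz_factorial_toeplitz : toeplitz R X.
Proof.
split; [exact: toeplitz_minimal|exact: toeplitz_almost_one_to_one|exact: toeplitz_eigenvalues].
Qed.

End Odometer.

End ToeplitzFactorial.

Theorem theorem1p9 (R : realType) :
  let S : set (\bar R) :=
    [set l | exists (A : finType) (X : set (fullshift A)),
       [/\ subshift X, infinite_set X, toeplitz R X & l = complexity_limsup R X]] in
  S (3 / 2)%:E /\ lbound S (3 / 2)%:E.
Proof.
split.
  exists bool, toeplitz_factorial.
  split; [exact: toeplitz_subshift|exact: toeplitz_infinite|exact: toeplitz_factorial_toeplitz|].
  apply/eqP; rewrite eq_le complexity_limsup_toeplitz andbT.
  apply: complexity_limsup_ge; [exact: toeplitz_subshift|exact: toeplitz_minimal|exact: toeplitz_infinite|].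
  exact: toeplitz_eigenvalues.
move=> _ [A [Y [sY iY [mY _ eY] ->]]]; exact: complexity_limsup_ge.
Qed.
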